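(* There exists a constant $C>0$ such that for all integers $l\ge 2$: for all $0<\varepsilon\le 1$, $$\Pr\left\{\sup_{z}|S_l(z)|>\varepsilon\right\}\le\frac{C}{l}\left\{\frac{\log^6 l}{\varepsilon^3}\right\},$$ and for all $\varepsilon\ge 1$, $$\Pr\left\{\sup_{z}|S_l(z)|>\varepsilon\right\}\le\frac{C}{l}\left\{\varepsilon^{-4/3}+\frac{\log^6 l}{\varepsilon^{7/3}}\right\},$$ where the suprema are over $z\in\mathbb{R}$.
   Context: $\mathbb{S}^2\subset\mathbb{R}^3$ is the unit sphere and $dx$ is its standard surface area measure (total mass $4\pi$). For each integer $l\ge 1$, $f_l(x)=\sum_{m=-l}^{l}a_{lm}Y_{lm}(x)$, where $\{Y_{lm}\}_{m=-l,\dots,l}$ are the standard complex spherical harmonics of degree $l$, orthonormal in $L^2(\mathbb{S}^2,dx)$, and the $a_{lm}$ are jointly (complex) Gaussian, with mean zero, $E[a_{lm}\overline{a_{lm'}}]=\frac{4\pi}{2l+1}\delta_m^{m'}$ and $a_{lm}=(-1)^m\overline{a_{l,-m}}$. Equivalently, $f_l$ is the real-valued centred Gaussian random field on $\mathbb{S}^2$ with covariance $E[f_l(x)f_l(y)]=P_l(\langle x,y\rangle)$, where $P_l$ is the Legendre polynomial of degree $l$ (with $P_l(1)=1$) and $\langle x,y\rangle$ is the Euclidean inner product in $\mathbb{R}^3$; in particular $E f_l(x)^2=1$. $\phi$ and $\Phi$ denote the standard Gaussian density and cumulative distribution function, and $\mathbb{I}$ is the indicator function. Define $$G_l(z)=\sqrt{l}\left[\int_{\mathbb{S}^2}\mathbb{I}(f_l(x)\le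 z)\,dx-4\pi\,\Phi(z)\right],\qquad h_{l;2}=\int_{\mathbb{S}^2}\left(f_l(x)^2-1\right)dx,$$ $$J_2(z)=-z\phi(z),\qquad S_l(z)=G_l(z)-\frac{J_2(z)}{2}\sqrt{l}\,h_{l;2}.$$ *)

(* Defs.v *)
From HB Require Import structures.
From mathcomp Require Import all_boot all_order all_algebra.
From mathcomp Require Import all_classical all_reals all_analysis measurable_realfun.
From mathcomp Require Import complex.

Set Implicit Arguments.
Unset Strict Implicit.
Unset Printing Implicit Defensive.

Import Order.TTheory GRing.Theory Num.Theory.
Import numFieldNormedType.Exports.

Local Open Scope classical_set_scope.
Local Open Scope ring_scope.
Local Open Scope complex_scope.

(* Points of R^3 are triples [((x1, x2), x3) : R * R * R]. *)
Definition sphere (R : realType) : set (R * R * R) :=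
  [set x | x.1.1 ^+ 2 + x.1.2 ^+ 2 + x.2 ^+ 2 = 1].

(* [t.1] is the colatitude and [t.2] the longitude. *)
Definition spherical_coord (R : realType) (t : R * R) : R * R * R :=
  (sin t.1 * cos t.2, sin t.1 * sin t.2, cos t.1).

Definition angles (R : realType) : set (R * R) :=
  `[0, pi] `*` `[0, 2 * pi].

(* Surface area measure of the unit sphere, [sin theta dtheta dphi] transported
   by spherical coordinates; as a measure on R^3 it is carried by [sphere R]. *)
Definition surface_area (R : realType) (A : set (R * R * R)) : \bar R :=
  (\int[lebesgue_measure \x lebesgue_measure]_(t in
      @angles R `&` @spherical_coord R @^-1` A) (sin t.1)%:E)%E.

Section surface_area_measure.
Variable R : realType.

Let measurable_sin : measurable_fun setT (@sin R).
Proof. by apply: continuous_measurable_fun; exact: continuous_sin. Qed.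

Let measurable_cos : measurable_fun setT (@cos R).
Proof. by apply: continuous_measurable_fun; exact: continuous_cos. Qed.

Lemma measurable_spherical_coord : measurable_fun setT (@spherical_coord R).
Proof.
have s1 : measurable_fun setT (fun t : R * R => sin t.1).
  exact: measurableT_comp.
have c1 : measurable_fun setT (fun t : R * R => cos t.1).
  exact: measurableT_comp.
have s2 : measurable_fun setT (fun t : R * R => sin t.2).
  exact: measurableT_comp.
have c2 : measurable_fun setT (fun t : R * R => cos t.2).
  exact: measurableT_comp.
by apply/measurable_fun_pair => //; apply/measurable_fun_pair;
  apply: measurable_funM.
Qed.

Lemma measurable_angles : measurable (@angles R).
Proof. exact: measurableX. Qed.

Let measurable_piece (A : set (R * R * R)) : measurable A ->
  measurable (@angles R `&` @spherical_coord R @^-1` A).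
Proof.
move=> mA; apply: measurableI; first exact: measurable_angles.
by rewrite -[X in measurable X]setTI; exact: measurable_spherical_coord.
Qed.

Let sin_ge0_angles (t : R * R) : angles t -> (0 <= (sin t.1)%:E)%E.
Proof.
by case; rewrite /= in_itv/= => /andP[t0 tpi] _; rewrite lee_fin sin_ge0_pi// t0.
Qed.

Let surface_area0 : surface_area (@set0 (R * R * R)) = 0%E.
Proof. by rewrite /surface_area preimage_set0 setI0 integral_set0. Qed.

Let surface_area_ge0 (A : set (R * R * R)) : (0 <= surface_area A)%E.
Proof. by apply: integral_ge0 => t [/sin_ge0_angles]. Qed.

Let surface_area_sigma_additive : semi_sigma_additive (@surface_area R).
Proof.
move=> F mF tF mUF.
rewrite /surface_area preimage_bigcup setI_bigcupr ge0_integral_bigcup.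
- apply: is_cvg_nneseries => n _ _.
  exact: surface_area_ge0.
- by move=> k; exact: measurable_piece.
- by apply: measurable_funTS; apply/measurable_EFinP; exact: measurableT_comp.
- by move=> t [k _] [/sin_ge0_angles].
- move=> i j _ _ [t [[_ Fi] [_ Fj]]]; apply: (tF i j I I).
  by exists (spherical_coord t).
Qed.

HB.instance Definition _ := isMeasure.Build _ _ _ (@surface_area R)
  surface_area0 surface_area_ge0 surface_area_sigma_additive.

End surface_area_measure.

Definition legendre (R : realType) (l : nat) : {poly R} :=
  (2 ^+ l * l`!%:R)^-1 *: (('X^2 - 1) ^+ l)^`(l).

(* [sphY_nneg l m] is Y_{lm} for [0 <= m <= l]: at the point of the sphere with
   colatitude theta and longitude phi one has
   [(x1 + i x2)^m = (sin theta)^m e^{i m phi}], so that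
   [(-1)^m (x1 + i x2)^m P_l^{(m)}(x3) = P_{lm}(cos theta) e^{i m phi}], with
   P_{lm} the associated Legendre function with Condon-Shortley phase. *)
Definition sphY_nneg (R : realType) (l m : nat) (x : R * R * R) : R[i] :=
  ((-1) ^+ m *
   Num.sqrt ((2 * l + 1)%:R / (4 * pi) * ((l - m)`!%:R / (l + m)`!%:R)) *
   ((legendre R l)^`(m)).[x.2])%:C * (x.1.1 +i* x.1.2) ^+ m.

Definition sphY (R : realType) (l : nat) (m : int) (x : R * R * R) : R[i] :=
  match m with
  | Posz n => sphY_nneg l n x
  | Negz n => (-1) ^+ n.+1 * (sphY_nneg l n.+1 x)^*
  end.

(* \sum_{m = -l}^{l} F m *)
Definition sum_order (V : nmodType) (l : nat) (F : int -> V) : V :=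
  \sum_(k < (2 * l).+1) F (k%:Z - l%:Z).

Section random_field.
Context d (T : measurableType d) (R : realType).

(* Degenerate laws ([s = 0]) are allowed. *)
Definition gaussian_rv (P : probability T R) (X : T -> R) : Prop :=
  measurable_fun setT X /\
  exists m s : R, forall A : set R, measurable A ->
    P (X @^-1` A) = if s == 0 then \d_m A else normal_prob m s A.

(* Jointly complex Gaussian: every real linear combination of the real and
   imaginary parts of the coefficients is Gaussian. *)
Definition jointly_gaussian (P : probability T R) (l : nat)
    (a : int -> T -> R[i]) : Prop :=
  forall u v : int -> R,
    gaussian_rv P (fun w =>
      sum_order l (fun m => u m * complex.Re (a m w) + v m * complex.Im (a m w))).

(* [E[Z] = c] for a complex random variable [Z]. *)
Definition has_mean (P : probability T R) (Z : T -> R[i]) (c : R[i]) : Prop :=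
  ('E_P[fun w => complex.Re (Z w)] = (complex.Re c)%:E)%E /\
  ('E_P[fun w => complex.Im (Z w)] = (complex.Im c)%:E)%E.

Record harmonic_coefficients (P : probability T R) (l : nat)
    (a : int -> T -> R[i]) : Prop := HarmonicCoefficients {
  coef_gaussian : jointly_gaussian P l a;
  coef_mean : forall m : int, (`|m| <= l)%N -> has_mean P (a m) 0;
  coef_cov : forall m m' : int, (`|m| <= l)%N -> (`|m'| <= l)%N ->
    has_mean P (fun w => a m w * (a m' w)^*)
      ((4 * pi / (2 * l + 1)%:R * (m == m')%:R)%:C);
  coef_real : forall m : int, (`|m| <= l)%N ->
    forall w, a m w = (-1) ^+ `|m|%N * (a (- m) w)^* }.

(* The sum is real when [coef_real] holds, whence the real part. *)
Definition eigenfield (l : nat) (a : int -> T -> R[i]) (w : T) (x : R * R * R) : R :=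
  complex.Re (sum_order l (fun m => a m w * sphY l m x)).

Definition std_normal_cdf (z : R) : R :=
  \int[lebesgue_measure]_(t in `]-oo, z]) normal_pdf 0 1 t.

Definition empirical_process (l : nat) (a : int -> T -> R[i]) (z : R) (w : T) : R :=
  Num.sqrt l%:R *
  (\int[@surface_area R]_(x in @sphere R) \1_[set y | eigenfield l a w y <= z] x
   - 4 * pi * std_normal_cdf z).

Definition h2 (l : nat) (a : int -> T -> R[i]) (w : T) : R :=
  \int[@surface_area R]_(x in @sphere R) (eigenfield l a w x ^+ 2 - 1).

Definition J2 (z : R) : R := - z * normal_pdf 0 1 z.

Definition S_process (l : nat) (a : int -> T -> R[i]) (z : R) (w : T) : R :=
  empirical_process l a z w - J2 z / 2 * Num.sqrt l%:R * h2 l a w.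

Definition sup_S (l : nat) (a : int -> T -> R[i]) (w : T) : \bar R :=
  ereal_sup (range (fun z : R => `|S_process l a z w|%:E)).

End random_field.

(* Main.v *)
(* By the addition theorem, f_l(x) is standard normal and (f_l(x), f_l(y)) is
   Gaussian with correlation P_l(<x, y>). If g(X) is a trigonometric polynomial
   of a standard normal X, then E g(X) g(Y) = sum_q b_q rho^q with b_q >= 0 for
   (X, Y) of correlation rho; when g is orthogonal to 1 and to x^2 - 1, only
   b_1 and the b_q with q >= 3 are present. Integrating rho = P_l(<x, y>) over
   the sphere kills b_1 and leaves
     E (int g(f_l) dx)^2 <= C ||g||^2 (|int P_l^3| + |int P_l^4|),
   which by approximation holds for g = 1_A minus its projection on these two
   functions. Sonin's function for the Legendre equation gives
   P_l^4 <= C / (l^2 (1 - t^2)), whence a bound C log l / l^2 on both moments.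
   The increments of S_l over (z, z'] thus have second moment at most
   C (log l / l) (Phi(z') - Phi(z)); chaining over a dyadic grid of mesh l^-2,
   with monotonicity of the empirical distribution between grid points, loses
   log^2 l, and Markov's inequality yields
     P(sup |S_l| > eps) <= C log^3 l / (l eps^2),
   which implies both bounds (the second one by the inequality of the means). *)

Require Import Defs.
From HB Require Import structures.
From mathcomp Require Import all_boot all_order all_algebra.
From mathcomp Require Import all_classical all_reals all_analysis measurable_realfun.
From mathcomp Require Import complex.
From mathcomp Require Import ring lra.

Set Implicit Arguments.
Unset Strict Implicit.
Unset Printing Implicit Defensive.

Import Order.TTheory GRing.Theory Num.Theory.
Import numFieldNormedType.Exports.

Local Open Scope classical_set_scope.
Local Open Scope ring_scope.

(** * Legendre polynomials *)

(** The compensators in S_l are exactly the projection of the indicator on 1 and x^2 - 1. The second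
    one must be removed because the integral of P_l^2 is of order 1/l, whereas moments of order log
    l / l^2 are wanted. The quartic moment obeys this by a pointwise bound, but the cubic one does
    not: |P_l|^3 only integrates to order l^(-3/2). It is first rewritten, by parts, as an integral
    of t (1 - t^2) P_l'^3 divided by a multiple of l^4, and this one can be estimated in absolute
    value. Trigonometric polynomials are used because the law of (f_l(x), f_l(y)) degenerates when
    the correlation is 1 or -1; the expectation of a cosine of a linear combination is insensitive
    to that and follows from one-dimensional Gaussian laws. The mesh l^-2 makes the error between
    grid points sqrt(l) (l^-2 + |h_{l;2}| / l) up to constants. Its second moment is O(1/l) even
    with a bound on h_{l;2} that ignores all cancellation. *)

Section legendre_algebra.
Variable R : realType.
Implicit Types (p q : {poly R}) (l n k : nat) (t : R).

Lemma derivn_XsubC_mul (a : R) p n :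
  (('X - a%:P) * p)^`(n.+1) = ('X - a%:P) * p^`(n.+1) + p^`(n) *+ n.+1.
Proof.
elim: n => [|n IH].
  by rewrite !derivn1 derivM derivXsubC mul1r mulr1n addrC.
rewrite derivnS IH derivD derivM derivXsubC mul1r -!derivnS derivMn -derivnS.
by rewrite [X in X + _]addrC -addrA; congr (_ + _); rewrite -mulrS.
Qed.

(** At the root [a] only the Leibniz term in which all [n] derivatives fall on the power survives.
    With the formula of Rodrigues this gives the value at 1. *)
Lemma horner_derivn_XsubC_exp (a : R) q n :
  ((('X - a%:P) ^+ n * q)^`(n)).[a] = n`!%:R * q.[a].
Proof.
elim: n q => [|n IH] q; first by rewrite expr0 !mul1r derivn0.
rewrite exprS -mulrA derivn_XsubC_mul hornerD hornerM hornerXsubC subrr mul0r.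
by rewrite add0r hornerMn IH factS natrM -mulr_natl mulrA.
Qed.

Let vpol l : {poly R} := ('X^2 - 1) ^+ l.

Let legendre_coef_neq0 l : (2 ^+ l * l`!%:R : R) != 0.
Proof. by rewrite mulf_neq0// ?expf_neq0// pnatr_eq0 -lt0n fact_gt0. Qed.

Lemma legendre1 l : (legendre R l).[1] = 1.
Proof.
rewrite /legendre hornerZ.
have -> : ('X^2 - 1 : {poly R}) = ('X - 1%:P) * ('X + 1%:P) by rewrite polyC1; ring.
rewrite exprMn horner_derivn_XsubC_exp horner_exp hornerD hornerX hornerC.
have -> : (1 + 1 : R) = 2 by ring.
by rewrite [l`!%:R * _]mulrC mulVf// legendre_coef_neq0.
Qed.

Lemma comp_polyN_derivn p n :
  (p \Po (- 'X))^`(n) = (-1) ^+ n *: (p^`(n) \Po (- 'X)).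
Proof.
elim: n => [|n IH]; first by rewrite !derivn0 scale1r.
rewrite derivnS IH derivZ deriv_comp -derivnS derivN derivX mulrN1.
by rewrite scalerN exprS mulN1r scaleNr.
Qed.

Lemma legendre_parity l : legendre R l \Po (- 'X) = (-1) ^+ l *: legendre R l.
Proof.
rewrite /legendre comp_polyZ scalerA [(-1) ^+ l * _]mulrC -scalerA; congr (_ *: _).
have vN : (('X^2 - 1) ^+ l) \Po (- 'X) = ('X^2 - 1 : {poly R}) ^+ l.
  by rewrite rmorphXn/= comp_polyB rmorphXn/= comp_polyX sqrrN -polyC1 comp_polyC.
have := comp_polyN_derivn (('X^2 - 1) ^+ l) l; rewrite vN => {2}->.
by rewrite scalerA -exprMn mulrNN mulr1 expr1n scale1r.
Qed.

(** Differentiating (X^2 - 1) v' = 2 l X v ([H0]) once gives the case n = 0, and each further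
    derivative raises n by one. *)
Lemma vpol_ode l n : ('X^2 - 1) * (vpol l)^`(n.+2) +
  (2 * (n.+1%:R - l%:R)) *: ('X * (vpol l)^`(n.+1)) +
  (n.+1%:R * (n%:R - 2 * l%:R)) *: (vpol l)^`(n) = 0.
Proof.
have H0 : ('X^2 - 1) * (vpol l)^`(1) = (2 * l%:R) *: ('X * vpol l).
  rewrite /vpol derivn1 -mul_polyC; case: l => [|l].
    by rewrite expr0 -polyC1 derivC mulr0 mulr0 polyC0 mul0r.
  rewrite deriv_exp derivB derivXn -polyC1 derivC subr0/= expr1.
  by rewrite polyC1 [_ ^+ l.+1]exprS -mulr_natr; ring.
elim: n => [|n IH].
  have := congr1 (@deriv R) H0.
  rewrite derivM derivB derivXn -polyC1 derivC subr0 polyC1 derivZ derivM derivX.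
  rewrite -!derivnS derivn0 -!mul_polyC/= expr1 => H.
  move/eqP: H; rewrite -subr_eq0 => /eqP H; rewrite -[RHS]H; ring.
have := congr1 (@deriv R) IH.
rewrite !derivD !derivZ !derivM derivB derivXn -polyC1 derivC subr0 polyC1 derivX deriv0.
rewrite -!derivnS => <-.
rewrite -!mul_polyC/= expr1; ring.
Qed.

(** This is [vpol_ode] at n = l + k. Legendre's equation is the case k = 0; higher k drive the
    ladder relations between spherical harmonics of neighbouring orders. *)
Lemma legendre_ode l k (t : R) :
  (1 - t ^+ 2) * ((legendre R l)^`(k.+2)).[t] =
  2 * k.+1%:R * t * ((legendre R l)^`(k.+1)).[t] -
  (l + k.+1)%:R * (l%:R - k%:R) * ((legendre R l)^`(k)).[t].
Proof.
have E n : ((legendre R l)^`(n)).[t] =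
    (2 ^+ l * l`!%:R)^-1 * ((vpol l)^`(l + n)).[t].
  by rewrite /legendre derivnZ hornerZ /vpol /derivn addnC iterD.
rewrite !E.
have := congr1 (horner^~ t) (vpol_ode l (l + k)).
rewrite !(hornerD, hornerZ, hornerM, hornerN, hornerX, horner_exp, hornerC, horner0) -!addnS.
set A := ((vpol l)^`(_)).[t]; set B := ((vpol l)^`(_)).[t].
set C := ((vpol l)^`(_)).[t]; set c := (_ * _)^-1 => H.
apply/eqP; rewrite -subr_eq0; apply/eqP; rewrite -[RHS](mulr0 (- c)) -[in RHS]H.
ring.
Qed.

End legendre_algebra.

(** * Integrals of polynomials over [-1, 1] *)

Section primitive.
Variable R : realType.
Implicit Types (p q : {poly R}) (f g df : R -> R).

Lemma le_of_is_derive f df (a b : R) : a <= b ->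
  (forall x, a <= x <= b -> is_derive x 1 f (df x)) ->
  (forall x, a <= x <= b -> 0 <= df x) -> f a <= f b.
Proof.
move=> ab fdf df0.
have [||c /[!in_itv]/= cab fba] := @MVT_segment R f df a b ab.
- by move=> x /[!in_itv]/= /andP[ax xb]; apply: fdf; rewrite !ltW.
- apply: derivable_within_continuous => x /[!in_itv]/= xab.
  by have := fdf x xab => -[].
- by rewrite -subr_ge0 fba mulr_ge0 ?subr_ge0// df0.
Qed.

Lemma le_sub_of_is_derive f df g dg (a b : R) : a <= b ->
  (forall x, a <= x <= b -> is_derive x 1 f (df x)) ->
  (forall x, a <= x <= b -> is_derive x 1 g (dg x)) ->
  (forall x, a <= x <= b -> `|df x| <= dg x) -> `|f b - f a| <= g b - g a.
Proof.
move=> ab fdf gdg dfg.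
have H1 : (g \- f) a <= (g \- f) b.
  apply: (@le_of_is_derive _ (fun x => dg x - df x)) => //.
    by move=> x xab; have ? := fdf x xab; have ? := gdg x xab; exact: is_deriveB.
  by move=> x xab; rewrite subr_ge0 (le_trans (ler_norm _))// dfg.
have H2 : (g \+ f) a <= (g \+ f) b.
  apply: (@le_of_is_derive _ (fun x => dg x + df x)) => //.
    by move=> x xab; have ? := fdf x xab; have ? := gdg x xab; exact: is_deriveD.
  move=> x xab; rewrite -lerBlDr sub0r (le_trans _ (dfg _ xab))//.
  by rewrite -normrN ler_norm.
rewrite ler_norml; move: H1 H2 => /=; lra.
Qed.

(** Antiderivatives are taken coefficientwise, so that integrals over [-1, 1] stay inside polynomial
    algebra until they meet the sphere. At i = 0 the division by zero returns 0, hence the constant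
    term vanishes. *)
Definition primitive p : {poly R} :=
  \poly_(i < (size p).+1) (p`_i.-1 / i%:R).

Lemma deriv_primitive p : (primitive p)^`() = p.
Proof.
apply/polyP => i; rewrite coef_deriv coef_poly ltnS; case: ltnP => [_|pi].
  by rewrite /= -[LHS]mulr_natr divfK// pnatr_eq0.
by rewrite mul0rn nth_default.
Qed.

(* The integral of [p] over [-1, 1]. *)
Definition pint p : R := (primitive p).[1] - (primitive p).[-1].

Lemma pint_deriv p : pint p^`() = p.[1] - p.[-1].
Proof.
have : `|(primitive p^`() - p).[1] - (primitive p^`() - p).[-1]| <= 0 - 0.
  apply: (@le_sub_of_is_derive (horner (primitive p^`() - p)) (fun=> 0) (fun=> 0) (fun=> 0)).
  - lra.
  - by move=> x _; apply: is_derive_eq; rewrite derivB deriv_primitive subrr horner0.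
  - by move=> x _; rewrite normr0.
rewrite subr0 normr_le0 !hornerE => /eqP; rewrite /pint; lra.
Qed.

Lemma pintD p q : pint (p + q) = pint p + pint q.
Proof.
rewrite -[in LHS](deriv_primitive p) -[in LHS](deriv_primitive q) -derivD.
by rewrite pint_deriv !hornerD /pint; ring.
Qed.

Lemma pintZ c p : pint (c *: p) = c * pint p.
Proof.
by rewrite -[in LHS](deriv_primitive p) -derivZ pint_deriv !hornerZ /pint; ring.
Qed.

(** Within distance d of an endpoint the bound A is used, elsewhere B / (1 - t^2), whose integral
    produces the logarithm. Parity transfers the bounds from t >= 0 to t <= 0. *)
Lemma pint_le (p : {poly R}) (A B d : R) : 0 < d <= 1 ->
  (forall t : R, p.[- t] = p.[t] \/ p.[- t] = - p.[t]) ->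
  (forall t : R, 0 <= t <= 1 -> `|p.[t]| <= A) ->
  (forall t : R, 0 <= t <= 1 - d -> `|p.[t]| * (1 - t ^+ 2) <= B) ->
  `|pint p| <= 2 * A * d + B * ln (2 / d).
Proof.
move=> /andP[d0 d1] pN pA pB.
have nN t : `|p.[- t]| = `|p.[t]| by case: (pN t) => ->; rewrite ?normrN.
have dp (x : R) : is_derive x 1 (horner (primitive p)) p.[x].
  by apply: is_derive_eq; rewrite deriv_primitive.
have E1 : `|(primitive p).[1] - (primitive p).[1 - d]| <= A * 1 - A * (1 - d).
  apply: (@le_sub_of_is_derive _ (horner p) (fun x => A * x) (fun=> A)); first lra.
  - by move=> x _; apply: is_derive_eq; rewrite ?scaler0 ?addr0; exact: mulr1.
  - by move=> x x01; apply: pA; lra.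
have E3 : `|(primitive p).[- (1 - d)] - (primitive p).[- 1]| <= A * (- (1 - d)) - A * (- 1).
  apply: (@le_sub_of_is_derive _ (horner p) (fun x => A * x) (fun=> A)); first lra.
  - by move=> x _; apply: is_derive_eq; rewrite ?scaler0 ?addr0; exact: mulr1.
  - by move=> x x01; rewrite -nN; apply: pA; lra.
(* [G] is an antiderivative of B / (1 - x^2). *)
pose G (x : R) := B / 2 * (ln (1 + x) - ln (1 - x)).
have E2 : `|(primitive p).[1 - d] - (primitive p).[- (1 - d)]| <= G (1 - d) - G (- (1 - d)).
  apply: (@le_sub_of_is_derive _ (horner p) G (fun x => B / (1 - x ^+ 2))); first lra.
  - move=> x xd.
    have x1 : 0 < 1 + x by lra.
    have x2 : 0 < 1 - x by lra.
    have := is_derive1_ln x1 => H1.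
    have := is_derive1_ln x2 => H2.
    rewrite /G.
    have D1 : is_derive x 1 (@ln R \o (fun x : R => 1 + x)) ((1 + x)^-1 * 1).
      apply: (@is_derive1_comp _ (@ln R) (cst 1 + id : R -> R)).
      by apply: is_derive_eq; rewrite add0r.
    have D2 : is_derive x 1 (@ln R \o (fun x : R => 1 - x)) ((1 - x)^-1 * (- 1)).
      apply: (@is_derive1_comp _ (@ln R) (cst 1 - id : R -> R)).
      by apply: is_derive_eq; rewrite add0r.
    have -> : (fun x => B / 2 * (ln (1 + x) - ln (1 - x))) =
      (cst (B / 2) \* ((@ln R \o (fun x : R => 1 + x)) \- (@ln R \o (fun x : R => 1 - x)))) by [].
    apply: is_derive_eq.
    rewrite scaler0 addr0 /GRing.scale/=.
    have n1 : 1 + x != 0 by rewrite gt_eqF.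
    have n2 : 1 - x != 0 by rewrite gt_eqF.
    have n3 : 1 - x ^+ 2 != 0 by rewrite gt_eqF//; nra.
    by field; rewrite n1 n2 n3.
  - move=> x xd.
    have x0 : 0 < 1 - x ^+ 2 by nra.
    rewrite ler_pdivlMr//.
    have [x00|x00] := leP 0 x; first by apply: pB; lra.
    by rewrite -nN -sqrrN; apply: pB; lra.
have B0 : G (1 - d) - G (- (1 - d)) = B * ln ((2 - d) / d).
  rewrite /G ln_div ?posrE//; last lra.
  rewrite !opprK.
  have -> : 1 + (1 - d) = 2 - d by ring.
  have -> : 1 - (1 - d) = d by ring.
  by field.
have Bge : 0 <= B.
  by rewrite (le_trans _ (pB 0 _))//; [rewrite expr0n/= subr0 mulr1|lra].
have Bl : B * ln ((2 - d) / d) <= B * ln (2 / d).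
  apply: ler_wpM2l => //; rewrite ler_ln ?posrE ?divr_gt0//; last lra.
  by rewrite ler_pM2r ?invr_gt0//; lra.
rewrite /pint.
have -> : (primitive p).[1] - (primitive p).[-1] =
  ((primitive p).[1] - (primitive p).[1 - d]) +
  ((primitive p).[1 - d] - (primitive p).[- (1 - d)]) +
  ((primitive p).[- (1 - d)] - (primitive p).[-1]) by ring.
apply: (le_trans (ler_normD _ _)); apply: (le_trans (lerD (ler_normD _ _) (lexx _))).
move: E1 E2 E3; rewrite B0; lra.
Qed.

End primitive.

Definition horner_rw := (hornerD, hornerN, hornerZ, hornerMn, hornerM, hornerX, horner_exp, hornerC).

(** * Sonin-type estimates from Legendre's equation (N is l, lam is l (l + 1), w is (1 - t^2) P') *)

Section legendre_type_estimates.
Variables (R : realType) (N lam : R) (P w : {poly R}).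
Local Notation P' := (P^`()).
Hypothesis N1 : 1 <= N.
Hypothesis lam_ge : N ^+ 2 <= lam.
Hypothesis lam_le : lam <= 2 * N ^+ 2.
Hypothesis P_ode : forall t : R,
  (1 - t ^+ 2) * (P'^`()).[t] = 2 * t * P'.[t] - lam * P.[t].
Hypothesis P1 : P.[1] = 1.
Hypothesis P_comp : P \Po (- 'X) = P \/ P \Po (- 'X) = - P.
Hypothesis horner_w : forall t : R, w.[t] = (1 - t ^+ 2) * P'.[t].
Hypothesis deriv_w : forall t : R, (w^`()).[t] = - lam * P.[t].

Let N20 : 0 < N ^+ 2.
Proof. by rewrite exprn_gt0//; move: N1; lra. Qed.

Let lam_gt0 : 0 < lam.
Proof. exact: lt_le_trans N20 lam_ge. Qed.

Let P_parity (t : R) : P.[- t] = P.[t] \/ P.[- t] = - P.[t].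
Proof.
have -> : P.[- t] = (P \Po (- 'X)).[t] by rewrite horner_comp hornerN hornerX.
by case: P_comp => ->; [left|right; rewrite hornerN].
Qed.

Let P'_parity (t : R) : P'.[- t] = P'.[t] \/ P'.[- t] = - P'.[t].
Proof.
have -> : P'.[- t] = - ((P \Po (- 'X))^`()).[t].
  rewrite deriv_comp derivN derivX mulrN1 hornerN opprK horner_comp.
  by rewrite hornerN hornerX.
by case: P_comp => ->; [right|left; rewrite derivN hornerN opprK].
Qed.

(** P is -1/lam times the derivative of [w], and [w] vanishes at both endpoints. *)
Lemma pint_eq0 : pint P = 0.
Proof.
have lam0 : lam != 0 by rewrite gt_eqF.
have d (x : R) : is_derive x 1 (horner (primitive P + lam^-1 *: w)) 0.
  apply: is_derive_eq.
  by rewrite derivD derivZ deriv_primitive !horner_rw deriv_w; field; rewrite lam0.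
have := @is_derive_0_is_cst R _ 1 (-1) d; rewrite !horner_rw !horner_w /pint.
rewrite sqrrN expr1n subrr !mul0r mulr0 !addr0 => ->; exact: subrr.
Qed.

(** A first Sonin function: by the equation its derivative is 2 t P'^2, so on [0, 1] it stays below
    its value lam at 1. This controls both |P| and (1 - t^2) P'^2. *)
Let Q : {poly R} := lam *: P ^+ 2 + w * P'.

Let Q_le (t : R) : 0 <= t <= 1 ->
  lam * P.[t] ^+ 2 + (1 - t ^+ 2) * P'.[t] ^+ 2 <= lam.
Proof.
move=> t01; have Q1 : Q.[1] = lam by rewrite /Q !horner_rw horner_w P1; ring.
have -> : lam * P.[t] ^+ 2 + (1 - t ^+ 2) * P'.[t] ^+ 2 = Q.[t].
  by rewrite /Q !horner_rw horner_w; ring.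
rewrite -Q1.
apply: (@le_of_is_derive _ _ (horner Q^`())); first lra.
move=> x xt.
have -> : (Q^`()).[x] = 2 * x * P'.[x] ^+ 2.
  rewrite /Q derivD derivZ derivM deriv_exp !horner_rw deriv_w horner_w.
  rewrite [_ * P'.[x] * _]mulrAC P_ode /= expr1; ring.
by apply: mulr_ge0; [lra|exact: sqr_ge0].
Qed.

Let onem2_ge0 (t : R) : 0 <= t <= 1 -> 0 <= 1 - t ^+ 2.
Proof. by move=> t01; nra. Qed.

Let wP'_ge0 (t : R) : 0 <= t <= 1 -> 0 <= (1 - t ^+ 2) * P'.[t] ^+ 2.
Proof. by move=> t01; rewrite mulr_ge0 ?sqr_ge0//; exact: onem2_ge0. Qed.

Lemma horner_le1 (t : R) : -1 <= t <= 1 -> `|P.[t]| <= 1.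
Proof.
wlog t0 : t / 0 <= t => [H|].
  have [t0|t0] := leP 0 t; first exact: H.
  move=> t1; have : `|P.[- t]| <= 1 by apply: H; lra.
  by case: (P_parity t) => ->; rewrite ?normrN.
move=> t1; have t01 : 0 <= t <= 1 by lra.
have := Q_le t01; have := wP'_ge0 t01 => H1 H2.
rewrite -(@ler_pXn2r _ 2)// ?nnegrE// expr1n -normrX ger0_norm ?sqr_ge0//.
by rewrite -(ler_pM2l lam_gt0) mulr1; lra.
Qed.

Let w_le (t : R) : 0 <= t <= 1 -> `|w.[t]| <= lam * (1 - t).
Proof.
move=> t01.
have := @le_sub_of_is_derive R (horner w) (horner w^`()) (fun x => lam * x) (fun=> lam) t 1.
rewrite [w.[1]]horner_w expr1n subrr mul0r sub0r normrN => H.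
rewrite mulrBr; apply: H; first lra.
- by move=> x _; apply: is_derive_eq; rewrite ?scaler0 ?addr0; exact: mulr1.
- move=> x xt; rewrite deriv_w normrM normrN [`|lam|]gtr0_norm//.
  by apply: ler_piMr; [exact: ltW|apply: horner_le1; lra].
Qed.

(** For t < 1, divide [w_le] by (1 - t)(1 + t); at t = 1 the equation itself reads 2 P'(1) = lam. *)
Let P'_le (t : R) : 0 <= t <= 1 -> `|P'.[t]| <= lam.
Proof.
move=> t01; have [t1|t1] := ltP t 1.
  have := w_le t01; rewrite horner_w.
  have -> : 1 - t ^+ 2 = (1 - t) * (1 + t) by ring.
  rewrite -mulrA normrM gtr0_norm; last by rewrite subr_gt0.
  rewrite mulrC ler_pM2r; last by rewrite subr_gt0.
  rewrite normrM; apply: le_trans; rewrite ler_peMl// ger0_norm; lra.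
have -> : t = 1 by lra.
have := P_ode 1; rewrite expr1n subrr mul0r P1 mulr1 mulr1 => H.
by rewrite ler_norml; move: lam_gt0; lra.
Qed.

Let B : {poly R} := 2 *: ((1%:P - 'X^2) * (lam *: P ^+ 2)) + 2 *: w ^+ 2 -
  2 *: ('X * P * w) + P ^+ 2.

Let BE (t : R) : B.[t] = 2 * (1 - t ^+ 2) * lam * P.[t] ^+ 2 + 2 * w.[t] ^+ 2
  - 2 * t * P.[t] * w.[t] + P.[t] ^+ 2.
Proof. by rewrite /B !horner_rw; ring. Qed.

(** Consequently B^2 / (1 - t^2) has derivative 2 t B P^2 / (1 - t^2)^2, since the terms in B^2
    cancel. As B >= 0, this ratio is nondecreasing on [0, 1). *)
Let BE' (t : R) : (1 - t ^+ 2) * (B^`()).[t] = t * P.[t] ^+ 2 - t * B.[t].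
Proof.
rewrite BE /B !(derivD, derivN, derivZ, derivM, deriv_exp, derivXn, derivX, derivC).
rewrite /= !horner_rw deriv_w horner_w; ring.
Qed.

(* In terms of u = sqrt(sin th) P(cos th), one has
   B/(2 sqrt(1 - t^2)) = ((l + 1/2)^2 + 1/(4 sin^2 th)) u^2 + u'^2,
   which is Sonin's function for u'' + ((l + 1/2)^2 + 1/(4 sin^2 th)) u = 0. *)
Let B_le (t : R) : 0 <= t <= 1 - (N ^+ 2)^-1 ->
  [/\ w.[t] ^+ 2 <= B.[t], 2 * (1 - t ^+ 2) * lam * P.[t] ^+ 2 <= B.[t]
    & B.[t] ^+ 2 <= 441 * N ^+ 2 * (1 - t ^+ 2)].
Proof.
set d := (N ^+ 2)^-1 => tt; pose s := 1 - d.
have d0 : 0 < d by rewrite invr_gt0.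
have d1 : d <= 1 by rewrite invf_le1// expr_ge1//; move: N1; lra.
have ld : N ^+ 2 * d = 1 by rewrite mulfV// gt_eqF.
have B0 (x : R) : 0 <= x <= 1 -> w.[x] ^+ 2 <= B.[x] /\
    2 * (1 - x ^+ 2) * lam * P.[x] ^+ 2 <= B.[x].
  move=> x01; rewrite BE.
  have h1 : 0 <= 2 * (1 - x ^+ 2) * lam * P.[x] ^+ 2.
    apply: mulr_ge0; last exact: sqr_ge0.
    apply: mulr_ge0; last exact: ltW.
    by rewrite mulr_ge0 ?onem2_ge0.
  have h2 : 0 <= w.[x] ^+ 2 - 2 * x * P.[x] * w.[x] + P.[x] ^+ 2.
    have -> : w.[x] ^+ 2 - 2 * x * P.[x] * w.[x] + P.[x] ^+ 2 =
      (w.[x] - x * P.[x]) ^+ 2 + (1 - x ^+ 2) * P.[x] ^+ 2 by ring.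
    by rewrite addr_ge0 ?sqr_ge0// mulr_ge0 ?sqr_ge0 ?onem2_ge0.
  have := sqr_ge0 w.[x]; split; lra.
have s01 : 0 <= s <= 1 by rewrite /s; lra.
have s2 : d <= 1 - s ^+ 2 <= 2 * d by rewrite /s; nra.
(* At s = 1 - 1/N^2 the factor 1 - s^2 is of order 1/N^2, so the four terms of B are at most 8, 8, 4
   and 1. The constant 441 is 21^2. *)
have Bs : B.[s] <= 21.
  have ws : `|w.[s]| <= 2.
    apply: (le_trans (w_le s01)).
    have -> : 1 - s = d by rewrite /s; ring.
    by move: ld lam_le d0; nra.
  have Ps : `|P.[s]| <= 1 by apply: horner_le1; lra.
  have h1 : (1 - s ^+ 2) * lam <= 4.
    apply: (@le_trans _ _ ((2 * d) * (2 * N ^+ 2))); last by lra.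
    by apply: ler_pM => //; [lra|exact: ltW|lra].
  have Ps2 : P.[s] ^+ 2 <= 1 by rewrite -real_normK ?num_real// expr_le1.
  have ws2 : w.[s] ^+ 2 <= 4.
    by rewrite -real_normK ?num_real//; have := normr_ge0 w.[s]; nra.
  have Pws : `|s * P.[s] * w.[s]| <= 2.
    rewrite !normrM ger0_norm; last lra.
    have -> : 2 = 1 * 1 * 2 :> R by rewrite !mul1r.
    by rewrite ler_pM// ?mulr_ge0// ?ler_pM//; lra.
  have h2 : (1 - s ^+ 2) * lam * P.[s] ^+ 2 <= 4.
    apply: (@le_trans _ _ (4 * 1)); last by rewrite mulr1.
    apply: ler_pM => //; last exact: sqr_ge0.
    by rewrite mulr_ge0 ?onem2_ge0// ltW.
  have := ler_norm (- (s * P.[s] * w.[s])); rewrite normrN.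
  rewrite BE; lra.
have t01 : 0 <= t <= 1 by move: tt; lra.
have [B1 B2] := B0 _ t01; split => //.
have B00 x : 0 <= x <= 1 -> 0 <= B.[x].
  by move=> x01; rewrite (le_trans _ (B0 x x01).1)// sqr_ge0.
have m0 x : 0 <= x <= s -> 0 < 1 - x ^+ 2 by rewrite /s; nra.
(* Monotonicity carries the bound at s back to t. Stopping at s keeps 1 - s^2 >= 1/N^2, which turns
   441 / (1 - s^2) into 441 N^2. *)
have : B.[t] ^+ 2 / (1 - t ^+ 2) <= B.[s] ^+ 2 / (1 - s ^+ 2).
  apply: (@le_of_is_derive R (fun x => B.[x] ^+ 2 / (1 - x ^+ 2))
    (fun x => 2 * x * B.[x] * P.[x] ^+ 2 / (1 - x ^+ 2) ^+ 2)); first by rewrite /s; lra.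
  - move=> x xt; have x0 : 1 - x ^+ 2 != 0 by rewrite gt_eqF// m0//; lra.
    have D1 : is_derive x 1 (horner (1%:P - 'X^2)) (- (2 * x)).
      apply: is_derive_eq; rewrite derivB derivC derivXn sub0r !horner_rw /=; ring.
    have D2 : is_derive x 1 (fun y => ((1%:P - 'X^2).[y])^-1) _ :=
      is_deriveV (f := horner (1%:P - 'X^2)) _ D1.
    have -> : (fun x1 : R => B.[x1] ^+ 2 / (1 - x1 ^+ 2)) =
      horner (B ^+ 2) \* (fun y => ((1%:P - 'X^2).[y])^-1).
      by apply/funext => y /=; rewrite !horner_rw.
    have D0 : (1%:P - 'X^2).[x] != 0 by rewrite !horner_rw.
    have D3 := D2 D0; apply: (is_derive_eq (is_deriveM _ D3)).
    have Bx : (B^`()).[x] = (x * P.[x] ^+ 2 - x * B.[x]) / (1 - x ^+ 2).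
      by rewrite -BE' mulrC mulKf.
    rewrite deriv_exp [_ ^+ 2.-1]/= expr1 -[(horner (B ^+ 2)) x]/((B ^+ 2).[x]).
    rewrite /GRing.scale/= hornerMn !hornerM Bx.
    move: (B.[x]) => b; rewrite !horner_rw; field; exact: x0.
  - move=> x xt; rewrite divr_ge0 ?sqr_ge0// mulr_ge0 ?sqr_ge0// mulr_ge0 ?B00//; lra.
move=> H.
have H2 : B.[s] ^+ 2 / (1 - s ^+ 2) <= 441 * N ^+ 2.
  rewrite ler_pdivrMr; last by apply: m0; lra.
  have := B00 s s01 => ?.
  apply: (@le_trans _ _ 441); first by nra.
  have /andP[s2a _] := s2.
  have : 1 <= N ^+ 2 * (1 - s ^+ 2) by rewrite -[X in X <= _]ld ler_pM2l.
  by rewrite -mulrA; lra.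
rewrite -ler_pdivrMr; first exact: le_trans H H2.
by apply: m0; rewrite /s; lra.
Qed.

Let d01 : 0 < (N ^+ 2)^-1 <= 1.
Proof.
by rewrite invr_gt0 N20 invf_le1// expr_ge1//; move: N1; lra.
Qed.

(** [B_le] bounds (2 (1 - t^2) lam P^2)^2 by 441 N^2 (1 - t^2), hence (1 - t^2) P^4 <= 441 / (4
    N^2), and 111 rounds up 441 / 4. Within 1/N^2 of the endpoints |P| <= 1 is used instead. *)
Lemma pint_exp4 : `|pint (P ^+ 4)| <= (N ^+ 2)^-1 * (2 + 111 * ln (2 * N ^+ 2)).
Proof.
have := @pint_le R (P ^+ 4) 1 (111 * (N ^+ 2)^-1) (N ^+ 2)^-1 d01.
rewrite invrK mulr1 => H; apply: le_trans (H _ _ _) _.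
- move=> t; rewrite !horner_exp; left.
  by case: (P_parity t) => -> //; rewrite exprNn -signr_odd mul1r.
- move=> t t01; rewrite horner_exp normrX exprn_ile1//; apply: horner_le1; lra.
- move=> t td; have t01 : 0 <= t <= 1 by move: d01; lra.
  have [_ H1 H2] := B_le td.
  rewrite horner_exp ger0_norm ?exprn_even_ge0//.
  have m0 : 0 < 1 - t ^+ 2 by move: d01 td => /andP[d0 _]; nra.
  have lN : 4 * N ^+ 4 * (1 - t ^+ 2) ^+ 2 * P.[t] ^+ 4 <= 441 * N ^+ 2 * (1 - t ^+ 2).
    apply: le_trans H2.
    apply: (@le_trans _ _ ((2 * (1 - t ^+ 2) * lam * P.[t] ^+ 2) ^+ 2)); last first.
      have h0 : 0 <= 2 * (1 - t ^+ 2) * lam * P.[t] ^+ 2.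
        by rewrite mulr_ge0 ?sqr_ge0// mulr_ge0 ?ltW// mulr_gt0.
      by rewrite ler_pXn2r// nnegrE// (le_trans _ H1).
    have -> : (2 * (1 - t ^+ 2) * lam * P.[t] ^+ 2) ^+ 2 =
      4 * lam ^+ 2 * (1 - t ^+ 2) ^+ 2 * P.[t] ^+ 4 by ring.
    rewrite ler_wpM2r ?exprn_even_ge0// ler_wpM2r ?sqr_ge0// ler_pM2l//.
    by rewrite (_ : N ^+ 4 = (N ^+ 2) ^+ 2); [rewrite ler_pXn2r ?nnegrE// ltW|ring].
  rewrite ler_pdivlMr// -(@ler_pM2l _ (4 * N ^+ 2 * (1 - t ^+ 2)))//; last first.
    by rewrite mulr_gt0// mulr_gt0.
  have -> : 4 * N ^+ 2 * (1 - t ^+ 2) * (P.[t] ^+ 4 * (1 - t ^+ 2) * N ^+ 2) =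
     4 * N ^+ 4 * (1 - t ^+ 2) ^+ 2 * P.[t] ^+ 4 by ring.
  apply: le_trans lN _; have : 0 <= N ^+ 2 * (1 - t ^+ 2) by rewrite mulr_ge0// ltW.
  lra.
- lra.
Qed.

Let E3 : {poly R} := 'X * (P' ^+ 2 * w).

(** Integration by parts trades P^3 for t (1 - t^2) P'^3 with a gain of lam^2. All boundary terms
    contain [w], which vanishes at 1 and -1. *)
Let pint_exp3E : 3 * lam ^+ 2 * pint (P ^+ 3) = 4 * pint E3.
Proof.
(* In 2 lam Qw + lam P^2 w the weights are chosen so that the terms in w P P' cancel upon
   differentiation, which leaves 4 E3 - 3 lam^2 P^3. *)
pose Qw := (P ^+ 2 + lam^-1 *: (w * P')) * w.
have lam0 : lam != 0 by rewrite gt_eqF.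
have d (x : R) : is_derive x 1
   (horner (primitive ((3 * lam ^+ 2) *: P ^+ 3) - primitive (4 *: E3)
     + (2 * lam) *: Qw + lam *: (P ^+ 2 * w))) 0.
  apply: is_derive_eq.
  rewrite !(derivD, derivN, derivZ, derivM, deriv_exp) !deriv_primitive /E3.
  rewrite !(horner_rw, derivD, derivN, derivZ, derivM, deriv_exp).
  rewrite !deriv_w horner_w /= .
  have := P_ode x.
  move: (P'^`()).[x] => P2 Px.
  transitivity (2 * (1 - x ^+ 2) * P'.[x] ^+ 2 * ((1 - x ^+ 2) * P2 - (2 * x * P'.[x] - lam * P.[x]))); last by rewrite Px; ring.
  by field; rewrite lam0.
have := @is_derive_0_is_cst R _ 1 (-1) d.
rewrite !horner_rw !horner_w sqrrN expr1n subrr !(mul0r, mulr0, addr0) => H.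
rewrite -!pintZ /pint; lra.
Qed.

(** Near the endpoints |E3| <= lam^2, from (1 - t^2) P'^2 <= lam and |P'| <= lam. Elsewhere (1 -
    t^2)^2 E3 = t w^3, and |w|^4 is controlled by [B_le]. *)
Lemma pint_exp3 : `|pint (P ^+ 3)| <=
  (N ^+ 2)^-1 * (2 + 442 * ln (2 * N ^+ 2)) * (4 / 3).
Proof.
have := @pint_le R E3 (lam ^+ 2) (442 * N ^+ 2) (N ^+ 2)^-1 d01.
rewrite invrK => H.
have : `|pint E3| <= 2 * lam ^+ 2 * (N ^+ 2)^-1 + 442 * N ^+ 2 * ln (2 * N ^+ 2).
  apply: H.
  - move=> t; rewrite /E3 !horner_rw !horner_w.
    by case: (P'_parity t) => ->; [right|left]; ring.
  - move=> t t01; rewrite /E3 !horner_rw horner_w.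
    have -> : t * (P'.[t] ^+ 2 * ((1 - t ^+ 2) * P'.[t])) =
       (t * ((1 - t ^+ 2) * P'.[t] ^+ 2)) * P'.[t] by ring.
    rewrite normrM expr2 ler_pM// ?P'_le//.
    rewrite ger0_norm; last by rewrite mulr_ge0 ?wP'_ge0//; lra.
    have := Q_le t01; have := wP'_ge0 t01; have : 0 <= lam * P.[t] ^+ 2.
      by rewrite mulr_ge0 ?sqr_ge0// ltW.
    move=> h1 h2 h3.
    by rewrite (@le_trans _ _ (1 * ((1 - t ^+ 2) * P'.[t] ^+ 2)))// ?ler_wpM2r//; lra.
  - move=> t td; have t01 : 0 <= t <= 1 by move: d01; lra.
    have [H1 _ H2] := B_le td.
    have m0 : 0 < 1 - t ^+ 2 by move: d01 td => /andP[d0 _]; nra.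
    have Nm : 1 <= N ^+ 2 * (1 - t ^+ 2).
      have ld : N ^+ 2 * (N ^+ 2)^-1 = 1 by rewrite mulfV// gt_eqF.
      rewrite -[X in X <= _]ld ler_pM2l//.
      by move: d01 td => /andP[]; nra.
    have w4 : `|w.[t]| ^+ 4 <= 441 * N ^+ 2 * (1 - t ^+ 2).
      rewrite (_ : _ ^+ 4 = (w.[t] ^+ 2) ^+ 2); last first.
        by rewrite -normrX ger0_norm ?exprn_even_ge0//; ring.
      apply: le_trans H2; rewrite ler_pXn2r// nnegrE ?sqr_ge0//.
      by rewrite (le_trans _ H1)// sqr_ge0.
    (* A cube is at most 1 plus the fourth power; N^2 (1 - t^2) >= 1 absorbs the 1 and turns 441
       into 442. *)
    have w3 : `|w.[t]| ^+ 3 <= 442 * N ^+ 2 * (1 - t ^+ 2).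
      apply: (@le_trans _ _ (1 + `|w.[t]| ^+ 4)); last by lra.
      have := normr_ge0 w.[t]; move: `|_| => a a0.
      have [a1|a1] := leP a 1.
        by rewrite ler_wpDr ?exprn_ge0// exprn_ile1.
      by rewrite ler_wpDl// [leRHS]exprS ler_peMl ?exprn_ge0// ltW.
    have e : E3.[t] * (1 - t ^+ 2) * (1 - t ^+ 2) = t * w.[t] ^+ 3.
      by rewrite /E3 !horner_rw !horner_w; ring.
    rewrite -(ler_pM2r m0) -[X in _ * X](gtr0_norm m0) -[X in _ * X * _](gtr0_norm m0).
    rewrite -!normrM e normrM normrX [X in X * _]ger0_norm; last by lra.
    by apply: le_trans w3; rewrite ler_piMl ?exprn_ge0//; lra.
move=> H3.
have E : pint (P ^+ 3) = 4 / 3 * pint E3 / lam ^+ 2.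
  have lam0 : lam != 0 by rewrite gt_eqF.
  by apply: (@mulfI _ (3 * lam ^+ 2)); [rewrite mulf_neq0// expf_neq0|rewrite pint_exp3E; field].
have lam2 : 0 < lam ^+ 2 by rewrite exprn_gt0.
have i0 : 0 <= (lam ^+ 2)^-1 by rewrite invr_ge0 ltW.
rewrite E normrM normrM (ger0_norm i0).
rewrite gtr0_norm; last by lra.
rewrite -mulrA mulrC ler_pM2r; last by lra.
rewrite ler_pdivrMr//; apply: le_trans H3 _.
have N4 : N ^+ 4 <= lam ^+ 2.
  by rewrite (_ : N ^+ 4 = (N ^+ 2) ^+ 2); [rewrite ler_pXn2r ?nnegrE// ltW|ring].
have L0 : 0 <= ln (2 * N ^+ 2).
  by rewrite ln_ge0//; move: N1; nra.
have -> : (N ^+ 2)^-1 * (2 + 442 * ln (2 * N ^+ 2)) * lam ^+ 2 =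
  2 * lam ^+ 2 * (N ^+ 2)^-1 + 442 * (lam ^+ 2 / N ^+ 2) * ln (2 * N ^+ 2) by ring.
apply: lerD; first exact: lexx.
apply: ler_wpM2r; first exact: L0.
apply: ler_wpM2l; first lra.
by rewrite ler_pdivlMr// (le_trans _ N4)// -exprD.
Qed.

End legendre_type_estimates.

Section legendre_estimates.
Variables (R : realType) (l : nat).
Hypothesis l_gt0 : (0 < l)%N.
Local Notation P := (legendre R l).
Local Notation lam := (l%:R * l.+1%:R : R).

Let N1 : 1 <= l%:R :> R. Proof. by rewrite ler1n. Qed.

Let lam_ge : l%:R ^+ 2 <= lam.
Proof. by rewrite expr2 ler_pM2l ?ltr0n// ler_nat. Qed.

Let lam_le : lam <= 2 * l%:R ^+ 2.
Proof.
rewrite expr2 mulrCA ler_pM2l ?ltr0n// -natr1.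
by have := N1; lra.
Qed.

Let P_ode (t : R) : (1 - t ^+ 2) * (P^`()^`()).[t] =
  2 * t * (P^`()).[t] - lam * P.[t].
Proof.
have := legendre_ode l 0 t; rewrite subr0 addn1 mulr1 -[P^`(2)]/(P^`()^`()) => ->.
by rewrite -[P^`(1)]/(P^`()) -[P^`(0)]/P [l.+1%:R * _]mulrC.
Qed.

Let P_comp : P \Po (- 'X) = P \/ P \Po (- 'X) = - P.
Proof.
rewrite legendre_parity -signr_odd; case: odd; [right|left].
  by rewrite expr1 scaleN1r.
by rewrite expr0 scale1r.
Qed.

Let w := (1%:P - 'X^2) * P^`().

Let horner_w (t : R) : w.[t] = (1 - t ^+ 2) * (P^`()).[t].
Proof. by rewrite /w hornerM hornerD hornerC hornerN horner_exp hornerX. Qed.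

Let deriv_w (t : R) : (w^`()).[t] = - lam * P.[t].
Proof.
rewrite /w; move: P_ode; move: (P) => p p_ode.
rewrite derivM derivB derivXn derivC sub0r.
rewrite hornerD hornerM [((_ - _) * _).[t]]hornerM !horner_rw p_ode /=; ring.
Qed.

Lemma legendre_le1 (t : R) : -1 <= t <= 1 -> `|P.[t]| <= 1.
Proof. by apply: (@horner_le1 R l%:R lam P w) => //; exact: legendre1. Qed.

Lemma pint_legendre : pint P = 0.
Proof. by apply: (@pint_eq0 R l%:R lam P w) => //; exact: legendre1. Qed.

Lemma pint_legendre4 :
  `|pint (P ^+ 4)| <= (l%:R ^+ 2)^-1 * (2 + 111 * ln (2 * l%:R ^+ 2)).
Proof. by apply: (@pint_exp4 R l%:R lam P w) => //; exact: legendre1. Qed.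

Lemma pint_legendre3 : `|pint (P ^+ 3)| <=
  (l%:R ^+ 2)^-1 * (2 + 442 * ln (2 * l%:R ^+ 2)) * (4 / 3).
Proof. by apply: (@pint_exp3 R l%:R lam P w) => //; exact: legendre1. Qed.

End legendre_estimates.

(** * Addition theorem *)

Section zonal_kernel.
Variables (R : realType) (l : nat).
Implicit Types (x y : R * R * R) (m : nat).
Local Notation P := (legendre R l).

(** The power (a + i b)^m split into real and imaginary parts, so that it can be differentiated
    along real curves. *)
Fixpoint cpow (a b : R) m : R * R :=
  if m is m'.+1 then
    (a * (cpow a b m').1 - b * (cpow a b m').2,
     a * (cpow a b m').2 + b * (cpow a b m').1)
  else (1, 0).

Lemma cpowE a b m : (a +i* b)%C ^+ m = ((cpow a b m).1 +i* (cpow a b m).2)%C.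
Proof. by elim: m => [//|m IH]; rewrite exprS IH. Qed.

Definition solidre m x := (P^`(m)).[x.2] * (cpow x.1.1 x.1.2 m).1.
Definition solidim m x := (P^`(m)).[x.2] * (cpow x.1.1 x.1.2 m).2.

Definition solid_prod m x y :=
  solidre m x * solidre m y + solidim m x * solidim m y.

Definition zonal_coef m : R := (l - m)`!%:R / (l + m)`!%:R.

(** Up to the factor 4 pi / (2 l + 1), this is the real part of the sum over m of Y_{lm}(x) times
    the conjugate of Y_{lm}(y), the orders m and -m being merged into the factor 2. In this real
    form rotation invariance is a matter of real derivatives. *)
Definition zonal_kernel x y :=
  solid_prod 0 x y +
  2 * \sum_(m < l) zonal_coef m.+1 * solid_prod m.+1 x y.

Section curve.
Variables (X1 X3 : R -> R) (x2 : R).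
Hypothesis dX1 : forall t : R, is_derive t 1 X1 (X3 t).
Hypothesis dX3 : forall t : R, is_derive t 1 X3 (- X1 t).
Hypothesis X_sphere : forall t : R, X1 t ^+ 2 + x2 ^+ 2 + X3 t ^+ 2 = 1.

Let A m t := (cpow (X1 t) x2 m).1.
Let B m t := (cpow (X1 t) x2 m).2.

Let dAB m (t : R) : is_derive t 1 (A m) (m%:R * X3 t * A m.-1 t) /\
  is_derive t 1 (B m) (m%:R * X3 t * B m.-1 t).
Proof.
elim: m => [|m [IA IB]].
  by rewrite !mul0r; split; exact: is_derive_cst.
have cA : m%:R * X3 t * A m t = m%:R * X3 t * (X1 t * A m.-1 t - x2 * B m.-1 t).
  by case: m {IA IB} => [|m]; rewrite ?mul0r.
have cB : m%:R * X3 t * B m t = m%:R * X3 t * (X1 t * B m.-1 t + x2 * A m.-1 t).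
  by case: m {IA IB cA} => [|m]; rewrite ?mul0r.
have dX := dX1 t.
have dc := is_derive_cst x2 t (1 : R).
split.
  apply: (is_derive_eq (is_deriveB (is_deriveM dX IA) (is_deriveM dc IB))).
  rewrite /GRing.scale/= -natr1.
  transitivity (m%:R * X3 t * A m t + A m t * X3 t); last by ring.
  by rewrite cA /cst; ring.
apply: (is_derive_eq (is_deriveD (is_deriveM dX IB) (is_deriveM dc IA))).
rewrite /GRing.scale/= -natr1.
transitivity (m%:R * X3 t * B m t + B m t * X3 t); last by ring.
by rewrite cB /cst; ring.
Qed.

Let a m t := (P^`(m)).[X3 t] * A m t.
Let b m t := (P^`(m)).[X3 t] * B m t.

Let kappa m : R := (l + m.+1)%:R * (l%:R - m%:R).

Let dP m (t : R) : is_derive t 1 (fun t => (P^`(m)).[X3 t]) ((P^`(m.+1)).[X3 t] * (- X1 t)).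
Proof. exact: (is_derive1_comp (is_derive_poly _ _) (dX3 t)). Qed.

Let sph2 (t : R) : X1 t ^+ 2 + x2 ^+ 2 = 1 - X3 t ^+ 2.
Proof. by rewrite -(X_sphere t); ring. Qed.

(** An infinitesimal rotation about the second axis mixes order m + 1 only with its neighbours m and
    m + 2. The Legendre equation of level m, with 1 - X3^2 replaced by X1^2 + x2^2, supplies the
    term of order m. *)
Lemma derive_solid m (t : R) :
  is_derive t 1 (a m.+1) (- 2^-1 * a m.+2 t + 2^-1 * kappa m * a m t) /\
  is_derive t 1 (b m.+1) (- 2^-1 * b m.+2 t + 2^-1 * kappa m * b m t).
Proof.
have [dA dB] := dAB m.+1 t.
have E := legendre_ode l m (X3 t).
have S := sph2 t.
split.
  apply: (is_derive_eq (is_deriveM (dP m.+1 t) dA)).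
  rewrite /GRing.scale/= /a /kappa.
  rewrite /A /= -[(cpow _ _ m).1]/(A m t) -[(cpow _ _ m).2]/(B m t).
  have := congr1 ( *%R^~ (A m t)) E; rewrite /= -S; lra.
apply: (is_derive_eq (is_deriveM (dP m.+1 t) dB)).
rewrite /GRing.scale/= /b /kappa.
rewrite /B /= -[(cpow _ _ m).1]/(A m t) -[(cpow _ _ m).2]/(B m t).
have := congr1 ( *%R^~ (B m t)) E; rewrite /= -S; lra.
Qed.

Lemma derive_solid0 (t : R) : is_derive t 1 (a 0) (- a 1 t).
Proof.
have [dA _] := dAB 0 t.
apply: (is_derive_eq (is_deriveM (dP 0 t) dA)).
rewrite /GRing.scale/= /a /A /=; ring.
Qed.

End curve.

Lemma derivn_legendre_eq0 : P^`(l.+1) = 0.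
Proof.
rewrite /legendre derivnZ /derivn -iterD -/(derivn _ _) derivn_poly0 ?scaler0//.
have := size_exp ('X^2 - 1 : {poly R}) l; rewrite -polyC1 size_XnsubC//= => H.
have : size (('X^2 - 1%:P : {poly R}) ^+ l) != 0%N.
  by rewrite size_poly_eq0 expf_neq0// -size_poly_eq0 size_XnsubC.
move: H; case: size => // n /= -> _.
by rewrite addSn addnn -muln2 mulnC.
Qed.

(** With this recursion the derivative of the summand of order m + 1 becomes half the difference of
    two consecutive terms [zonal_coef m * h m], so that the sum telescopes. *)
Lemma zonal_coefS m : (m < l)%N ->
  zonal_coef m.+1 * ((l + m.+1)%:R * (l%:R - m%:R)) = zonal_coef m.
Proof.
move=> ml; rewrite /zonal_coef.
have -> : (l - m)%N = (l - m.+1).+1 by rewrite subnSK.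
rewrite addnS !factS !natrM.
have -> : l%:R - m%:R = (l - m.+1).+1%:R :> R by rewrite subnSK// natrB// ltnW.
have h1 : (l + m)`!%:R != 0 :> R by rewrite pnatr_eq0 -lt0n fact_gt0.
have h2 : (l + m).+1%:R != 0 :> R by rewrite pnatr_eq0.
move: h1 h2; move: ((l + m)`!%:R : R) ((l + m).+1%:R : R) => a b h1 h2.
by field; rewrite h1 h2.
Qed.

Section two_curves.
Variables (X1 X3 Y1 Y3 : R -> R) (x2 y2 : R).
Hypothesis dX1 : forall t : R, is_derive t 1 X1 (X3 t).
Hypothesis dX3 : forall t : R, is_derive t 1 X3 (- X1 t).
Hypothesis X_sphere : forall t : R, X1 t ^+ 2 + x2 ^+ 2 + X3 t ^+ 2 = 1.
Hypothesis dY1 : forall t : R, is_derive t 1 Y1 (Y3 t).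
Hypothesis dY3 : forall t : R, is_derive t 1 Y3 (- Y1 t).
Hypothesis Y_sphere : forall t : R, Y1 t ^+ 2 + y2 ^+ 2 + Y3 t ^+ 2 = 1.

Let X t := (X1 t, x2, X3 t).
Let Y t := (Y1 t, y2, Y3 t).

Let h m t :=
  solidre m.+1 (X t) * solidre m (Y t) + solidre m (X t) * solidre m.+1 (Y t) +
  (solidim m.+1 (X t) * solidim m (Y t) + solidim m (X t) * solidim m.+1 (Y t)).

Let dg m (t : R) : is_derive t 1 (fun t => solid_prod m.+1 (X t) (Y t))
  (- 2^-1 * h m.+1 t + 2^-1 * ((l + m.+1)%:R * (l%:R - m%:R)) * h m t).
Proof.
have [aX bX] := derive_solid dX1 dX3 X_sphere m t.
have [aY bY] := derive_solid dY1 dY3 Y_sphere m t.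
apply: (is_derive_eq (is_deriveD (is_deriveM aX aY) (is_deriveM bX bY))).
rewrite /GRing.scale/= /h /solidre /solidim /X /Y /=; ring.
Qed.

Let dg0 (t : R) : is_derive t 1 (fun t => solid_prod 0 (X t) (Y t)) (- h 0 t).
Proof.
have aX := @derive_solid0 X1 X3 x2 dX1 dX3 t.
have aY := @derive_solid0 Y1 Y3 y2 dY1 dY3 t.
have -> : (fun t => solid_prod 0 (X t) (Y t)) =
   (fun t => solidre 0 (X t) * solidre 0 (Y t)).
  by apply/funext => u; rewrite /solid_prod /solidim /= mulr0 mul0r addr0.
apply: (is_derive_eq (is_deriveM aX aY)).
rewrite /GRing.scale/= /h /solidre /solidim /X /Y /=; ring.
Qed.

(* Rotating both points about the second axis at unit speed: the sum of the
   derivatives of the terms telescopes. *)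
Lemma zonal_kernel_curve (t : R) : is_derive t 1 (fun t => zonal_kernel (X t) (Y t)) 0.
Proof.
have ds := @is_derive_sum R R R l (fun (m : 'I_l) t => zonal_coef m.+1 * solid_prod m.+1 (X t) (Y t)) t 1
   (fun m : 'I_l => zonal_coef m.+1 * (- 2^-1 * h m.+1 t + 2^-1 * ((l + m.+1)%:R * (l%:R - m%:R)) * h m t)).
have {}ds := ds (fun m : 'I_l => is_deriveZ (zonal_coef m.+1) (dg m t)).
have -> : (fun t => zonal_kernel (X t) (Y t)) =
  (fun t => solid_prod 0 (X t) (Y t)) + (2 *: (\sum_(m < l) (fun t => zonal_coef m.+1 * solid_prod m.+1 (X t) (Y t)))).
  by apply/funext => u; rewrite /zonal_kernel /= fctE fct_sumE.
apply: (is_derive_eq (is_deriveD (dg0 t) (is_deriveZ 2 ds))).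
have -> : \sum_(m < l) zonal_coef m.+1 *
     (- 2^-1 * h m.+1 t + 2^-1 * ((l + m.+1)%:R * (l%:R - m%:R)) * h m t) =
   2^-1 * (zonal_coef 0 * h 0 t - zonal_coef l * h l t).
  have := telescope_sumr (fun m => - (zonal_coef m * h m t)) (leq0n l).
  rewrite big_mkord opprK addrC => <-.
  rewrite mulr_sumr; apply: eq_bigr => m _.
  rewrite -(zonal_coefS (ltn_ord m)); ring.
(* The upper end of the telescope vanishes because P_l has degree l; the lower end cancels the
   derivative of the order-0 term. *)
have -> : h l t = 0.
  by rewrite /h /solidre /solidim derivn_legendre_eq0 !horner0 !(mul0r, mulr0, addr0).
rewrite /zonal_coef subn0 addn0 divff ?pnatr_eq0 -?lt0n ?fact_gt0//.
rewrite /GRing.scale/=; field.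
by rewrite pnatr_eq0 -lt0n fact_gt0.
Qed.

End two_curves.

Definition dot x y := x.1.1 * y.1.1 + x.1.2 * y.1.2 + x.2 * y.2.

Definition roty (u : R) x : R * R * R :=
  (cos u * x.1.1 + sin u * x.2, x.1.2, - sin u * x.1.1 + cos u * x.2).

Definition rotz (u : R) x : R * R * R :=
  (cos u * x.1.1 - sin u * x.1.2, sin u * x.1.1 + cos u * x.1.2, x.2).

Lemma zonal_kernel_roty (u : R) x y : sphere x -> sphere y ->
  zonal_kernel (roty u x) (roty u y) = zonal_kernel x y.
Proof.
move=> xS yS.
have d1 (z : R * R * R) (t : R) : is_derive t 1 (fun t => (roty t z).1.1) (roty t z).2.
  have dc := is_derive_cst z.1.1 t (1 : R).
  have dc' := is_derive_cst z.2 t (1 : R).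
  apply: (is_derive_eq (is_deriveD (is_deriveM (is_derive_cos t) dc) (is_deriveM (is_derive_sin t) dc'))).
  by rewrite /GRing.scale/= /roty /cst/=; ring.
have d3 (z : R * R * R) (t : R) : is_derive t 1 (fun t => (roty t z).2) (- (roty t z).1.1).
  have dc := is_derive_cst z.1.1 t (1 : R).
  have dc' := is_derive_cst z.2 t (1 : R).
  apply: (is_derive_eq (is_deriveD (is_deriveM (is_deriveN (is_derive_sin t)) dc) (is_deriveM (is_derive_cos t) dc'))).
  by rewrite /GRing.scale/= /roty /cst/=; ring.
have S (z : R * R * R) (t : R) : sphere z -> (roty t z).1.1 ^+ 2 + z.1.2 ^+ 2 + (roty t z).2 ^+ 2 = 1.
  rewrite /sphere /roty /= => zS.
  have := cos2Dsin2 t; move: (cos t) (sin t) => c s cs.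
  transitivity ((c ^+ 2 + s ^+ 2) * (z.1.1 ^+ 2 + z.2 ^+ 2) + z.1.2 ^+ 2); first ring.
  by rewrite cs -[RHS]zS; ring.
have := @is_derive_0_is_cst R _ u 0 (zonal_kernel_curve (d1 x) (d3 x) (fun t => S x t xS) (d1 y) (d3 y) (fun t => S y t yS)).
rewrite /= => ->.
by congr zonal_kernel; rewrite /= cos0 sin0 oppr0 !mul1r !mul0r !addr0 ?add0r; [case: (x) => -[]|case: (y) => -[]].
Qed.

(** Rotation about the third axis multiplies (x1 + i x2)^m by the unit number e^{i m u}, which
    leaves each summand unchanged. *)
Lemma zonal_kernel_rotz (u : R) x y :
  zonal_kernel (rotz u x) (rotz u y) = zonal_kernel x y.
Proof.
have E m : solid_prod m (rotz u x) (rotz u y) = solid_prod m x y.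
  rewrite /solid_prod /solidre /solidim /=.
  have H (z : R * R * R) : (cpow (rotz u z).1.1 (rotz u z).1.2 m).1 = (cpow (cos u) (sin u) m).1 * (cpow z.1.1 z.1.2 m).1 - (cpow (cos u) (sin u) m).2 * (cpow z.1.1 z.1.2 m).2
   /\ (cpow (rotz u z).1.1 (rotz u z).1.2 m).2 = (cpow (cos u) (sin u) m).1 * (cpow z.1.1 z.1.2 m).2 + (cpow (cos u) (sin u) m).2 * (cpow z.1.1 z.1.2 m).1.
    elim: m => [|m [I1 I2]]; first by rewrite /= mul1r mulr0 subr0 mul1r mul0r addr0.
    rewrite /= in I1 I2 *; rewrite !I1 !I2; split; ring.
  have U : (cpow (cos u) (sin u) m).1 ^+ 2 + (cpow (cos u) (sin u) m).2 ^+ 2 = 1.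
    elim: m {H} => [|m IH]; first by rewrite /= expr1n expr0n addr0.
    rewrite /= -[RHS]IH -[RHS]mul1r -(cos2Dsin2 u); ring.
  have [Hx1 Hx2] := H x; have [Hy1 Hy2] := H y.
  rewrite /= in Hx1 Hx2 Hy1 Hy2; rewrite Hx1 Hx2 Hy1 Hy2.
  move: U; move: (cpow (cos u) (sin u) m) => [a b] /= U.
  rewrite -[RHS]mul1r -U; ring.
by rewrite /zonal_kernel E; congr (_ + _ * _); apply: eq_bigr => m _; rewrite E.
Qed.

Lemma zonal_kernel_north x : zonal_kernel x (0, 0, 1) = P.[x.2].
Proof.
rewrite /zonal_kernel big1 ?mulr0 ?addr0.
  by rewrite /solid_prod /solidre /solidim /= legendre1 !(mulr1, mulr0, addr0).
move=> m _; rewrite /solid_prod /solidre /solidim /= !(mul0r, subr0, addr0, mulr0).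
by [].
Qed.

Lemma sphere_spherical_coord (t : R * R) : sphere (spherical_coord t).
Proof.
rewrite /sphere /spherical_coord /=.
rewrite !exprMn -mulrDr cos2Dsin2 mulr1.
by rewrite addrC cos2Dsin2.
Qed.

(** Turning by minus the longitude and then by minus the colatitude of the second point brings it to
    the north pole, where only order 0 survives. The height of the first point after these rotations
    is the inner product. *)
Lemma zonal_kernelE (t s : R * R) :
  zonal_kernel (spherical_coord t) (spherical_coord s) =
  P.[dot (spherical_coord t) (spherical_coord s)].
Proof.
have rS u (z : R * R * R) : sphere z -> sphere (rotz u z).
  rewrite /sphere /rotz /= => <-; rewrite -[z.1.1 ^+ 2 + _]mul1r -(cos2Dsin2 u); ring.
rewrite -(zonal_kernel_rotz (- s.2)).
rewrite -(zonal_kernel_roty (- s.1)); do ?exact/rS/sphere_spherical_coord.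
have -> : roty (- s.1) (rotz (- s.2) (spherical_coord s)) = (0, 0, 1).
  rewrite /roty /rotz /spherical_coord /= !cosN !sinN.
  have h1 := cos2Dsin2 s.1; have h2 := cos2Dsin2 s.2.
  move: (cos s.1) (sin s.1) (cos s.2) (sin s.2) h1 h2 => a b c d h1 h2.
  congr (_, _, _); first last.
  - transitivity (b ^+ 2 * (c ^+ 2 + d ^+ 2) + a ^+ 2); first ring.
    by rewrite h2 mulr1 addrC.
  - ring.
  - transitivity (a * b * (c ^+ 2 + d ^+ 2 - 1)); first ring.
    by rewrite h2 subrr mulr0.
rewrite zonal_kernel_north; congr (P.[_]).
rewrite /dot /roty /rotz /spherical_coord /= !cosN !sinN; ring.
Qed.

End zonal_kernel.

Section addition_theorem.
Variable R : realType.

Lemma sum_orderE (V : nmodType) l (F : int -> V) :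
  sum_order l F = F 0 + \sum_(m < l) (F m.+1%:Z + F (- m.+1%:Z)).
Proof.
rewrite /sum_order -(big_mkord xpredT (fun k => F (k%:Z - l%:Z))).
rewrite mul2n -addnn -addnS (@big_cat_nat _ _ _ l)//=; last by rewrite leq_addr.
rewrite -[in X in _ + X](add0n l) big_addn add0n addnC addnK big_nat_recl//= add0n subrr.
rewrite big_nat_rev /= addrCA big_split/= !big_mkord; congr (_ + _); rewrite addrC; congr (_ + _).
  by apply: eq_bigr => m _; rewrite PoszD addrK.
apply: eq_bigr => m _; congr F; rewrite add0n -subzn//.
by rewrite addrAC subrr sub0r.
Qed.

Lemma ReD (z t : R[i]) : complex.Re (z + t) = complex.Re z + complex.Re t.
Proof. by case: z t => ? ? []. Qed.

Lemma Re_sum n (F : 'I_n -> R[i]) :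
  complex.Re (\sum_(i < n) F i) = \sum_(i < n) complex.Re (F i).
Proof. exact: (big_morph _ ReD). Qed.

Lemma sphY_opp l m (x : R * R * R) : sphY l (- m%:Z) x = (-1) ^+ m * (sphY l m%:Z x)^*.
Proof.
case: m => [|m] //=.
by rewrite expr0 mul1r /sphY_nneg expr0 mulr1; exact/esym/conjc_real.
Qed.

Lemma Re_sphY_prod l m (x y : R * R * R) :
  complex.Re (sphY l m%:Z x * (sphY l m%:Z y)^*) =
  (2 * l + 1)%:R / (4 * pi) * (zonal_coef R l m * solid_prod l m x y).
Proof.
rewrite /sphY /sphY_nneg !cpowE /= /solid_prod /solidre /solidim /zonal_coef.
set s := Num.sqrt _; set q : R := (2 * l + 1)%:R / (4 * pi) * ((l - m)`!%:R / (l + m)`!%:R).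
have s2 : s ^+ 2 = q.
  by rewrite sqr_sqrtr// mulr_ge0 ?divr_ge0// mulr_ge0// pi_ge0.
have e2 : ((-1) ^+ m : R) ^+ 2 = 1 by rewrite sqrr_sign.
rewrite [RHS]mulrA -[X in _ = X * _]/q -s2 !mul0r !subr0 !addr0.
transitivity (((-1) ^+ m) ^+ 2 * (s ^+ 2 *
 ((legendre R l)^`(m).[x.2] * (cpow x.1.1 x.1.2 m).1 *
  ((legendre R l)^`(m).[y.2] * (cpow y.1.1 y.1.2 m).1) +
  (legendre R l)^`(m).[x.2] * (cpow x.1.1 x.1.2 m).2 *
  ((legendre R l)^`(m).[y.2] * (cpow y.1.1 y.1.2 m).2)))); first ring.
by rewrite e2 mul1r.
Qed.

Lemma addition_formula l (x y : R * R * R) :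
  4 * pi / (2 * l + 1)%:R *
    complex.Re (sum_order l (fun m => sphY l m x * (sphY l m y)^*)) =
  zonal_kernel l x y.
Proof.
rewrite sum_orderE.
have E m : complex.Re (sphY l (- m%:Z) x * (sphY l (- m%:Z) y)^*) =
    complex.Re (sphY l m%:Z x * (sphY l m%:Z y)^*).
  rewrite !sphY_opp; move: (sphY l m x) (sphY l m y) => [a b] [c e].
  by rewrite -signr_odd; case: (odd m); rewrite ?expr1 ?expr0 /=; ring.
rewrite ReD Re_sum.
under eq_bigr do rewrite ReD E -mulr2n Re_sphY_prod -mulrnAr.
rewrite Re_sphY_prod -mulr_sumr -mulrDr mulrA.
have -> : 4 * pi / (2 * l + 1)%:R * ((2 * l + 1)%:R / (4 * pi)) = 1 :> R.
  have p0 : pi != 0 :> R by rewrite gt_eqF// pi_gt0.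
  have n0 : (2 * l + 1)%:R != 0 :> R by rewrite addn1 pnatr_eq0.
  by move: ((2 * l + 1)%:R : R) n0 => n n0; move: (pi : R) p0 => p p0; field; rewrite n0 p0.
rewrite mul1r /zonal_kernel; congr (_ + _).
  by rewrite /zonal_coef subn0 addn0 divff ?mul1r// pnatr_eq0 -lt0n fact_gt0.
by rewrite sumrMnl mulr_natl.
Qed.

End addition_theorem.

(** * Integration over the sphere *)

Section density.
Context d (T : measurableType d) (R : realType).
Variables (mu nu : {measure set T -> \bar R}) (p : T -> R).
Hypothesis p_ge0 : forall x, 0 <= p x.
Hypothesis mp : measurable_fun setT p.
Hypothesis nuE : forall A, measurable A -> nu A = (\int[mu]_(x in A) (p x)%:E)%E.
Import HBNNSimple.
Local Open Scope ereal_scope.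

Let integral_density_nnsfun (h : {nnsfun T >-> R}) :
  sintegral nu h = \int[mu]_x ((h x)%:E * (p x)%:E).
Proof.
have mh (y : R) : measurable (h @^-1` [set y]).
  by rewrite -[X in measurable X]setTI; apply: (measurable_funPT h) => //; exact: measurable_set1.
have h_ge0 (y : R) x : (0 <= y * \1_(h @^-1` [set y]) x)%R.
  rewrite indicE; case: (boolP (_ \in _)) => [|_]; last by rewrite mulr0.
  by rewrite inE/= mulr1 => <-.
under eq_integral => x _.
  rewrite fimfunE -fsumEFin// ge0_mule_fsuml; last by move=> y; rewrite lee_fin.
  over.
rewrite ge0_integral_fsum//; last first.
- by move=> y x _; rewrite mule_ge0// lee_fin.
- move=> y; under eq_fun do rewrite -EFinM; apply/measurable_EFinP.
  by apply: measurable_funM => //; apply: measurable_funM.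
rewrite sintegralE; apply: eq_fsbigr => y; rewrite inE => -[x _ <-].
rewrite nuE//; set A := h @^-1` _.
under [RHS]eq_integral do rewrite EFinM -muleA.
rewrite ge0_integralZl//; [congr (_ * _)| | |by rewrite lee_fin].
- rewrite [LHS]integral_mkcond; apply: eq_integral => z _; rewrite patchE indicE.
  by case: (_ \in _); rewrite ?mul1e ?mul0e.
- under eq_fun do rewrite -EFinM; apply/measurable_EFinP.
  by apply: measurable_funM => //; exact: measurable_indic (mh _).
- by move=> z _; rewrite mule_ge0// lee_fin.
Qed.

Lemma ge0_integral_density (f : T -> \bar R) : (forall x, 0 <= f x) ->
  measurable_fun setT f -> \int[nu]_x f x = \int[mu]_x (f x * (p x)%:E).
Proof.
move=> f0 mf; pose h := nnsfun_approx measurableT mf.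
have h_ndecr x : {homo (fun n => h n x) : n m / (n <= m)%N >-> (n <= m)%R}.
  by move=> n m nm; exact/lefP/nd_nnsfun_approx.
have h_cvg x : (h n x)%:E @[n --> \oo] --> f x by exact: cvg_nnsfun_approx.
rewrite (nd_ge0_integral_lim nu f0 h_ndecr h_cvg).
rewrite (_ : _ \o _ = fun n => \int[mu]_x ((h n x)%:E * (p x)%:E)); last first.
  by apply/funext => n; exact: integral_density_nnsfun.
rewrite -monotone_convergence//.
- by apply: eq_integral => x _; apply/cvg_lim => //; exact: cvgeZr.
- move=> n; under eq_fun do rewrite -EFinM; apply/measurable_EFinP.
  exact: measurable_funM.
- by move=> n x _; rewrite mule_ge0// lee_fin.
- by move=> x _ n m nm; rewrite lee_wpmul2r// lee_fin//; exact: h_ndecr.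
Qed.

Lemma integral_density (f : T -> R) : measurable_fun setT f ->
  \int[nu]_x (f x)%:E = \int[mu]_x (f x * p x)%:E.
Proof.
move=> mf; rewrite integralE [RHS]integralE.
have mf' : measurable_fun setT (EFin \o f) by exact/measurable_EFinP.
rewrite !ge0_integral_density//; do ?exact: measurable_funepos; do ?exact: measurable_funeneg.
congr (_ - _); apply: eq_integral => x _.
  rewrite !funeposE /= -!EFin_max -EFinM; congr EFin.
  by rewrite maxr_pMl// mul0r.
rewrite !funenegE /= -!EFin_max -EFinM; congr EFin.
by rewrite maxr_pMl// mul0r mulNr.
Qed.

End density.

(** * Bounded measurable functions *)

Section bounded_measurable.
Context d (T : measurableType d) (R : realType).
Implicit Types f g : T -> R.

(** This class is closed under the algebraic operations and integrable for every finite measure, so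
    that integrability can be read off the shape of an integrand. *)
Definition bmf f := measurable_fun setT f /\ exists M, forall x, `|f x| <= M.

Lemma bmf_cst (c : R) : bmf (fun=> c).
Proof. by split; [exact: measurable_cst|exists `|c|]. Qed.

Lemma bmfD f g : bmf f -> bmf g -> bmf (fun x => f x + g x).
Proof.
move=> [mf [M fM]] [mg [N gN]]; split; first exact: measurable_funD.
by exists (M + N) => x; rewrite (le_trans (ler_normD _ _))// lerD.
Qed.

Lemma bmfM f g : bmf f -> bmf g -> bmf (fun x => f x * g x).
Proof.
move=> [mf [M fM]] [mg [N gN]]; split; first exact: measurable_funM.
by exists (M * N) => x; rewrite normrM ler_pM.
Qed.

Lemma bmfX f n : bmf f -> bmf (fun x => f x ^+ n).
Proof.
move=> bf; elim: n => [|n IH]; first by under eq_fun do rewrite expr0; exact: bmf_cst.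
by under eq_fun do rewrite exprS; exact: bmfM.
Qed.

Lemma bmf_sum (I : Type) (s : seq I) (F : I -> T -> R) :
  (forall i, bmf (F i)) -> bmf (fun x => \sum_(i <- s) F i x).
Proof.
move=> bF; elim: s => [|i s IH].
  by under eq_fun do rewrite big_nil; exact: bmf_cst.
by under eq_fun do rewrite big_cons; exact: bmfD.
Qed.

Lemma bmf_horner f (p : {poly R}) : bmf f -> bmf (fun x => p.[f x]).
Proof.
move=> bf; under eq_fun do rewrite horner_coef.
apply: bmf_sum => i; apply: bmfM; [exact: bmf_cst|exact: bmfX].
Qed.

Lemma bmf_cos f : measurable_fun setT f -> bmf (fun x => cos (f x)).
Proof.
move=> mf; split.
  by apply: measurableT_comp => //; apply: continuous_measurable_fun; exact: continuous_cos.
by exists 1 => x; rewrite ler_norml cos_geN1 cos_le1.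
Qed.

Lemma bmf_sin f : measurable_fun setT f -> bmf (fun x => sin (f x)).
Proof.
move=> mf; split.
  by apply: measurableT_comp => //; apply: continuous_measurable_fun; exact: continuous_sin.
by exists 1 => x; rewrite ler_norml sin_geN1 sin_le1.
Qed.

Lemma bmf_indic (A : set T) : measurable A -> bmf (\1_A).
Proof.
move=> mA; split; first exact: measurable_indic.
by exists 1 => x; rewrite indicE; case: (_ \in _); rewrite ?normr1 ?normr0.
Qed.

Lemma bmf_integrable (mu : {finite_measure set T -> \bar R}) f :
  bmf f -> mu.-integrable setT (EFin \o f).
Proof.
move=> [mf [M fM]]; apply: measurable_bounded_integrable => //.
  by rewrite -ge0_fin_numE// fin_num_measure.
exists M; split; first exact: num_real.
by move=> N MN x _ /=; rewrite (le_trans (fM x))// ltW.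
Qed.

End bounded_measurable.

Lemma bmf_comp d d' (T : measurableType d) (T' : measurableType d') (R : realType)
    (f : T' -> R) (g : T -> T') :
  bmf f -> measurable_fun setT g -> bmf (fun x => f (g x)).
Proof.
move=> [mf [M fM]] mg; split; last by exists M.
exact: measurableT_comp.
Qed.

Section ftc.
Variable R : realType.

Lemma Rintegral_derive (F f : R -> R) (a b : R) : a < b ->
  (forall x : R, is_derive x 1 F (f x)) -> continuous f ->
  \int[lebesgue_measure]_(x in `[a, b]) f x = F b - F a.
Proof.
move=> ab dF cf.
have cF : continuous F.
  by move=> x; apply/differentiable_continuous/derivable1_diffP; have [] := dF x.
rewrite /Rintegral (@continuous_FTC2 R f F a b ab)//.
- exact: continuous_subspaceT.
- split => [x _| |]; first by have [] := dF x.
    by apply: cvg_at_right_filter; exact: cF.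
  by apply: cvg_at_left_filter; exact: cF.
- by move=> x _; rewrite derive1E; have [_ ->] := dF x.
Qed.

End ftc.

Lemma is_derive_exprn (R : realType) (f : R -> R) n (x df : R) :
  is_derive x 1 f df -> is_derive x 1 (fun y => f y ^+ n) (n%:R * f x ^+ n.-1 * df).
Proof.
move=> fdf; have -> : (fun y => f y ^+ n) = horner 'X^n \o f.
  by apply/funext => y /=; rewrite hornerXn.
apply: (is_derive_eq (is_derive1_comp (is_derive_poly _ _) fdf)).
by rewrite derivXn hornerMn hornerXn mulr_natl.
Qed.

(** * Moments of sines and cosines *)

Section trig_integrals.
Variable R : realType.
Local Notation mu := (@lebesgue_measure R).

Let cos_continuous_comp (c : R) : continuous (fun x : R => cos (x - c)).
Proof.
move=> x; apply: continuous_comp; last exact: continuous_cos.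
by apply: continuousB; [exact: cvg_id|exact: cvg_cst].
Qed.

Let dcosB (c x : R) : is_derive x 1 (fun x : R => cos (x - c)) (- sin (x - c)).
Proof.
have dB : is_derive x 1 (fun x : R => x - c) 1.
  have -> : (fun x : R => x - c) = id - cst c by [].
  by apply: is_derive_eq; rewrite subr0.
have H : is_derive x 1 (@cos R \o (fun x : R => x - c)) _ := @is_derive1_comp R (@cos R) (fun x : R => x - c) x _ _ (is_derive_cos (x - c)) dB.
by apply: (is_derive_eq H); rewrite mulr1.
Qed.

Let dsinB (c x : R) : is_derive x 1 (fun x : R => sin (x - c)) (cos (x - c)).
Proof.
have dB : is_derive x 1 (fun x : R => x - c) 1.
  have -> : (fun x : R => x - c) = id - cst c by [].
  by apply: is_derive_eq; rewrite subr0.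
have H : is_derive x 1 (@sin R \o (fun x : R => x - c)) _ := @is_derive1_comp R (@sin R) (fun x : R => x - c) x _ _ (is_derive_sin (x - c)) dB.
by apply: (is_derive_eq H); rewrite mulr1.
Qed.

Let cX (f : R -> R) n : continuous f -> continuous (fun x => f x ^+ n).
Proof.
move=> cf; elim: n => [|n IH].
  by under eq_fun do rewrite expr0; exact: cst_continuous.
have -> : (fun x => f x ^+ n.+1) = (fun x => f x * f x ^+ n).
  by apply/funext => y; rewrite exprS.
by move=> x; exact: (continuousM (cf x) (IH x)).
Qed.

Let cM (f g : R -> R) : continuous f -> continuous g -> continuous (fun x => f x * g x).
Proof. by move=> cf cg x; exact: (continuousM (cf x) (cg x)). Qed.

Let cint (f : R -> R) (a b : R) : continuous f -> mu.-integrable `[a, b] (EFin \o f).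
Proof.
move=> cf; apply: continuous_compact_integrable; first exact: segment_compact.
exact: continuous_subspaceT.
Qed.

Let pi2_gt0 : 0 < 2 * pi :> R. Proof. by rewrite mulr_gt0// pi_gt0. Qed.

Definition wallis k (c : R) : R := \int[mu]_(x in `[0, 2 * pi]) cos (x - c) ^+ k.

Lemma wallis0 c : wallis 0 c = 2 * pi.
Proof.
have dF (x : R) : is_derive x 1 id (cos (x - c) ^+ 0) by rewrite expr0; exact: is_derive_id.
rewrite /wallis (Rintegral_derive pi2_gt0 dF) ?subr0//.
exact: (@cX (fun x => cos (x - c))).
Qed.

Lemma wallis1 c : wallis 1 c = 0.
Proof.
have dF (x : R) : is_derive x 1 (fun x => sin (x - c)) (cos (x - c) ^+ 1) by rewrite expr1.
rewrite /wallis (Rintegral_derive pi2_gt0 dF); last exact: (@cX (fun x => cos (x - c))).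
have -> : 2 * pi - c = - c + pi *+ 2 by rewrite mulr2n; ring.
by rewrite sinD2pi sub0r subrr.
Qed.

(** The derivative of cos^(k+1) sin integrates to 0 over a full period, whatever the shift c. *)
Lemma wallisS k c : k.+2%:R * wallis k.+2 c = k.+1%:R * wallis k c.
Proof.
have cC n : continuous (fun x : R => cos (x - c) ^+ n) by exact: (@cX (fun x => cos (x - c))).
have cZ n (r : R) : continuous (fun x : R => r * cos (x - c) ^+ n).
  by apply: cM => //; exact: cst_continuous.
have dF (x : R) : is_derive x 1 (fun x => cos (x - c) ^+ k.+1 * sin (x - c))
    (k.+2%:R * cos (x - c) ^+ k.+2 - k.+1%:R * cos (x - c) ^+ k).
  apply: (is_derive_eq (is_deriveM (is_derive_exprn k.+1 (dcosB c x)) (dsinB c x))).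
  have := cos2Dsin2 (x - c); move: (cos (x - c)) (sin (x - c)) => C S CS.
  have E : S ^+ 2 = 1 - C ^+ 2 by rewrite -CS; ring.
  rewrite /GRing.scale/= -[k.+2%:R]natr1.
  transitivity (C ^+ k.+2 - k.+1%:R * C ^+ k * S ^+ 2); last by rewrite E !exprS; ring.
  by rewrite !exprS; ring.
apply/eqP; rewrite -subr_eq0; apply/eqP.
rewrite /wallis -!RintegralZl//; do ?exact: cint.
rewrite -RintegralB//; do ?exact: cint.
rewrite (Rintegral_derive pi2_gt0 dF).
  have -> : 2 * pi - c = - c + pi *+ 2 by rewrite mulr2n; ring.
  by rewrite sinD2pi cosD2pi sub0r subrr.
by move=> x; exact: (continuousB (cZ _ _ x) (cZ _ _ x)).
Qed.

Definition beta_sc a b : R := \int[mu]_(x in `[0, pi]) (sin x ^+ a * cos x ^+ b).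

Let csc a b : continuous (fun x : R => sin x ^+ a * cos x ^+ b).
Proof. by apply: cM; apply: cX; [exact: continuous_sin|exact: continuous_cos]. Qed.

Lemma beta_scS a b : a.+1%:R * beta_sc a b.+2 = b.+1%:R * beta_sc a.+2 b.
Proof.
have cZ (r : R) m n : continuous (fun x : R => r * (sin x ^+ m * cos x ^+ n)).
  by apply: cM => //; exact: cst_continuous.
have dF (x : R) : is_derive x 1 (fun x => sin x ^+ a.+1 * cos x ^+ b.+1)
    (a.+1%:R * (sin x ^+ a * cos x ^+ b.+2) - b.+1%:R * (sin x ^+ a.+2 * cos x ^+ b)).
  apply: (is_derive_eq (is_deriveM (is_derive_exprn a.+1 (is_derive_sin x)) (is_derive_exprn b.+1 (is_derive_cos x)))).
  by move: (cos x) (sin x) => C S; rewrite /GRing.scale/= !exprS; ring.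
apply/eqP; rewrite -subr_eq0; apply/eqP.
rewrite /beta_sc -!RintegralZl//; do ?exact: cint.
rewrite -RintegralB//; do ?exact: cint.
rewrite (Rintegral_derive (pi_gt0 R) dF).
  by rewrite sinpi sin0 !expr0n/= !mul0r subrr.
by move=> x; exact: (continuousB (cZ _ _ _ x) (cZ _ _ _ x)).
Qed.

Lemma beta_sc_1 a : beta_sc a 1 = 0.
Proof.
have dF (x : R) : is_derive x 1 (fun x => a.+1%:R^-1 * sin x ^+ a.+1) (sin x ^+ a * cos x ^+ 1).
  have dc := is_derive_cst (a.+1%:R^-1 : R) x (1 : R).
  apply: (is_derive_eq (is_deriveM dc (is_derive_exprn a.+1 (is_derive_sin x)))).
  have a0 : a.+1%:R != 0 :> R by rewrite pnatr_eq0.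
  by rewrite /GRing.scale/= /cst expr1; move: (a.+1%:R : R) a0 => r r0; field.
rewrite /beta_sc (Rintegral_derive (pi_gt0 R) dF); last exact: csc.
by rewrite sinpi sin0 expr0n mulr0 subrr.
Qed.

(** Substitution t = cos x. The weight sin x is the colatitude part of the surface density, so here
    integrals over the sphere become [pint]. *)
Lemma beta_sc1 n : beta_sc 1 n = pint ('X^n).
Proof.
have -> : ('X^n : {poly R}) = (n.+1%:R^-1 *: 'X^(n.+1))^`().
  by rewrite derivZ derivXn -scalerMnr scalerMnl -[_ *+ _]mulr_natr mulVf ?scale1r// pnatr_eq0.
have dF (x : R) : is_derive x 1 (fun x => - (n.+1%:R^-1) * cos x ^+ n.+1) (sin x ^+ 1 * cos x ^+ n).
  have dc := is_derive_cst (- n.+1%:R^-1 : R) x (1 : R).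
  apply: (is_derive_eq (is_deriveM dc (is_derive_exprn n.+1 (is_derive_cos x)))).
  have a0 : n.+1%:R != 0 :> R by rewrite pnatr_eq0.
  by rewrite /GRing.scale/= /cst expr1; move: (n.+1%:R : R) a0 => r r0; field.
rewrite pint_deriv /beta_sc (Rintegral_derive (pi_gt0 R) dF); last exact: csc.
by rewrite cospi cos0 !hornerZ !hornerXn; ring.
Qed.

Lemma beta_sc_odd a b : beta_sc a b.*2.+1 = 0.
Proof.
elim: b a => [|b IH] a; first exact: beta_sc_1.
apply: (@mulfI _ a.+1%:R); first by rewrite pnatr_eq0.
by rewrite doubleS beta_scS IH !mulr0.
Qed.

Lemma sum_even_odd (F : nat -> R) n : \sum_(0 <= k < n) F k =
  \sum_(0 <= j < uphalf n) F j.*2 + \sum_(0 <= j < n./2) F j.*2.+1.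
Proof.
elim: n => [|n IH]; first by rewrite !big_geq// addr0.
have E1 : uphalf n.+1 = (n./2).+1 by [].
have E2 : n.+1./2 = uphalf n by [].
rewrite E1 E2 big_nat_recr//= IH !uphalf_half.
have := odd_double_half n; case: (odd n) => /= nE.
  by rewrite !add1n [X in _ = _ + X]big_nat_recr//= -[in F n]nE add1n; ring.
by rewrite !add0n [X in _ = X + _]big_nat_recr//= -[in F n]nE add0n; ring.
Qed.

(* Only the even moments of [cos] survive, and the surviving terms of the
   binomial expansion add up to [(s ^+ 2 + t ^+ 2) ^+ (n / 2)]. *)
Lemma zonal_moment n (s t c : R) : s ^+ 2 + t ^+ 2 = 1 ->
  \sum_(k < n.+1) 'C(n, k)%:R * (s ^+ k * t ^+ (n - k)) *
    (wallis k c * beta_sc k.+1 (n - k)) = 2 * pi * pint 'X^n.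
Proof.
move=> st.
have W m : wallis m.*2.+1 c = 0.
  elim: m => [|m IH]; first exact: wallis1.
  apply: (@mulfI _ m.*2.+3%:R); first by rewrite pnatr_eq0.
  by rewrite doubleS wallisS IH !mulr0.
rewrite -(big_mkord xpredT (fun k => 'C(n, k)%:R * (s ^+ k * t ^+ (n - k)) *
  (wallis k c * beta_sc k.+1 (n - k)))) (sum_even_odd (fun k => 'C(n, k)%:R * (s ^+ k * t ^+ (n - k)) *
  (wallis k c * beta_sc k.+1 (n - k)))).
rewrite [X in _ + X]big1 ?addr0; last by move=> j _; rewrite W mul0r mulr0.
rewrite -[uphalf n.+1]/(n./2.+1) -beta_sc1 big_mkord.
have := odd_double_half n; move: (n./2) => N; case: (odd n) => /=.
  rewrite add1n => <-; rewrite beta_sc_odd mulr0 big1// => j _.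
  by rewrite subSn ?leq_double -1?ltnS// -doubleB beta_sc_odd !mulr0.
rewrite add0n => <-.
(* Induction on j: by [wallisS], [beta_scS] and the recursions for binomials, moving two factors
   from cosine to sine multiplies the left side by (N - j) / (j + 1), which is the ratio of C(N,
   j+1) to C(N, j). *)
have B (j : nat) : (j <= N)%N ->
    'C(N.*2, j.*2)%:R * (wallis j.*2 c * beta_sc j.*2.+1 (N.*2 - j.*2)) =
    'C(N, j)%:R * (2 * pi * beta_sc 1 N.*2).
  elim: j => [|j IH] jN; first by rewrite !bin0 !mul1r wallis0 subn0.
  move: (IH (ltnW jN)).
  have E : (N - j = (N - j.+1).+1)%N by rewrite subnSK.
  rewrite -!doubleB E; move: (N - j.+1)%N E => M E.
  rewrite !doubleS => IHj.
  have e1 := wallisS j.*2 c.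
  have e2 := beta_scS j.*2.+1 M.*2.
  have e3 : (j.*2.+1%:R * 'C(N.*2, j.*2.+1)%:R = M.*2.+2%:R * 'C(N.*2, j.*2)%:R :> R).
    by rewrite -!natrM mul_bin_left -doubleB E doubleS.
  have e4 : (j.*2.+2%:R * 'C(N.*2, j.*2.+2)%:R = M.*2.+1%:R * 'C(N.*2, j.*2.+1)%:R :> R).
    by rewrite -!natrM mul_bin_left subnS -doubleB E doubleS.
  have e5 : (j.*2.+2%:R * 'C(N, j.+1)%:R = M.*2.+2%:R * 'C(N, j)%:R :> R).
    rewrite -!natrM -[j.*2.+2]doubleS -[M.*2.+2]doubleS -!muln2 -!mulnA ![(2 * _)%N]mulnC !mulnA.
    by rewrite mul_bin_left E.
  have n0 k : k.+1%:R != 0 :> R by rewrite pnatr_eq0.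
  move: e1 e2 e3 e4 e5 IHj (n0 j.*2) (n0 j.*2.+1) (n0 M.*2).
  move: (j.*2.+1%:R : R) (j.*2.+2%:R : R) (M.*2.+1%:R : R) (M.*2.+2%:R : R) => a b u v.
  move: (wallis _ c) (wallis _ c) (beta_sc _ _) (beta_sc _.+3 _) => W2 W0 b0 b2.
  move: ('C(_, _)%:R : R) ('C(_, _)%:R : R) ('C(_, _)%:R : R) ('C(_, _)%:R : R) ('C(_, _)%:R : R) => c2 d2 c1 c0 d0.
  move=> h1 h2 h3 h4 h5 h6 a0 b0' u0.
  have -> : W0 = a * W2 / b by rewrite -h1; field.
  have -> : b2 = b * b0 / u by rewrite h2; field.
  have -> : c1 = u * d0 / b by rewrite -h4; field.
  have -> : d0 = v * c0 / a by rewrite -h3; field.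
  have -> : d2 = v * c2 / b by rewrite -h5; field.
  transitivity (v / b * (c0 * (W2 * b0))); first by field; rewrite a0 b0' u0.
  by rewrite h6; ring.
rewrite (eq_bigr (fun j : 'I_N.+1 => s ^+ j.*2 * t ^+ (N.*2 - j.*2) * 'C(N, j)%:R *
  (2 * pi * beta_sc 1 N.*2))); last first.
  move=> j _; rewrite -[RHS]mulrA -B -1?ltnS//.
  by move: (wallis _ _ * _) => X; rewrite -[LHS]mulrA mulrCA.
rewrite -mulr_suml.
have -> : \sum_(i < N.+1) s ^+ i.*2 * t ^+ (N.*2 - i.*2) * 'C(N, i)%:R = 1.
  transitivity ((t ^+ 2 + s ^+ 2) ^+ N); last by rewrite addrC st expr1n.
  rewrite exprDn; apply: eq_bigr => i _.
  by rewrite -!exprM -doubleB -!mul2n mulr_natr [_ * s ^+ _]mulrC.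
by rewrite mul1r.
Qed.

End trig_integrals.

Lemma integrable_indic d (T : measurableType d) (R : realType)
    (m : {measure set T -> \bar R}) (D : set T) (h : T -> R) :
  bmf h -> measurable D -> (m D < +oo)%E ->
  m.-integrable setT (fun x => (h x * \1_D x)%:E).
Proof.
move=> [mh [M hM]] mD fD.
have -> : (fun x => (h x * \1_D x)%:E) = (EFin \o h) \_ D.
  apply/funext => x; rewrite /patch indicE.
  by case: ifPn => _; rewrite ?mulr1 ?mulr0.
apply/(integrable_mkcond _ _).1 => //; apply: measurable_bounded_integrable => //.
  exact: measurable_funTS.
exists M; split; first exact: num_real.
by move=> N MN x _ /=; rewrite (le_trans (hM x))// ltW.
Qed.

Section bounded_integral.
Context d (T : measurableType d) (R : realType).
Variable m : {finite_measure set T -> \bar R}.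
Implicit Types f g : T -> R.

Lemma bmf_RintegralD f g : bmf f -> bmf g ->
  \int[m]_x (f x + g x) = \int[m]_x f x + \int[m]_x g x.
Proof. by move=> bf bg; rewrite RintegralD//; exact: bmf_integrable. Qed.

Lemma bmf_RintegralZl c f : bmf f -> \int[m]_x (c * f x) = c * \int[m]_x f x.
Proof. by move=> bf; rewrite RintegralZl//; exact: bmf_integrable. Qed.

Lemma bmf_Rintegral_sum (I : Type) (s : seq I) (F : I -> T -> R) :
  (forall i, bmf (F i)) ->
  \int[m]_x (\sum_(i <- s) F i x) = \sum_(i <- s) \int[m]_x F i x.
Proof.
move=> bF; elim: s => [|i s IH].
  under eq_Rintegral do rewrite big_nil.
  by rewrite big_nil Rintegral_cst// mul0r.
under eq_Rintegral do rewrite big_cons.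
by rewrite big_cons bmf_RintegralD ?IH//; exact: bmf_sum.
Qed.

End bounded_integral.

(** * Surface measure in colatitude and longitude, and zonal integrals *)

Section angle_measure.
Variable R : realType.
Local Notation mu := (@lebesgue_measure R).
Local Notation AT := (measurableTypeR R * measurableTypeR R)%type.
Implicit Types (t s : AT).

(* The surface area in spherical coordinates, as a measure on pairs of angles. *)
Definition angle_measure (A : set AT) : \bar R :=
  (\int[mu \x mu]_(t in @angles R `&` A) (sin t.1)%:E)%E.

Let msin : measurable_fun setT (fun t : AT => sin t.1).
Proof.
apply: (@measurableT_comp _ _ _ _ _ _ _ _ (fst : AT -> measurableTypeR R)) => //; apply: continuous_measurable_fun.
exact: continuous_sin.
Qed.

Let mcos : measurable_fun setT (fun t : AT => cos t.1).
Proof.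
apply: (@measurableT_comp _ _ _ _ _ _ _ _ (fst : AT -> measurableTypeR R)) => //; apply: continuous_measurable_fun.
exact: continuous_cos.
Qed.

Let sin_ge0_angles t : angles t -> (0 <= (sin t.1)%:E)%E.
Proof.
by case; rewrite /= in_itv/= => /andP[t0 tpi] _; rewrite lee_fin sin_ge0_pi// t0.
Qed.

Let measurable_piece (A : set AT) : measurable A ->
  measurable (@angles R `&` A).
Proof. by move=> mA; apply: measurableI => //; exact: measurable_angles. Qed.

Let angle_measure0 : angle_measure set0 = 0%E.
Proof. by rewrite /angle_measure setI0 integral_set0. Qed.

Let angle_measure_ge0 A : (0 <= angle_measure A)%E.
Proof. by apply: integral_ge0 => t [/sin_ge0_angles]. Qed.

Let angle_measure_sigma_additive : semi_sigma_additive angle_measure.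
Proof.
move=> F mF tF mUF.
rewrite /angle_measure setI_bigcupr ge0_integral_bigcup.
- apply: is_cvg_nneseries => n _ _.
  exact: angle_measure_ge0.
- by move=> k; exact: measurable_piece.
- by apply: measurable_funTS; exact/measurable_EFinP.
- by move=> t [k _] [/sin_ge0_angles].
- move=> i j _ _ [t [[_ Fi] [_ Fj]]]; apply: (tF i j I I).
  by exists t.
Qed.

HB.instance Definition _ := isMeasure.Build _ _ _ angle_measure
  angle_measure0 angle_measure_ge0 angle_measure_sigma_additive.

Let angles_fin : ((mu \x mu) (@angles R) < +oo)%E.
Proof.
rewrite /angles product_measure1E//= !lebesgue_measure_itv/=.
by rewrite !lte_fin pi_gt0 mulr_gt0 ?pi_gt0//= ltry.
Qed.

Let angle_measure_fin : fin_num_fun angle_measure.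
Proof.
move=> A mA; rewrite ge0_fin_numE; last exact: angle_measure_ge0.
apply: le_lt_trans angles_fin.
rewrite -[leRHS]mul1e -integral_cst; last exact: measurable_angles.
apply: (@le_trans _ _ (\int[mu \x mu]_(t in @angles R `&` A) (cst 1 t))%E).
  apply: ge0_le_integral => //.
  - by apply: measurableI => //; exact: measurable_angles.
  - by move=> t [/sin_ge0_angles].
  - by apply: measurable_funTS; exact/measurable_EFinP.
  - by move=> t _; rewrite lee_fin sin_le1.
apply: ge0_subset_integral => //.
- by apply: measurableI => //; exact: measurable_angles.
- exact: measurable_angles.
Qed.

HB.instance Definition _ := Measure_isFinite.Build _ _ _ angle_measure
  angle_measure_fin.

Let density t : R := sin t.1 * \1_(@angles R) t.

Lemma angle_measure_density (f : AT -> R) : measurable_fun setT f ->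
  (\int[angle_measure]_t (f t)%:E =
   \int[mu \x mu]_(t in @angles R) (f t * sin t.1)%:E)%E.
Proof.
move=> mf; pose nu : {measure set AT -> \bar R} := angle_measure.
pose mm : {measure set AT -> \bar R} := (mu \x mu)%E.
rewrite -[LHS]/(\int[nu]_t (f t)%:E)%E -[RHS]/(\int[mm]_(t in @angles R) (f t * sin t.1)%:E)%E.
rewrite (@integral_density _ _ R mm nu density)//.
- rewrite [RHS]integral_mkcond; apply: eq_integral => t _.
  rewrite /density /patch indicE; case: ifPn => _; first by rewrite mulr1.
  by rewrite !mulr0.
- move=> t; rewrite /density indicE; case: (boolP (_ \in _)) => [|_].
    by rewrite inE mulr1 -lee_fin; exact: sin_ge0_angles.
  by rewrite mulr0.
- by apply: measurable_funM => //; apply: measurable_indic; exact: measurable_angles.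
- move=> A mA; rewrite -[LHS]/(\int[mm]_(t in @angles R `&` A) (sin t.1)%:E)%E.
  rewrite [LHS]integral_mkcond [RHS]integral_mkcond; apply: eq_integral => t _.
  rewrite /density /patch in_setI indicE.
  by case: (t \in A); rewrite ?andbF ?andbT//; case: ifPn => _; rewrite ?mulr1 ?mulr0.
Qed.

Lemma measurable_sph : measurable_fun (setT : set AT) (@spherical_coord R).
Proof. exact: measurable_spherical_coord. Qed.

(** [surface_area] is by definition the image of [angle_measure] under [spherical_coord], whose
    values all lie on the sphere; the restriction to the sphere therefore removes nothing. *)
Lemma integral_surface_area (f : R * R * R -> R) : measurable_fun setT f ->
  angle_measure.-integrable setT (EFin \o f \o @spherical_coord R) ->
  \int[@surface_area R]_(x in @sphere R) f x =
  \int[angle_measure]_t f (spherical_coord t).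
Proof.
move=> mf intf; rewrite /Rintegral; congr fine.
have E : @spherical_coord R @^-1` @sphere R = setT.
  by apply/seteqP; split => // t _; exact: sphere_spherical_coord.
have mS : measurable (@sphere R).
  have -> : @sphere R = (fun x : R * R * R => x.1.1 ^+ 2 + x.1.2 ^+ 2 + x.2 ^+ 2) @^-1` [set 1] by [].
  rewrite -[X in measurable X]setTI.
  have : measurable_fun setT (fun x : R * R * R => x.1.1 ^+ 2 + x.1.2 ^+ 2 + x.2 ^+ 2).
    by apply: measurable_funD; [apply: measurable_funD|]; apply: measurable_funX => //;
      apply: measurableT_comp => //.
  by apply => //; exact: measurable_set1.
pose nu : {measure set AT -> \bar R} := angle_measure.
rewrite -[RHS]/(\int[nu]_t (f (spherical_coord t))%:E)%E.
rewrite -[LHS]/(\int[pushforward nu (@spherical_coord R)]_(x in @sphere R) (f x)%:E)%E.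
by rewrite (@integral_pushforward _ _ _ _ _ _ measurable_sph nu _ (EFin \o f))// ?E//; exact/measurable_EFinP.
Qed.

Lemma angle_measure_prod (f g : measurableTypeR R -> R) : bmf f -> bmf g ->
  \int[angle_measure]_t (f t.1 * g t.2) =
  \int[mu]_(x in `[0, pi]) (f x * sin x) * \int[mu]_(y in `[0, 2 * pi]) g y.
Proof.
move=> bf bg; have bs : bmf (@sin R : measurableTypeR R -> R).
  by apply: (@bmf_sin _ _ _ id).
have mI a b : measurable (`[a, b]%classic : set (measurableTypeR R)) by exact: measurable_itv.
have bfs := bmfM bf bs.
pose F (x : measurableTypeR R) := f x * sin x * \1_(`[0, pi] : set (measurableTypeR R)) x.
pose G (x : measurableTypeR R) := g x * \1_(`[0, 2 * pi] : set (measurableTypeR R)) x.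
have bF : bmf F by apply: bmfM => //; apply: bmf_indic; exact: mI.
have bG : bmf G by apply: bmfM => //; apply: bmf_indic; exact: mI.
have intI (h : measurableTypeR R -> R) (b : R) : bmf h -> 0 < b ->
    mu.-integrable setT (fun x => (h x * \1_(`[0, b] : set (measurableTypeR R)) x)%:E).
  move=> bh b0; apply: integrable_indic => //.
  have /= -> := @lebesgue_measure_itv R `[0, b]; by rewrite lte_fin b0 oppr0 adde0 ltry.
have p2 : 0 < 2 * pi :> R by rewrite mulr_gt0 ?pi_gt0.
have iF := intI _ _ bfs (pi_gt0 R); have iG := intI _ _ bg p2.
have fE (h : measurableTypeR R -> R) (A : set (measurableTypeR R)) :
    \int[mu]_(x in A) h x = \int[mu]_x (h x * \1_A x).
  rewrite /Rintegral; congr fine.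
  rewrite [LHS]integral_mkcond; apply: eq_integral => x _; rewrite /patch indicE.
  by case: ifPn => _; rewrite ?mulr1 ?mulr0.
have bfst (h : measurableTypeR R -> R) : bmf h -> bmf (fun t : AT => h t.1).
  by move=> bh; apply: (@bmf_comp _ _ AT _ _ h fst).
have bsnd (h : measurableTypeR R -> R) : bmf h -> bmf (fun t : AT => h t.2).
  by move=> bh; apply: (@bmf_comp _ _ AT _ _ h snd).
have mA : measurable (@angles R : set AT) by exact: measurable_angles.
rewrite (fE (fun x => f x * sin x)) (fE g) /Rintegral angle_measure_density; last first.
  exact: (bmfM (bfst _ bf) (bsnd _ bg)).1.
pose mm : {measure set AT -> \bar R} := (mu \x mu)%E.
have FGE : (fun t : AT => (f t.1 * g t.2 * sin t.1)%:E) \_ (@angles R) =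
    (fun t : AT => (F t.1 * G t.2)%:E).
  apply/funext => -[x y]; rewrite /patch /F /G /angles /= !indicE in_setX/=.
  by case: (x \in _); case: (y \in _); rewrite ?mulr1 ?mulr0 ?mul0r//= mulrAC.
have iFG : mm.-integrable setT (fun t : AT => (F t.1 * G t.2)%:E).
  rewrite -FGE.
  have -> : (fun t : AT => (f t.1 * g t.2 * sin t.1)%:E) \_ (@angles R) =
      (fun t : AT => (f t.1 * g t.2 * sin t.1 * \1_(@angles R) t)%:E).
    apply/funext => t; rewrite /patch indicE.
    by case: ifPn => _; rewrite ?mulr1 ?mulr0.
  apply: integrable_indic => //.
  by apply: bmfM; [apply: bmfM; [exact: bfst|exact: bsnd]|exact: bfst].
rewrite [in LHS]integral_mkcond FGE.
rewrite -(@integral12_prod_meas1 _ _ _ _ R mu mu _ iFG).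
have cG : (\int[mu]_y (G y)%:E = (\int[mu]_y G y)%:E)%E.
  by rewrite /Rintegral fineK//; exact: integrable_fin_num.
transitivity (\int[mu]_x ((\int[mu]_y G y) * F x)).
  rewrite /Rintegral; congr fine; apply: eq_integral => x _.
  rewrite /fubini_F /=; under eq_integral => y _ do rewrite EFinM.
  by rewrite integralZl//= cG -EFinM mulrC.
rewrite RintegralZl//.
by rewrite mulrC.
Qed.

(** The inner product is cos s.1 cos t.1 + sin s.1 sin t.1 cos(t.2 - s.2), so its powers expand into
    products of a function of t.1 and a function of t.2. The explicit moments of [zonal_moment] then
    show that the pole s has no influence. *)
Lemma zonal_integral (s : AT) (p : {poly R}) :
  \int[angle_measure]_t p.[dot (spherical_coord t) (spherical_coord s)] =
  2 * pi * pint p.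
Proof.
have bsn : bmf (@sin R : measurableTypeR R -> R) by apply: (@bmf_sin _ _ _ id).
have bcs : bmf (@cos R : measurableTypeR R -> R) by apply: (@bmf_cos _ _ _ id).
have bcc : bmf (fun x : measurableTypeR R => cos (x - s.2)).
  apply: bmf_cos; exact: (@measurable_funD _ _ R setT id (fun=> - s.2)).
have bfst (h : measurableTypeR R -> R) : bmf h -> bmf (fun t : AT => h t.1).
  by move=> bh; apply: (@bmf_comp _ _ AT _ _ h fst).
have bsnd (h : measurableTypeR R -> R) : bmf h -> bmf (fun t : AT => h t.2).
  by move=> bh; apply: (@bmf_comp _ _ AT _ _ h snd).
pose E (t : AT) : R := sin t.1 * cos (t.2 - s.2).
pose D (t : AT) : R := cos s.1 * cos t.1 + sin s.1 * E t.
have DE (t : AT) : dot (spherical_coord t) (spherical_coord s) = D t.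
  rewrite /dot /D /E /= cosB; ring.
under eq_Rintegral => t _ do rewrite DE.
have bE : bmf E by apply: bmfM; [exact: bfst|exact: (bsnd _ bcc)].
have bD : bmf D by apply: bmfD; apply: bmfM => //; try exact: bmf_cst; exact: bfst.
have monom n : \int[angle_measure]_t (D t ^+ n) = 2 * pi * pint 'X^n.
  have sc : sin s.1 ^+ 2 + cos s.1 ^+ 2 = 1 by rewrite addrC cos2Dsin2.
  rewrite -(zonal_moment n s.2 sc).
  under eq_Rintegral => t _ do rewrite /D exprDn.
  rewrite bmf_Rintegral_sum; last first.
    move=> i; under eq_fun do rewrite -mulr_natl.
    apply: bmfM; first exact: bmf_cst.
    by apply: bmfM; apply: bmfX; apply: bmfM => //; try exact: bmf_cst; exact: bfst.
  apply: eq_bigr => i _.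
  have b1 : bmf (fun x : measurableTypeR R => sin x ^+ i * cos x ^+ (n - i)).
    by apply: bmfM; exact: bmfX.
  have b2 : bmf (fun x : measurableTypeR R => cos (x - s.2) ^+ i) by exact: bmfX.
  transitivity (\int[angle_measure]_t (('C(n, i)%:R * (sin s.1 ^+ i * cos s.1 ^+ (n - i))) *
      ((sin t.1 ^+ i * cos t.1 ^+ (n - i)) * cos (t.2 - s.2) ^+ i))).
    apply: eq_Rintegral => t _; rewrite -mulr_natl !exprMn; ring.
  rewrite bmf_RintegralZl; last by apply: bmfM; [exact: (bfst _ b1)|exact: (bsnd _ b2)].
  congr (_ * _); rewrite (angle_measure_prod b1 b2) mulrC; congr (_ * _).
  rewrite /beta_sc; apply: eq_Rintegral => x _; rewrite exprS; ring.
rewrite [in RHS](_ : p = \sum_(i < size p) p`_i *: 'X^i); last first.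
  by rewrite -[LHS]coefK poly_def.
under eq_Rintegral => t _ do rewrite horner_coef.
rewrite bmf_Rintegral_sum; last first.
  by move=> i; apply: bmfM; [exact: bmf_cst|exact: bmfX].
have pint0 : pint (0 : {poly R}) = 0.
  by rewrite -(scale0r (0 : {poly R})) pintZ mul0r.
rewrite (big_morph (@pint R) (@pintD R) pint0) mulr_sumr; apply: eq_bigr => i _.
rewrite bmf_RintegralZl; last exact: bmfX.
by rewrite monom pintZ mulrCA.
Qed.

Lemma angle_measureT : angle_measure setT = (4 * pi)%:E.
Proof.
have := @zonal_integral 0 1; under eq_Rintegral do rewrite hornerC.
rewrite Rintegral_cst// mul1r -(derivX R) pint_deriv !hornerX opprK => h.
by rewrite -(fineK (fin_num_measure angle_measure _ measurableT)) h; congr EFin; ring.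
Qed.

End angle_measure.

(** * Gaussian integrals *)

Lemma Rintegral_dct d (T : measurableType d) (R : realType)
    (m : {measure set T -> \bar R}) (f_ : nat -> T -> R) (f g : T -> R) :
  (forall n, measurable_fun setT (f_ n)) ->
  (forall x, f_ n x @[n --> \oo] --> f x) ->
  m.-integrable setT (EFin \o g) -> (forall n x, `|f_ n x| <= g x) ->
  m.-integrable setT (EFin \o f) /\
  \int[m]_x f_ n x @[n --> \oo] --> \int[m]_x f x.
Proof.
move=> mf_ f_f ig f_g.
have mf : measurable_fun setT f by apply: (measurable_fun_cvg mf_) => x _; exact: f_f.
have [|||||if_ _ cf] := @dominated_convergence _ _ _ m setT measurableT
    (fun n => EFin \o f_ n) (EFin \o f) (EFin \o g).
- by move=> n; exact/measurable_EFinP.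
- exact/measurable_EFinP.
- by apply: aeW => x _ /=; apply: cvg_EFin; [exact: nearW|exact: f_f].
- exact: ig.
- by apply: aeW => x n _ /=; rewrite lee_fin.
split => //; rewrite /Rintegral; apply: fine_cvg; rewrite fineK//.
exact: integrable_fin_num.
Qed.

Section real_ftc.
Variable R : realType.
Local Notation mu := (@lebesgue_measure R).
Local Notation MR := (measurableTypeR R).
Variables G g : R -> R.
Hypothesis dG : forall x : R, is_derive x 1 G (g x).
Hypothesis cg : continuous g.
Hypothesis ig : mu.-integrable setT (fun x : MR => (g x)%:E).

Let mg : measurable_fun setT (g : MR -> R).
Proof. exact: continuous_measurable_fun. Qed.

(** Exhaustion by compact intervals: the fundamental theorem on each of them, then dominated
    convergence under |g|. *)
Let cvg_itv (a b : nat -> R) (A : set MR) (c : R) :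
  (forall n, a n < b n) -> (forall x, \forall n \near \oo, (x \in `[a n, b n]) = (x \in A)) ->
  G (b n) - G (a n) @[n --> \oo] --> c ->
  \int[mu]_x (g x * \1_A x) = c.
Proof.
move=> ab nab Gc.
pose I n : set MR := `[a n, b n]%classic.
have mI n : measurable (I n) by exact: measurable_itv.
have [||||_ h] := @Rintegral_dct _ _ _ mu (fun n (x : MR) => g x * \1_(I n) x)
  (fun x : MR => g x * \1_A x) (fun x : MR => `|g x|).
- by move=> n; apply: measurable_funM => //; exact: measurable_indic.
- move=> x; apply: cvg_near_cst; near=> n; rewrite !indicE.
  congr (_ * (nat_of_bool _)%:R).
  have : (x \in `[a n, b n]) = (x \in A) by near: n; exact: nab.
  by move=> <-; rewrite /I mem_setE.
- exact: (integrable_abse ig).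
- move=> n x; rewrite normrM indicE; case: (_ \in _) => /=.
    by rewrite normr1 mulr1.
  by rewrite normr0 mulr0.
apply: (cvg_unique _ h) => //; apply: cvg_trans Gc.
apply: near_eq_cvg; apply: nearW => n.
rewrite -(Rintegral_derive (ab n) dG cg) /Rintegral; congr fine.
rewrite [LHS]integral_mkcond; apply: eq_integral => x _; rewrite /patch indicE.
by case: ifPn => _; rewrite ?mulr1 ?mulr0.
Unshelve. all: by end_near. Qed.

Hypothesis GNy : G x @[x --> -oo] --> (0 : R).

Let ltMn (z M : R) : \forall n \near \oo, M <= z + n.+1%:R.
Proof.
have := nbhs_infty_ger (M - z); apply: filterS => n.
by rewrite lerBlDl => /le_trans -> //; rewrite lerD2l ler_nat.
Qed.

Let cvgNy (z : R) : G (z - n.+1%:R) @[n --> \oo] --> (0 : R).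
Proof.
apply: cvg_comp GNy; apply/cvgrNyPle => M.
by have := ltMn (- z) (- M); apply: filterS => n; rewrite lerNl opprD opprK addrC.
Qed.

Lemma Rintegral_le_derive z : \int[mu]_x (g x * \1_(`]-oo, z]%classic : set MR) x) = G z.
Proof.
apply: (@cvg_itv (fun n => z - n.+1%:R) (fun=> z)).
- by move=> n; rewrite gtrBl.
- move=> x; have := ltMn x z; apply: filterS => n.
  by rewrite mem_setE !in_itv/= -lerBlDr => ->.
- by rewrite -[X in _ --> X]subr0; apply: cvgB; [exact: cvg_cst|exact: cvgNy].
Qed.

Lemma Rintegral_real_derive : G x @[x --> +oo] --> (0 : R) -> \int[mu]_x g x = 0.
Proof.
move=> Gy; rewrite -(@cvg_itv (fun n => 0 - n.+1%:R) (fun n => 0 + n.+1%:R) setT 0).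
- by apply: eq_Rintegral => x _; rewrite indicT mulr1.
- by move=> n; rewrite sub0r add0r gtrN.
- move=> x; have := ltMn 0 x; have := ltMn 0 (- x).
  apply: filterS2 => n h1 h2.
  by rewrite in_itv/= h2 sub0r lerNl -[leRHS]add0r h1 in_setT.
- rewrite -[X in _ --> X]subr0; apply: cvgB; last exact: cvgNy.
  by apply: cvg_comp Gy; apply/cvgryPge => M; exact: ltMn.
Qed.

End real_ftc.

(** * Normal densities and Gaussian integration by parts *)

Section normal.
Variables (R : realType) (m s : R).
Hypothesis s0 : s != 0.
Local Notation mu := (@lebesgue_measure R).
Local Notation MR := (measurableTypeR R).
Local Notation pdf := (normal_pdf m s).

Lemma is_derive_normal_pdf (x : R) :
  is_derive x 1 pdf (- ((x - m) / s ^+ 2) * pdf x).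
Proof.
rewrite normal_pdfE// /normal_fun.
have d1 : is_derive x 1 (fun y : R => - (s ^+ 2 *+ 2)^-1 * (y - m) ^+ 2)
    (- ((x - m) / s ^+ 2)).
  have d2 : is_derive x 1 (fun y : R => y - m) 1.
    by apply: (is_derive_eq (is_deriveB _ (is_derive_cst m x (1 : R)))); rewrite subr0.
  apply: (is_derive_eq (is_deriveM (is_derive_cst (- (s ^+ 2 *+ 2)^-1) x (1 : R))
    (is_derive_exprn 2 d2))).
  rewrite /GRing.scale/=; field; exact: s0.
have := is_deriveM (is_derive_cst (normal_peak s) x (1 : R))
  (is_derive1_comp (is_derive_expR _) d1).
set f := (X in is_derive _ _ X); set g := (X in _ -> is_derive _ _ X _).
have -> : f = g.
  apply/funext => y; rewrite /f /g /=; congr (_ * expR _).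
  by rewrite mulrC mulrN mulNr.
move=> h; apply: (is_derive_eq h); rewrite /GRing.scale/= /cst.
have -> : - (s ^+ 2 *+ 2)^-1 * (x - m) ^+ 2 = - (x - m) ^+ 2 / (s ^+ 2 *+ 2).
  by rewrite mulrC mulrN mulNr.
ring.
Qed.

(** Doubling the standard deviation leaves a factor exp(-3c) to spare, with c = (x - m)^2 / (8 s^2).
    It absorbs the quartic because (1 + c)^2 <= exp(3c), and (x - m)^4 = 64 s^4 c^2 explains the
    constant. *)
Lemma normal_pdf_bound : exists C : R, 0 <= C /\
  forall x, (1 + (x - m) ^+ 4) * pdf x <= C * normal_pdf m (2 * s) x.
Proof.
have s20 : 2 * s != 0 by rewrite mulf_neq0.
have p2 := normal_peak_gt0 s20.
have p1 := normal_peak_ge0 s.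
exists (normal_peak s * (1 + 64 * s ^+ 4) / normal_peak (2 * s)); split.
  by apply: divr_ge0; [apply: mulr_ge0 => //; rewrite addr_ge0// mulr_ge0// exprn_even_ge0|exact: ltW].
move=> x; rewrite !normal_pdfE// /normal_fun.
pose c := (x - m) ^+ 2 / (8 * s ^+ 2).
have c0 : 0 <= c by rewrite divr_ge0 ?sqr_ge0// mulr_ge0// sqr_ge0.
have -> : - (x - m) ^+ 2 / (s ^+ 2 *+ 2) = - c - c *+ 3 by rewrite /c; field.
have -> : - (x - m) ^+ 2 / ((2 * s) ^+ 2 *+ 2) = - c by rewrite /c; field.
have -> : normal_peak s * (1 + 64 * s ^+ 4) / normal_peak (2 * s) *
  (normal_peak (2 * s) * expR (- c)) = normal_peak s * (1 + 64 * s ^+ 4) * expR (- c).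
  by field; rewrite gt_eqF.
have e1 : 1 + (x - m) ^+ 4 <= (1 + 64 * s ^+ 4) * expR (c *+ 3).
  have -> : (x - m) ^+ 4 = 64 * s ^+ 4 * c ^+ 2 by rewrite /c; field.
  have e2 : (1 + c) ^+ 2 <= expR (c *+ 3).
    rewrite !mulrS mulr0n addr0 !expRD.
    have := expR_ge1Dx c; move: (expR c) => E cE; nra.
  have s4 : 0 <= 64 * s ^+ 4 by rewrite mulr_ge0// exprn_even_ge0.
  nra.
have p3 := expR_gt0 (- c); have p4 := expR_gt0 (c *+ 3).
rewrite expRD expRN.
have : (1 + (x - m) ^+ 4) / expR (c *+ 3) <= 1 + 64 * s ^+ 4.
  by rewrite ler_pdivrMr.
move=> h.
have := ler_wpM2l (mulr_ge0 p1 (ltW p3)) h; rewrite -!expRN; lra.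
Qed.

Lemma normal_pdf_small (e : R) : 0 < e -> exists M : R, forall x, M <= `|x - m| -> pdf x <= e.
Proof.
move=> e0; have p1 := normal_peak_ge0 s.
exists (2 * s ^+ 2 * normal_peak s / e + 1) => x h.
have s2 : 0 < s ^+ 2 by rewrite exprn_even_gt0.
set y := `|x - m| in h.
have y1 : 1 <= y by apply: le_trans h; rewrite lerDr; apply: divr_ge0; [apply: mulr_ge0 => //; apply: mulr_ge0 => //; exact: ltW|exact: ltW].
rewrite normal_pdfE// /normal_fun.
pose c := y ^+ 2 / (s ^+ 2 *+ 2).
have -> : - (x - m) ^+ 2 / (s ^+ 2 *+ 2) = - c by rewrite /c /y real_normK ?num_real// mulNr.
have pc : normal_peak s <= e * c.
  have e1 : 2 * s ^+ 2 * normal_peak s <= e * (y - 1).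
    have := h; rewrite -lerBrDr ler_pdivrMr//; lra.
  rewrite /c mulrA ler_pdivlMr ?mulrn_wgt0//.
  have yy : y <= y ^+ 2 by rewrite expr2 ler_peMl// (le_trans ler01 y1).
  have := ler_wpM2l (ltW e0) yy; rewrite -mulr_natr; lra.
have c0 : 0 <= c by rewrite divr_ge0 ?sqr_ge0// mulrn_wge0// ltW.
rewrite expRN ler_pdivrMr ?expR_gt0//.
apply: (le_trans pc); rewrite ler_pM2l//.
by apply: le_trans (expR_ge1Dx _); rewrite lerDr.
Qed.

End normal.

Section normal_integral.
Variables (R : realType) (m s : R).
Hypothesis s0 : s != 0.
Local Notation mu := (@lebesgue_measure R).
Local Notation MR := (measurableTypeR R).
Local Notation pdf := (normal_pdf m s).
Local Notation gamma := (normal_prob m s).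

Lemma normal_integralE (f : MR -> R) : measurable_fun setT f ->
  (\int[gamma]_x (f x)%:E = \int[mu]_x (f x * pdf x)%:E)%E.
Proof.
move=> mf; apply: (@integral_density _ _ R mu gamma pdf) => //.
- by move=> x; exact: normal_pdf_ge0.
- exact: measurable_normal_pdf.
Qed.

Lemma normal_RintegralE (f : MR -> R) : measurable_fun setT f ->
  \int[gamma]_x f x = \int[mu]_x (f x * pdf x).
Proof. by move=> mf; rewrite /Rintegral normal_integralE. Qed.

(** Degree four is the largest that occurs: in the square of [hermite2], and in x times x^3 + x when
    that square is integrated by parts. *)
Definition quartic_growth (f : MR -> R) := measurable_fun setT f /\
  exists A : R, forall x : R, `|f x| <= A * (1 + (x - m) ^+ 4).

Lemma quartic_growthX k (f : MR -> R) : (k <= 4)%N -> bmf f ->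
  quartic_growth (fun x : MR => (x - m) ^+ k * f x).
Proof.
move=> k4 [mf [M fM]]; split.
  apply: measurable_funM => //; apply: measurable_funX.
  exact: (@measurable_funD _ _ R setT id (fun=> - m)).
exists M => x; rewrite normrM mulrC ler_pM// normrX.
have -> : (x - m) ^+ 4 = `|x - m| ^+ 4 by rewrite -normrX ger0_norm// exprn_even_ge0.
move: `|x - m| (normr_ge0 (x - m)) => y y0.
have [y1|y1] := leP y 1.
  by rewrite (@le_trans _ _ 1) ?exprn_ile1// lerDl exprn_ge0.
by rewrite (@le_trans _ _ (y ^+ 4)) ?lerDr// ler_weXn2l// ltW.
Qed.

Lemma quartic_growth_integrable_pdf (f : MR -> R) : quartic_growth f ->
  mu.-integrable setT (fun x : MR => (f x * pdf x)%:E).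
Proof.
move=> [mf [A fA]]; have [C [C0 hC]] := normal_pdf_bound m s0.
have s20 : 2 * s != 0 by rewrite mulf_neq0.
have ip := integrable_normal_pdf m (2 * s).
apply: (@le_integrable _ _ _ mu setT measurableT _ (fun x : MR => ((`|A| * C) * normal_pdf m (2 * s) x)%:E)).
- by apply/measurable_EFinP; apply: measurable_funM => //; exact: measurable_normal_pdf.
- move=> x _ /=; rewrite lee_fin [leRHS]ger0_norm; last first.
    by rewrite mulr_ge0// ?normal_pdf_ge0// mulr_ge0.
  rewrite normrM (ger0_norm (normal_pdf_ge0 _ _ _)).
  apply: (@le_trans _ _ (`|A| * (1 + (x - m) ^+ 4) * pdf x)).
    apply: ler_wpM2r; first exact: normal_pdf_ge0.
    apply: (le_trans (fA x)); apply: ler_wpM2r; last exact: ler_norm.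
    by rewrite addr_ge0// exprn_even_ge0.
  by rewrite -!mulrA; apply: ler_wpM2l => //; exact: hC.
- exact: (integrableZl _ _ ip).
Qed.

Lemma quartic_growth_integrable (f : MR -> R) : quartic_growth f ->
  gamma.-integrable setT (EFin \o f).
Proof.
move=> gf; have [mf _] := gf; apply/integrableP; split; first exact/measurable_EFinP.
have := quartic_growth_integrable_pdf gf => /integrableP[_].
have -> : (\int[gamma]_x `|(EFin \o f) x| = \int[gamma]_x (`|f x|)%:E)%E by [].
rewrite normal_integralE; last exact: measurableT_comp.
apply: le_lt_trans; rewrite le_eqVlt; apply/orP; left; apply/eqP.
apply: eq_integral => x _ /=; congr EFin.
by rewrite normrM (ger0_norm (normal_pdf_ge0 _ _ _)).
Qed.

Section stein.
Variables q q' : R -> R.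
Hypothesis dq : forall x : R, is_derive x 1 q (q' x).
Hypothesis cq' : continuous q'.
Hypotheses (gq : quartic_growth q) (gq' : quartic_growth q')
  (gxq : quartic_growth (fun x => (x - m) * q x)).
Let h x := q' x - (x - m) / s ^+ 2 * q x.

Let gh : quartic_growth h.
Proof.
have [m1 [A1 h1]] := gq'; have [m2 [A2 h2]] := gxq.
have hE : h = (fun x => q' x + - (s ^+ 2)^-1 * ((x - m) * q x)).
  by apply/funext => x; rewrite /h; ring.
split; first by rewrite hE; apply: measurable_funD => //; exact: measurable_funM.
exists (A1 + (s ^+ 2)^-1 * A2) => x; rewrite hE.
apply: (le_trans (ler_normD _ _)); rewrite [leRHS]mulrDl; apply: lerD => //.
have c0 : 0 <= (s ^+ 2)^-1 by rewrite invr_ge0 sqr_ge0.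
by rewrite normrM normrN (ger0_norm c0) -(mulrA (s ^+ 2)^-1) ler_wpM2l.
Qed.

Let G x := q x * pdf x.

Let dG (x : R) : is_derive x 1 G (h x * pdf x).
Proof.
apply: (is_derive_eq (is_deriveM (dq x) (is_derive_normal_pdf m s0 x))).
by rewrite /GRing.scale/= /h; ring.
Qed.

Let cg : continuous (fun x => h x * pdf x).
Proof.
have cq : continuous q.
  by move=> x; apply/differentiable_continuous/derivable1_diffP; have [] := dq x.
have cp : continuous pdf by exact: continuous_normal_pdf.
move=> x; apply: (@continuousM _ _ h pdf); last exact: cp.
apply: (@continuousB _ _ _ q' (fun x => (x - m) / s ^+ 2 * q x)); first exact: cq'.
apply: (@continuousM _ _ (fun x => (x - m) / s ^+ 2) q); last exact: cq.
apply: (@continuousM _ _ (fun x => x - m) (fun=> (s ^+ 2)^-1)); last exact: cst_continuous.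
apply: (@continuousB _ _ _ id (fun=> m)); [exact: cvg_id|exact: cst_continuous].
Qed.

Let G0 (F : set_system R) : Filter F ->
  (forall M : R, \forall x \near F, M <= `|x - m|) -> G x @[x --> F] --> (0 : R).
Proof.
move=> FF hF; have [C [C0 hC]] := normal_pdf_bound m s0.
have [_ [A hA]] := gq; apply/cvgr0Pnorm_le => e e0.
have s20 : 2 * s != 0 by rewrite mulf_neq0.
have AC : 0 < `|A| * C + 1 by rewrite ltr_wpDl// mulr_ge0.
have [M hM] := normal_pdf_small m s20 (divr_gt0 e0 AC).
apply: filterS (hF M) => x /hM h1.
rewrite /G normrM (ger0_norm (normal_pdf_ge0 _ _ _)).
apply: (@le_trans _ _ (`|A| * ((1 + (x - m) ^+ 4) * pdf x))).
  rewrite mulrA; apply: ler_wpM2r; first exact: normal_pdf_ge0.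
  apply: (le_trans (hA x)); apply: ler_wpM2r; last exact: ler_norm.
  by rewrite addr_ge0// exprn_even_ge0.
apply: (le_trans (ler_wpM2l (normr_ge0 A) (hC x))).
rewrite mulrA; apply: (@le_trans _ _ ((`|A| * C + 1) * normal_pdf m (2 * s) x)).
  by apply: ler_wpM2r; [exact: normal_pdf_ge0|rewrite lerDl].
by move: h1; rewrite ler_pdivlMr// mulrC.
Qed.

Let farNy (M : R) : \forall x \near -oo, M <= `|x - m|.
Proof.
near=> x; rewrite ler_normr; apply/orP; right.
by rewrite opprB lerBrDl -lerBrDr; near: x; apply: nbhs_ninfty_le; exact: num_real.
Unshelve. all: by end_near. Qed.

Let fary (M : R) : \forall x \near +oo, M <= `|x - m|.
Proof.
near=> x; rewrite ler_normr; apply/orP; left.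
by rewrite lerBrDr; near: x; apply: nbhs_pinfty_ge; exact: num_real.
Unshelve. all: by end_near. Qed.

(** [h] times the density is the derivative of [q] times the density, which tends to 0 at infinity.
    The truncated version yields the Hermite coefficients of half-line indicators. *)
Lemma stein_le z :
  \int[gamma]_x (h x * \1_(`]-oo, z]%classic : set MR) x) = q z * pdf z.
Proof.
rewrite normal_RintegralE; last first.
  by apply: measurable_funM; [exact: gh.1|exact: measurable_indic].
under eq_Rintegral do rewrite mulrAC.
apply: (@Rintegral_le_derive R G) => //.
  exact: (quartic_growth_integrable_pdf gh).
exact: (G0 _ farNy).
Qed.

Lemma stein : \int[gamma]_x (q' x - (x - m) / s ^+ 2 * q x) = 0.
Proof.
rewrite (@normal_RintegralE h); last exact: gh.1.
apply: (@Rintegral_real_derive R G) => //.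
- exact: (quartic_growth_integrable_pdf gh).
- exact: (G0 _ farNy).
- exact: (G0 _ fary).
Qed.

End stein.
End normal_integral.

Section intble.
Context d (T : measurableType d) (R : realType).
Variable m : {measure set T -> \bar R}.
Implicit Types f g : T -> R.

Definition intble f := m.-integrable setT (EFin \o f).

Lemma intbleD f g : intble f -> intble g -> intble (fun x => f x + g x).
Proof. exact: integrableD. Qed.

Lemma intbleB f g : intble f -> intble g -> intble (fun x => f x - g x).
Proof. exact: integrableB. Qed.

Lemma intbleZ c f : intble f -> intble (fun x => c * f x).
Proof. exact: integrableZl. Qed.

Lemma intble_eq f g : f =1 g -> intble f -> intble g.
Proof. by move=> /funext ->. Qed.

Lemma intble_measurable f : intble f -> measurable_fun setT f.
Proof. by move=> /measurable_int /measurable_EFinP. Qed.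

Lemma intble_le f g : measurable_fun setT f -> intble g ->
  (forall x, `|f x| <= g x) -> intble f.
Proof.
move=> mf ig fg; apply: (le_integrable measurableT _ _ ig); first exact/measurable_EFinP.
by move=> x _ /=; rewrite lee_fin (le_trans (fg x))// ler_norm.
Qed.

Lemma intble_mul_bmf f g : bmf f -> intble g -> intble (fun x => f x * g x).
Proof.
move=> [mf [M fM]] ig; apply: (@intble_le _ (fun x => M * `|g x|)).
- exact: (measurable_funM mf (intble_measurable ig)).
- apply: intbleZ; exact: (integrable_abse ig).
- by move=> x; rewrite normrM ler_wpM2r.
Qed.

Lemma IntD f g : intble f -> intble g ->
  \int[m]_x (f x + g x) = \int[m]_x f x + \int[m]_x g x.
Proof. by move=> i1 i2; rewrite RintegralD. Qed.

Lemma IntB f g : intble f -> intble g ->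
  \int[m]_x (f x - g x) = \int[m]_x f x - \int[m]_x g x.
Proof. by move=> i1 i2; rewrite RintegralB. Qed.

Lemma IntZ c f : intble f -> \int[m]_x (c * f x) = c * \int[m]_x f x.
Proof. by move=> i1; rewrite RintegralZl. Qed.

Lemma Int_le f g : intble f -> intble g -> (forall x, f x <= g x) ->
  \int[m]_x f x <= \int[m]_x g x.
Proof. by move=> i1 i2 fg; apply: le_Rintegral. Qed.

Lemma Int_ge0 f : (forall x, 0 <= f x) -> 0 <= \int[m]_x f x.
Proof. by move=> f0; apply: Rintegral_ge0. Qed.

End intble.

Section intble_finite.
Context d (T : measurableType d) (R : realType).
Variable m : {finite_measure set T -> \bar R}.

Lemma intble_bmf (f : T -> R) : bmf f -> intble m f.
Proof. exact: bmf_integrable. Qed.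

Lemma intble_cst (c : R) : intble m (fun=> c).
Proof. exact: intble_bmf (bmf_cst _ _). Qed.

End intble_finite.

Lemma Int_prob_cst d (T : measurableType d) (R : realType) (P : probability T R) (c : R) :
  \int[P]_x c = c.
Proof.
rewrite Rintegral_cst//; have := probability_setT P; by move=> /= ->; rewrite mulr1.
Qed.

Section normal_moments.
Variables (R : realType) (m s : R).
Hypothesis s0 : s != 0.
Local Notation MR := (measurableTypeR R).
Local Notation gamma := (normal_prob m s).

Let bmf1 : bmf (fun _ : MR => 1 : R). Proof. exact: bmf_cst. Qed.

Let gmX k : (k <= 4)%N -> quartic_growth m (fun x : MR => (x - m) ^+ k).
Proof.
move=> k4; have := quartic_growthX m k4 bmf1.
by under eq_fun do rewrite mulr1.
Qed.

Let dxm (x : R) : is_derive x 1 (fun y : R => y - m) 1.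
Proof. by apply: (is_derive_eq (is_deriveB _ (is_derive_cst m x (1 : R)))); rewrite subr0. Qed.

Lemma Rintegral_normal_id : \int[gamma]_x x = m.
Proof.
have h : \int[gamma]_x (0 - (x - m) / s ^+ 2 * 1) = 0.
  apply: (@stein R m s s0 (fun=> 1) (fun=> 0)).
  - by move=> x; exact: cst_continuous.
  - exact: (gmX (isT : 0 <= 4)%N).
  - by split; [exact: measurable_cst|exists 0 => x; rewrite normr0 mul0r].
  - by under eq_fun do rewrite mulr1; exact: (gmX (isT : 1 <= 4)%N).
have i1 : intble gamma (fun x : MR => x - m).
  exact: (quartic_growth_integrable s0 (gmX (isT : 1 <= 4)%N)).
have h2 : \int[gamma]_x (x - m) = 0.
  have s2 : - (s ^+ 2)^-1 != 0 by rewrite oppr_eq0 invr_eq0 expf_neq0.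
  apply: (mulfI s2); rewrite mulr0 -IntZ// -[RHS]h.
  by apply: eq_Rintegral => x _; ring.
have hm : \int[gamma]_x (x - m + m) = m.
  by rewrite IntD// ?h2 ?add0r ?Int_prob_cst//; exact: intble_cst.
by rewrite -[RHS]hm; apply: eq_Rintegral => x _; rewrite subrK.
Qed.

Lemma Rintegral_normal_sqr : \int[gamma]_x (x - m) ^+ 2 = s ^+ 2.
Proof.
have h : \int[gamma]_x (1 - (x - m) / s ^+ 2 * (x - m)) = 0.
  apply: (@stein R m s s0 (fun x => x - m) (fun=> 1)).
  - by [].
  - by move=> x; exact: cst_continuous.
  - exact: (gmX (isT : 1 <= 4)%N).
  - exact: (gmX (isT : 0 <= 4)%N).
  - exact: (gmX (isT : 2 <= 4)%N).
have i2 : intble gamma (fun x : MR => (x - m) ^+ 2).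
  exact: (quartic_growth_integrable s0 (gmX (isT : 2 <= 4)%N)).
have s2 : - (s ^+ 2)^-1 != 0 by rewrite oppr_eq0 invr_eq0 expf_neq0.
have : \int[gamma]_x (1 + - (s ^+ 2)^-1 * (x - m) ^+ 2) = 0.
  by rewrite -[RHS]h; apply: eq_Rintegral => x _; ring.
rewrite IntD ?IntZ ?Int_prob_cst//; [|exact: intble_cst|exact: intbleZ].
move=> /(congr1 (fun z => s ^+ 2 * z)); rewrite mulr0 mulrDr mulrA mulrN mulfV ?expf_neq0//.
by rewrite mulr1 mulN1r => /subr0_eq ->.
Qed.

End normal_moments.

Section std_normal_moments.
Variable R : realType.
Local Notation MR := (measurableTypeR R).
Local Notation gamma := (@normal_prob R 0 1).
Let s0 : (1 : R) != 0. Proof. exact: oner_neq0. Qed.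

Let gmX k (f : MR -> R) : (k <= 4)%N -> bmf f -> quartic_growth 0 (fun x : MR => x ^+ k * f x).
Proof.
move=> k4 bf; have := quartic_growthX 0 k4 bf.
by under eq_fun do rewrite subr0.
Qed.

Lemma is_derive_cos_affine (u t x : R) : is_derive x 1 (fun y => cos (u * y + t)) (- (u * sin (u * x + t))).
Proof.
have d1 : is_derive x 1 (fun y : R => u * y + t) u.
  apply: (is_derive_eq (is_deriveD (is_deriveM (is_derive_cst u x (1 : R)) (is_derive_id x 1)) (is_derive_cst t x (1 : R)))).
  by rewrite /GRing.scale/= /cst; ring.
apply: (is_derive_eq (@is_derive1_comp R cos (fun y => u * y + t) x _ _ (is_derive_cos _) d1)).
ring.
Qed.

Lemma is_derive_sin_affine (u t x : R) : is_derive x 1 (fun y => sin (u * y + t)) (u * cos (u * x + t)).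
Proof.
have d1 : is_derive x 1 (fun y : R => u * y + t) u.
  apply: (is_derive_eq (is_deriveD (is_deriveM (is_derive_cst u x (1 : R)) (is_derive_id x 1)) (is_derive_cst t x (1 : R)))).
  by rewrite /GRing.scale/= /cst; ring.
apply: (is_derive_eq (@is_derive1_comp R sin (fun y => u * y + t) x _ _ (is_derive_sin _) d1)).
ring.
Qed.

Let cos_cont (u t : R) : continuous (fun x : R => cos (u * x + t)).
Proof.
move=> x; apply/differentiable_continuous/derivable1_diffP.
by have [] := is_derive_cos_affine u t x.
Qed.

Let sin_cont (u t : R) : continuous (fun x : R => sin (u * x + t)).
Proof.
move=> x; apply/differentiable_continuous/derivable1_diffP.
by have [] := is_derive_sin_affine u t x.
Qed.

Lemma bmf_cos_affine (u t : R) : bmf (fun x : MR => cos (u * x + t)).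
Proof.
split; first exact: continuous_measurable_fun.
by exists 1 => x; rewrite ler_norml cos_geN1 cos_le1.
Qed.

Lemma bmf_sin_affine (u t : R) : bmf (fun x : MR => sin (u * x + t)).
Proof.
split; first exact: continuous_measurable_fun.
by exists 1 => x; rewrite ler_norml sin_geN1 sin_le1.
Qed.

Section charfun.
Variable s : R.
Hypothesis s_neq0 : s != 0.
Local Notation gam := (@normal_prob R 0 s).
Variable t : R.
Let psi u := \int[gam]_x cos (u * x + t).

Let gX k (f : MR -> R) : (k <= 4)%N -> bmf f -> quartic_growth 0 (fun x : MR => x ^+ k * f x).
Proof.
move=> k4 bf; have := quartic_growthX 0 k4 bf.
by under eq_fun do rewrite subr0.
Qed.

Let gbmf (f : MR -> R) : bmf f -> quartic_growth 0 f.
Proof.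
move=> bf; have := gX (isT : 0 <= 4)%N bf.
by under eq_fun do rewrite expr0 mul1r.
Qed.

Lemma stein_sin u : \int[gam]_x (x * sin (u * x + t)) = s ^+ 2 * u * psi u.
Proof.
have h : \int[gam]_x (u * cos (u * x + t) - (x - 0) / s ^+ 2 * sin (u * x + t)) = 0.
  apply: (@stein R 0 s s_neq0 (fun x => sin (u * x + t)) (fun x => u * cos (u * x + t))).
  - by move=> x; exact: is_derive_sin_affine.
  - by move=> x; apply: (@continuousM _ _ (fun=> u)); [exact: cst_continuous|exact: cos_cont].
  - exact: gbmf (bmf_sin_affine _ _).
  - exact: gbmf (bmfM (bmf_cst _ _) (bmf_cos_affine _ _)).
  - have := gX (isT : 1 <= 4)%N (bmf_sin_affine u t).
    by under eq_fun do rewrite expr1; under [X in _ -> quartic_growth _ X]eq_fun do rewrite subr0.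
have i1 : intble gam (fun x : MR => x * sin (u * x + t)).
  exact: (quartic_growth_integrable s_neq0 (gX (isT : 1 <= 4)%N (bmf_sin_affine u t))).
have i0 : intble gam (fun x : MR => cos (u * x + t)) := intble_bmf gam (bmf_cos_affine u t).
have : \int[gam]_x (u * cos (u * x + t) + - (s ^+ 2)^-1 * (x * sin (u * x + t))) = 0.
  by rewrite -[RHS]h; apply: eq_Rintegral => x _; rewrite subr0; ring.
rewrite IntD ?IntZ//; [|exact: intbleZ|exact: intbleZ].
move=> /(congr1 (fun z => s ^+ 2 * z)); rewrite mulr0 mulrDr !mulrA mulrN mulfV ?expf_neq0//.
by rewrite mulN1r => /subr0_eq ->.
Qed.

Let dpsi (u : R) : is_derive u 1 psi (- (s ^+ 2 * u * psi u)).
Proof.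
have i1 : gam.-integrable setT (EFin \o (fun x : MR => `|x|)).
  have [m1 [A hA]] := gX (isT : 1 <= 4)%N (bmf_cst _ (1 : R)).
  apply: (quartic_growth_integrable s_neq0 (m := 0)); split; first exact: measurableT_comp.
  by exists A => x; have := hA x; rewrite expr1 mulr1 normr_id.
have part x y : partial1of2 (fun v (z : MR) => cos (v * z + t)) x y = - (y * sin (x * y + t)).
  rewrite partial1of2E; have [_ h] := is_derive_cos_affine y t x.
  rewrite (mulrC x) -h (_ : (fun z : R => cos (z * y + t)) = (fun z => cos (y * z + t)))//.
  by apply/funext => z; rewrite mulrC.
have I u' : u' \in `](u - 1), (u + 1)[ -> gam.-integrable setT (EFin \o (fun x : MR => cos (u' * x + t))).
  by move=> _; exact: bmf_integrable (bmf_cos_affine _ _).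
have Iu : `](u - 1), (u + 1)[%classic u by rewrite /= in_itv/= ltrDl gtrBl ltr01.
have D1 x (y : MR) : `](u - 1), (u + 1)[%classic x -> setT y -> derivable (fun v : R => cos (v * y + t)) x 1.
  move=> _ _; have [h _] := is_derive_cos_affine y t x.
  have <- : (fun v : R => cos (y * v + t)) = (fun v => cos (v * y + t)) by apply/funext => z; rewrite mulrC.
  exact: h.
have D2 x (y : MR) : `](u - 1), (u + 1)[%classic x -> setT y ->
    `|partial1of2 (fun v (z : MR) => cos (v * z + t)) x y| <= `|y|.
  move=> _ _; rewrite part normrN normrM ler_piMr//.
  by rewrite ler_norml sin_geN1 sin_le1.
split.
  exact: (derivable_under_integral measurableT Iu I D1 (fun y => normr_ge0 y) i1 D2).
rewrite -derive1E (differentiation_under_integral measurableT Iu I D1 (fun y => normr_ge0 y) i1 D2).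
rewrite -stein_sin -[RHS]mulN1r -IntZ//; last first.
  exact: (quartic_growth_integrable s_neq0 (gX (isT : 1 <= 4)%N (bmf_sin_affine u t))).
by apply: eq_Rintegral => x _; rewrite part mulN1r.
Qed.

(** By [dpsi] the function psi(u) exp(s^2 u^2 / 2) has zero derivative. The phase t carries the
    cosine and sine transforms in one real formula. *)
Lemma normal_charfun u : psi u = expR (- (s ^+ 2 * u ^+ 2 / 2)) * cos t.
Proof.
pose E (u : R) := expR (s ^+ 2 * u ^+ 2 / 2).
have dE (v : R) : is_derive v 1 E (s ^+ 2 * v * E v).
  have d1 : is_derive v 1 (fun y : R => s ^+ 2 / 2 * y ^+ 2) (s ^+ 2 * v).
    apply: (is_derive_eq (is_deriveM (is_derive_cst (s ^+ 2 / 2) v (1 : R)) (is_derive_exprn 2 (is_derive_id v 1)))).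
    by rewrite /GRing.scale/= /cst; field.
  have -> : E = expR \o (fun y : R => s ^+ 2 / 2 * y ^+ 2).
    by apply/funext => y; rewrite /E /= mulrAC.
  apply: (is_derive_eq (is_derive1_comp (is_derive_expR _) d1)).
  by rewrite /= mulrC.
have dpE (v : R) : is_derive v 1 (fun y => psi y * E y) 0.
  apply: (is_derive_eq (is_deriveM (dpsi v) (dE v))).
  by rewrite /GRing.scale/=; ring.
have := is_derive_0_is_cst u 0 dpE.
rewrite [in RHS]/E expr0n mulr0 mul0r expR0 mulr1 => h.
have p0 : psi 0 = cos t.
  rewrite /psi; under eq_Rintegral do rewrite mul0r add0r.
  by rewrite Int_prob_cst.
by rewrite -p0 -h mulrC expRN mulfK// gt_eqF// expR_gt0.
Qed.

End charfun.

Let quartic (f : MR -> R) (a0 a1 a2 a3 a4 : R) :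
  (forall x, f x = a0 + a1 * x + a2 * x ^+ 2 + a3 * x ^+ 3 + a4 * x ^+ 4) ->
  quartic_growth 0 f.
Proof.
move=> fE; have mX k : measurable_fun setT (fun x : MR => x ^+ k).
  exact: (@measurable_funX _ _ R setT id).
split.
  rewrite (funext fE).
  apply: measurable_funD; last by apply: measurable_funM => //; exact: mX.
  apply: measurable_funD; last by apply: measurable_funM => //; exact: mX.
  apply: measurable_funD; last by apply: measurable_funM => //; exact: mX.
  by apply: measurable_funD => //; apply: measurable_funM.
exists (`|a0| + `|a1| + `|a2| + `|a3| + `|a4|) => x; rewrite fE subr0.
have N k : (k <= 4)%N -> `|x| ^+ k <= 1 + x ^+ 4.
  move=> k4; have -> : x ^+ 4 = `|x| ^+ 4 by rewrite -normrX ger0_norm// exprn_even_ge0.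
  move: `|x| (normr_ge0 x) => y y0.
  have [y1|y1] := leP y 1.
    by rewrite (@le_trans _ _ 1) ?exprn_ile1// lerDl exprn_ge0.
  by rewrite (@le_trans _ _ (y ^+ 4)) ?lerDr// ler_weXn2l// ltW.
have NM k a : (k <= 4)%N -> `|a * x ^+ k| <= `|a| * (1 + x ^+ 4).
  by move=> k4; rewrite normrM normrX ler_wpM2l// N.
rewrite !mulrDl.
do 3 (apply: (le_trans (ler_normD _ _)); apply: lerD; last exact: NM).
apply: (le_trans (ler_normD _ _)); apply: lerD; last exact: (NM 1%N a1 isT).
by have := NM 0%N a0 isT; rewrite expr0 mulr1.
Qed.

Definition hermite2 (x : R) : R := x ^+ 2 - 1.

Lemma quartic_growth_hermite2 : quartic_growth 0 (hermite2 : MR -> R).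
Proof. by apply: (@quartic _ (-1) 0 1 0 0) => x; rewrite /hermite2; ring. Qed.

Lemma quartic_growth_hermite2_sqr : quartic_growth 0 (fun x : MR => hermite2 x ^+ 2).
Proof. by apply: (@quartic _ 1 0 (-2) 0 1) => x; rewrite /hermite2; ring. Qed.

Lemma intble_hermite2 : intble gamma (hermite2 : MR -> R).
Proof. exact: (quartic_growth_integrable s0 quartic_growth_hermite2). Qed.

Lemma intble_hermite2_sqr : intble gamma (fun x : MR => hermite2 x ^+ 2).
Proof. exact: (quartic_growth_integrable s0 quartic_growth_hermite2_sqr). Qed.

Lemma Int_hermite2 : \int[gamma]_x hermite2 x = 0.
Proof.
have i2 : intble gamma (fun x : MR => (x - 0) ^+ 2).
  apply: (quartic_growth_integrable s0 (m := 0)).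
  by apply: (@quartic _ 0 0 1 0 0) => x; ring.
have := Rintegral_normal_sqr 0 s0; rewrite expr1n => h.
have := IntB i2 (intble_cst gamma 1); rewrite h Int_prob_cst subrr => h2.
transitivity (\int[gamma]_x ((x - 0) ^+ 2 - 1)); last exact: h2.
by apply: eq_Rintegral => x _; rewrite subr0.
Qed.

Lemma Int_hermite2_sqr : \int[gamma]_x hermite2 x ^+ 2 = 2.
Proof.
(* With q = x^3 + x the integrand 3 x^2 + 1 - x q equals 2 - (x^2 - 1)^2. *)
have h : \int[gamma]_x ((3 * x ^+ 2 + 1) - (x - 0) / 1 ^+ 2 * (x ^+ 3 + x)) = 0.
  have dX (x : R) : is_derive x 1 (fun y : R => y ^+ 3 + y) (3 * x ^+ 2 + 1).
    apply: (is_derive_eq (is_deriveD (is_derive_exprn 3 (is_derive_id x 1)) (is_derive_id x 1))).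
    by rewrite mulr1.
  apply: (@stein R 0 1 s0 (fun x => x ^+ 3 + x) (fun x => 3 * x ^+ 2 + 1)) => //.
  - move=> x; apply: (@continuousD _ _ _ (fun x : R => 3 * x ^+ 2) (fun=> 1)); last exact: cst_continuous.
    apply: (@continuousM _ _ (fun=> 3)); first exact: cst_continuous.
    exact: exprn_continuous.
  - by apply: (@quartic _ 0 1 0 1 0) => x; ring.
  - by apply: (@quartic _ 1 0 3 0 0) => x; ring.
  - by apply: (@quartic _ 0 0 1 0 1) => x; ring.
have i1 : intble gamma (fun x : MR => (3 * x ^+ 2 + 1) - (x - 0) / 1 ^+ 2 * (x ^+ 3 + x)).
  apply: (quartic_growth_integrable s0 (m := 0)).
  by apply: (@quartic _ 1 0 2 0 (-1)) => x; field.
have := IntB (intble_cst gamma 2) i1; rewrite h Int_prob_cst subr0 => <-.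
by apply: eq_Rintegral => x _; rewrite /hermite2; field.
Qed.

(** Integration by parts with q = -x. It identifies J_2(z) as the pairing of the half-line indicator
    with x^2 - 1, so that the correction in S_l is a projection. *)
Lemma Int_hermite2_le z :
  \int[gamma]_x (hermite2 x * \1_(`]-oo, z]%classic : set MR) x) = - z * normal_pdf 0 1 z.
Proof.
have dX (x : R) : is_derive x 1 (fun y : R => - y) (-1).
  exact: (is_deriveN (is_derive_id x 1)).
rewrite -(@stein_le R 0 1 s0 (fun x => - x) (fun=> -1)) => //.
- by apply: eq_Rintegral => x _; congr (_ * _); rewrite /hermite2; field.
- by move=> x; exact: cst_continuous.
- by apply: (@quartic _ 0 (-1) 0 0 0) => x; ring.
- by apply: (@quartic _ (-1) 0 0 0 0) => x; ring.
- by apply: (@quartic _ 0 0 (-1) 0 0) => x; ring.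
Qed.

Lemma Int_cos_hermite2 u t :
  \int[gamma]_x (cos (u * x + t) * hermite2 x) = - u ^+ 2 * (expR (- (u ^+ 2 / 2)) * cos t).
Proof.
have c := normal_charfun s0 t u; rewrite expr1n mul1r in c; rewrite -c.
have ss := stein_sin s0 t u; rewrite expr1n mul1r in ss.
have gXS k : (k <= 4)%N -> quartic_growth 0 (fun x : MR => x ^+ k * sin (u * x + t)).
  by move=> k4; apply: gmX => //; exact: bmf_sin_affine.
have gXC k : (k <= 4)%N -> quartic_growth 0 (fun x : MR => x ^+ k * cos (u * x + t)).
  by move=> k4; apply: gmX => //; exact: bmf_cos_affine.
have i1 : intble gamma (fun x : MR => cos (u * x + t) * hermite2 x).
  exact: (intble_mul_bmf (bmf_cos_affine u t) intble_hermite2).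
have i2 : intble gamma (fun x : MR => x * sin (u * x + t)).
  exact: (quartic_growth_integrable s0 (gXS 1%N isT)).
have dX (x : R) : is_derive x 1 (fun y : R => y * cos (u * y + t))
    (cos (u * x + t) - u * (x * sin (u * x + t))).
  apply: (is_derive_eq (is_deriveM (is_derive_id x 1) (is_derive_cos_affine u t x))).
  by rewrite /GRing.scale/=; ring.
(* Taking q = x cos(u x + t) makes the integrand - u x sin(u x + t) minus the one sought, and
   [stein_sin] evaluates the sine part. *)
have h : \int[gamma]_x ((cos (u * x + t) - u * (x * sin (u * x + t))) - (x - 0) / 1 ^+ 2 * (x * cos (u * x + t))) = 0.
  apply: (@stein R 0 1 s0 (fun x => x * cos (u * x + t)) (fun x => cos (u * x + t) - u * (x * sin (u * x + t)))) => //.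
  - move=> x; apply: (@continuousB _ _ _ (fun x : R => cos (u * x + t)) (fun x : R => u * (x * sin (u * x + t)))).
      exact: cos_cont.
    apply: (@continuousM _ _ (fun=> u)); first exact: cst_continuous.
    apply: (@continuousM _ _ id); [exact: cvg_id|exact: sin_cont].
  - exact: (gXC 1%N isT).
  - have [m1 [A1 h1]] := gXC 0%N isT; have [m2 [A2 h2]] := gXS 1%N isT; split.
      apply: measurable_funB; first exact: (bmf_cos_affine u t).1.
      exact: measurable_funM.
    exists (A1 + `|u| * A2) => x; apply: (le_trans (ler_normB _ _)); rewrite mulrDl.
    apply: lerD; first by have := h1 x; rewrite expr0 mul1r.
    by rewrite normrM -mulrA ler_wpM2l//; have := h2 x; rewrite expr1.
  - have [m2 [A2 h2]] := gXC 2%N isT; split.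
      by under eq_fun do rewrite subr0 mulrA -expr2.
    by exists A2 => x; have := h2 x; rewrite !subr0 mulrA -expr2.
have -> : - u ^+ 2 * \int[gamma]_x cos (u * x + t) = - u * \int[gamma]_x (x * sin (u * x + t)).
  by rewrite ss; ring.
have i3 : intble gamma (fun x : MR => (cos (u * x + t) - u * (x * sin (u * x + t))) - (x - 0) / 1 ^+ 2 * (x * cos (u * x + t))).
  by have := intbleB (intbleZ (- u) i2) i1; apply: intble_eq => x; rewrite /hermite2; field.
have := IntB (intbleZ (- u) i2) i3; rewrite IntZ// h subr0 => <-.
by apply: eq_Rintegral => x _; rewrite /hermite2; field.
Qed.

End std_normal_moments.

Section gaussian_law.
Context d (T : measurableType d) (R : realType) (P : probability T R).
Local Notation MR := (measurableTypeR R).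
Variable X : T -> R.
Hypothesis gX : gaussian_rv P X.

Lemma gaussian_integral (h : MR -> R) m s : s != 0 ->
  (forall A : set R, measurable A -> P (X @^-1` A) = normal_prob m s A) ->
  intble (normal_prob m s) h ->
  intble P (fun w => h (X w)) /\ \int[P]_w h (X w) = \int[normal_prob m s]_x h x.
Proof.
move=> s0 law ih; have mX : measurable_fun setT (X : T -> MR) by have [] := gX.
have mh := intble_measurable ih.
have E : (\int[pushforward P (X : T -> MR)]_x `|(h x)%:E| = \int[normal_prob m s]_x `|(h x)%:E|)%E.
  apply: eq_measure_integral => A mA _; exact: law.
have fin : intble P (fun w => h (X w)).
  apply/integrableP; split; first by apply/measurable_EFinP; exact: measurableT_comp.
  rewrite -(@ge0_integral_pushforward _ _ _ _ _ _ mX P setT (fun x => `|(h x)%:E|%E))//.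
    rewrite E; by case/integrableP : ih.
  by apply: measurableT_comp => //; exact/measurable_EFinP.
split=> //; rewrite /Rintegral; congr fine.
rewrite -(@integral_pushforward _ _ _ _ _ _ mX P setT (fun x => (h x)%:E))//.
- by apply: eq_measure_integral => A mA _; exact: law.
- by apply/measurable_EFinP.
Qed.

End gaussian_law.

Section gaussian_cos.
Context d (T : measurableType d) (R : realType) (P : probability T R).
Local Notation MR := (measurableTypeR R).
Variable X : T -> R.
Hypothesis gX : gaussian_rv P X.
Hypothesis X0 : \int[P]_w X w = 0.

Let dirac_integral (h : MR -> R) (c : R) : measurable_fun setT h ->
  (forall A : set R, measurable A -> P (X @^-1` A) = \d_c A) ->
  \int[P]_w h (X w) = h c.
Proof.
move=> mh law; have mX : measurable_fun setT (X : T -> MR) by have [] := gX.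
have E f : (\int[pushforward P (X : T -> MR)]_x f x = \int[@dirac _ MR c R]_x f x)%E.
  apply: eq_measure_integral => A mA _; exact: law.
have mEh : measurable_fun setT (fun x : MR => (h x)%:E) by exact/measurable_EFinP.
rewrite /Rintegral; transitivity (fine (h c)%:E) => //; congr fine.
rewrite -(@integral_pushforward _ _ _ _ _ _ mX P setT (fun x => (h x)%:E))//.
  by rewrite E integral_dirac// diracT mul1e.
apply/integrableP; split; first exact: (measurableT_comp mEh mX).
rewrite -(@ge0_integral_pushforward _ _ _ _ _ _ mX P setT (fun x => `|(h x)%:E|%E))//.
  by rewrite E integral_dirac ?diracT ?mul1e ?ltry//; exact: measurableT_comp.
exact: measurableT_comp.
Qed.

(** The vanishing mean places the law at 0 in both cases, the point mass and the proper normal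
    law. *)
Let law_cases : exists s : R, (s = 0 /\ forall A : set R, measurable A -> P (X @^-1` A) = \d_(0 : R) A) \/
  (s != 0 /\ forall A : set R, measurable A -> P (X @^-1` A) = normal_prob 0 s A).
Proof.
have [mX [m [s law]]] := gX; exists s; have [s0|s0] := eqVneq s 0.
  left; split=> //; have law' A : measurable A -> P (X @^-1` A) = \d_m A.
    by move=> mA; rewrite law// s0 eqxx.
  by have := dirac_integral (@measurable_id _ MR setT) law'; rewrite X0 => ->.
right; split=> //; have law' A : measurable A -> P (X @^-1` A) = normal_prob m s A.
  by move=> mA; rewrite law// (negbTE s0).
have i1 : intble (normal_prob m s) (id : MR -> R).
  have := quartic_growth_integrable s0 (quartic_growthX m (isT : 1 <= 4)%N (bmf_cst _ (1 : R))).
  move=> /(fun i => intbleD i (intble_cst _ m)); apply: intble_eq => x.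
  by rewrite expr1 mulr1 subrK.
have [_] := gaussian_integral gX s0 law' i1; rewrite X0 (Rintegral_normal_id m s0) => m0.
by rewrite -m0 in law'.
Qed.

(** The formula keeps its form for a point mass, where v = 0. This matters because combinations of
    field values at equal or antipodal points can be degenerate. *)
Lemma gaussian_cos (v t : R) : \int[P]_w X w ^+ 2 = v ->
  \int[P]_w cos (X w + t) = expR (- (v / 2)) * cos t.
Proof.
have mcos : measurable_fun setT (fun x : MR => cos (x + t)).
  by have := (bmf_cos_affine 1 t).1; under eq_fun do rewrite mul1r.
have [s [[_ law]|[s0 law]]] := law_cases.
  rewrite (@dirac_integral (fun x => x ^+ 2) 0)//.
  rewrite expr0n/= => <-.
  by rewrite (@dirac_integral (fun x => cos (x + t)) 0)// mul0r oppr0 expR0 mul1r add0r.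
have i2 : intble (normal_prob 0 s) (fun x : MR => x ^+ 2).
  have := quartic_growth_integrable s0 (quartic_growthX 0 (isT : 2 <= 4)%N (bmf_cst _ (1 : R))).
  by apply: intble_eq => x; rewrite mulr1 subr0.
have [_ ->] := gaussian_integral gX s0 law i2.
have -> : \int[normal_prob 0 s]_x x ^+ 2 = s ^+ 2.
  rewrite -(Rintegral_normal_sqr 0 s0); apply: eq_Rintegral => x _.
  by rewrite subr0.
move=> <-; have ic : intble (normal_prob 0 s) (fun x : MR => cos (x + t)).
  by apply: intble_bmf; have := bmf_cos_affine 1 t; under eq_fun do rewrite mul1r.
have [_ ->] := gaussian_integral gX s0 law ic.
have := normal_charfun s0 t 1; rewrite expr1n mulr1 => <-.
by apply: eq_Rintegral => x _; rewrite mul1r.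
Qed.

Lemma gaussian_std : \int[P]_w X w ^+ 2 = 1 ->
  forall A : set R, measurable A -> P (X @^-1` A) = normal_prob 0 1 A.
Proof.
have [s [[_ law]|[s0 law]]] := law_cases.
  rewrite (@dirac_integral (fun x => x ^+ 2) 0)//.
  by rewrite expr0n/= => /eqP; rewrite eq_sym oner_eq0.
have i2 : intble (normal_prob 0 s) (fun x : MR => x ^+ 2).
  have := quartic_growth_integrable s0 (quartic_growthX 0 (isT : 2 <= 4)%N (bmf_cst _ (1 : R))).
  by apply: intble_eq => x; rewrite mulr1 subr0.
have [_ ->] := gaussian_integral gX s0 law i2.
have -> : \int[normal_prob 0 s]_x x ^+ 2 = s ^+ 2.
  rewrite -(Rintegral_normal_sqr 0 s0); apply: eq_Rintegral => x _.
  by rewrite subr0.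
(* Only s^2 = 1 is known, so s may be -1; the density depends on s through s^2 alone. *)
move=> s1 A mA; rewrite (law A mA).
apply: eq_integral => x _; congr EFin.
by rewrite !normal_pdfE ?oner_eq0// /normal_peak /normal_fun s1 expr1n.
Qed.

End gaussian_cos.

(** * Trigonometric polynomials of correlated Gaussian variables *)

Section trig_polynomials.
Variable R : realType.
Local Notation MR := (measurableTypeR R).
Local Notation gamma := (@normal_prob R 0 1).
Implicit Types p q : seq (R * R * R).

(* A triple [(c, u, s)] stands for the function [c * cos (u * x + s)]. *)
Definition trig p (x : R) : R := \sum_(a <- p) a.1.1 * cos (a.1.2 * x + a.2).

Lemma bmf_trig p : bmf (trig p : MR -> R).
Proof.
by apply: bmf_sum => a; apply: bmfM; [exact: bmf_cst|exact: bmf_cos_affine].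
Qed.

Definition is_trig (f : R -> R) := exists p, f =1 trig p.

Lemma is_trig_cos u s : is_trig (fun x => cos (u * x + s)).
Proof. by exists [:: (1, u, s)] => x; rewrite /trig big_seq1 mul1r. Qed.

Lemma is_trigD f g : is_trig f -> is_trig g -> is_trig (fun x => f x + g x).
Proof. by move=> [p fp] [q gq]; exists (p ++ q) => x; rewrite /trig big_cat fp gq. Qed.

Lemma is_trigZ c f : is_trig f -> is_trig (fun x => c * f x).
Proof.
move=> [p fp]; exists [seq (c * a.1.1, a.1.2, a.2) | a <- p] => x.
by rewrite fp /trig big_map mulr_sumr; apply: eq_bigr => a _ /=; rewrite mulrA.
Qed.

Lemma is_trig_cst c : is_trig (fun=> c).
Proof.
have := is_trigZ c (is_trig_cos 0 0); case=> p fp; exists p => x.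
by rewrite -fp mul0r addr0 cos0 mulr1.
Qed.

Lemma is_trig_sum (I : Type) (s : seq I) (F : I -> R -> R) :
  (forall i, is_trig (F i)) -> is_trig (fun x => \sum_(i <- s) F i x).
Proof.
move=> tF; elim: s => [|i s [p hp]].
  by have [p hp] := is_trig_cst 0; exists p => x; rewrite big_nil -hp.
by have [q hq] := is_trigD (tF i) (ex_intro _ p hp); exists q => x; rewrite big_cons -hq.
Qed.

Lemma cosM_cos (a b : R) : cos a * cos b = (cos (a + b) + cos (a - b)) / 2.
Proof. by rewrite cosD cosB; field. Qed.

Lemma is_trigM f g : is_trig f -> is_trig g -> is_trig (fun x => f x * g x).
Proof.
move=> [p fp] [q gq].
have [r hr] : is_trig (fun x => \sum_(a <- p) \sum_(b <- q)
    (a.1.1 * b.1.1 / 2) * (cos ((a.1.2 + b.1.2) * x + (a.2 + b.2)) +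
      cos ((a.1.2 - b.1.2) * x + (a.2 - b.2)))).
  apply: is_trig_sum => a; apply: is_trig_sum => b; apply: is_trigZ.
  by apply: is_trigD; exact: is_trig_cos.
exists r => x; rewrite -hr fp gq /trig big_distrl; apply: eq_bigr => a _ /=.
rewrite big_distrr; apply: eq_bigr => b _ /=.
have -> : (a.1.2 + b.1.2) * x + (a.2 + b.2) = a.1.2 * x + a.2 + (b.1.2 * x + b.2) by ring.
have -> : (a.1.2 - b.1.2) * x + (a.2 - b.2) = a.1.2 * x + a.2 - (b.1.2 * x + b.2) by ring.
by rewrite mulrACA cosM_cos mulrCA mulrC -!mulrA.
Qed.

Lemma cvg_sum_seq (I : Type) (s : seq I) (F : I -> nat -> R) (G : I -> R) :
  (forall i, F i n @[n --> \oo] --> G i) ->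
  \sum_(i <- s) F i n @[n --> \oo] --> \sum_(i <- s) G i.
Proof.
move=> h; elim: s => [|i s IH].
  by rewrite big_nil; under eq_fun do rewrite big_nil; exact: cvg_cst.
by rewrite big_cons; under eq_fun do rewrite big_cons; exact: cvgD.
Qed.

(* Up to sign, the pairing of [trig p] with the [k]-th Hermite polynomial under
   the standard normal law. *)
Definition trig_coef (k : nat) p : R := \sum_(a <- p)
  a.1.1 * expR (- (a.1.2 ^+ 2 / 2)) * a.1.2 ^+ k * (if odd k then sin a.2 else cos a.2).

(** The coefficient b_k of the k-th power of the correlation. *)
Definition trig_mass (k : nat) p : R := trig_coef k p ^+ 2 / k`!%:R.

Lemma trig_mass_ge0 k p : 0 <= trig_mass k p.
Proof. by rewrite divr_ge0// ?sqr_ge0. Qed.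

(* The joint expectation of [trig p X * trig p Y] for standard normal [X], [Y]
   with correlation [r]. *)
Definition trig_cov p (r : R) : R := \sum_(a <- p) \sum_(b <- p) a.1.1 * b.1.1 / 2 *
  (expR (- ((a.1.2 ^+ 2 + b.1.2 ^+ 2 + 2 * a.1.2 * b.1.2 * r) / 2)) * cos (a.2 + b.2) +
   expR (- ((a.1.2 ^+ 2 + b.1.2 ^+ 2 - 2 * a.1.2 * b.1.2 * r) / 2)) * cos (a.2 - b.2)).

(** Expand exp(-u v r) and exp(u v r) in powers of r: even powers come with a product of two cosines
    of the phases, odd powers with a product of two sines. For each k the double sum over pairs is
    therefore a square. *)
Lemma trig_cov_cvg p r :
  \sum_(k < n) trig_mass k p * r ^+ k @[n --> \oo] --> trig_cov p r.
Proof.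
pose e (a : R * R * R) := a.1.1 * expR (- (a.1.2 ^+ 2 / 2)).
have -> : (fun n => \sum_(k < n) trig_mass k p * r ^+ k) = (fun n => \sum_(a <- p) \sum_(b <- p) (e a * e b / 2) *
   (series (exp_coeff (- (a.1.2 * b.1.2 * r))) n * cos (a.2 + b.2) + series (exp_coeff (a.1.2 * b.1.2 * r)) n * cos (a.2 - b.2))).
  apply/funext => n; rewrite [RHS](_ : _ = \sum_(a <- p) \sum_(b <- p) \sum_(k < n) (e a * e b / 2) *
     (exp_coeff (- (a.1.2 * b.1.2 * r)) k * cos (a.2 + b.2) + exp_coeff (a.1.2 * b.1.2 * r) k * cos (a.2 - b.2))); last first.
    apply: eq_bigr => a _; apply: eq_bigr => b _; rewrite -mulr_sumr big_split/= -!mulr_suml.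
    by rewrite /series/= !big_mkord.
  rewrite (eq_bigr (fun a => \sum_(k < n) \sum_(b <- p) (e a * e b / 2) *
     (exp_coeff (- (a.1.2 * b.1.2 * r)) k * cos (a.2 + b.2) + exp_coeff (a.1.2 * b.1.2 * r) k * cos (a.2 - b.2)))); last first.
    by move=> a _; rewrite exchange_big.
  rewrite exchange_big/=; apply: eq_bigr => k _.
  rewrite /trig_mass /trig_coef expr2 -mulrA big_distrl/= mulr_suml; apply: eq_bigr => a _.
  rewrite big_distrr mulr_suml; apply: eq_bigr => b _ /=.
  rewrite /exp_coeff /e /= cosD cosB exprNn !exprMn.
  rewrite -signr_odd; by case: (odd k); rewrite ?expr0 ?expr1; field; rewrite pnatr_eq0 -lt0n fact_gt0.
apply: cvg_sum_seq => a; apply: cvg_sum_seq => b.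
have E (x : R) : series (exp_coeff x) n @[n --> \oo] --> expR x by exact: is_cvg_series_exp_coeff.
have -> : a.1.1 * b.1.1 / 2 *
  (expR (- ((a.1.2 ^+ 2 + b.1.2 ^+ 2 + 2 * a.1.2 * b.1.2 * r) / 2)) * cos (a.2 + b.2) +
   expR (- ((a.1.2 ^+ 2 + b.1.2 ^+ 2 - 2 * a.1.2 * b.1.2 * r) / 2)) * cos (a.2 - b.2)) =
  e a * e b / 2 * (expR (- (a.1.2 * b.1.2 * r)) * cos (a.2 + b.2) + expR (a.1.2 * b.1.2 * r) * cos (a.2 - b.2)).
  have -> : - ((a.1.2 ^+ 2 + b.1.2 ^+ 2 + 2 * a.1.2 * b.1.2 * r) / 2) =
    - (a.1.2 ^+ 2 / 2) + - (b.1.2 ^+ 2 / 2) + - (a.1.2 * b.1.2 * r) by field.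
  have -> : - ((a.1.2 ^+ 2 + b.1.2 ^+ 2 - 2 * a.1.2 * b.1.2 * r) / 2) =
    - (a.1.2 ^+ 2 / 2) + - (b.1.2 ^+ 2 / 2) + a.1.2 * b.1.2 * r by field.
  rewrite /e !expRD; ring.
apply: cvgM; first exact: cvg_cst.
by apply: cvgD; apply: cvgM; try exact: cvg_cst; exact: E.
Qed.

Lemma trig_mass_le k p : trig_mass k p <= trig_cov p 1.
Proof.
have := @trig_cov_cvg p 1 => h; rewrite -(cvg_lim (@Rhausdorff R) h).
apply: limr_ge; first by apply/cvg_ex; exists (trig_cov p 1).
near=> n; have kn : (k < n)%N by near: n; exists k.+1.
rewrite (bigD1 (Ordinal kn))//= expr1n mulr1 lerDl; apply: sumr_ge0 => i _.
by rewrite expr1n mulr1 trig_mass_ge0.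
Unshelve. all: by end_near. Qed.

(** Terms with k >= 4 are at most r^4 times their masses, and r^2 <= 1 disposes of k = 2. The terms
    k = 1 and k = 3 keep their sign, since the integrals of P_l and P_l^3 are small only by
    cancellation. *)
Lemma trig_cov_le p r : -1 <= r <= 1 ->
  trig_cov p r <= trig_mass 0 p + trig_mass 2 p + trig_mass 1 p * r + trig_mass 3 p * r ^+ 3
     + trig_cov p 1 * r ^+ 4.
Proof.
move=> r1; have r2 : r ^+ 2 <= 1 by nra.
have r20 : 0 <= r ^+ 2 by exact: sqr_ge0.
have h := @trig_cov_cvg p r; rewrite -{1}(cvg_lim (@Rhausdorff R) h).
apply: limr_le; first by apply/cvg_ex; exists (trig_cov p r).
near=> n; have n4 : (4 <= n)%N by near: n; exists 4%N.
rewrite -(subnKC n4) big_split_ord/= !big_ord_recl big_ord0 /bump/= addr0.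
have S : \sum_(i < n - 4) trig_mass (4 + i) p * r ^+ (4 + i) <= trig_cov p 1 * r ^+ 4.
  apply: (@le_trans _ _ ((\sum_(i < n - 4) trig_mass (4 + i) p) * r ^+ 4)).
    rewrite mulr_suml; apply: ler_sum => i _; rewrite exprD.
    apply: ler_wpM2l; first exact: trig_mass_ge0.
    rewrite ler_piMr ?exprn_even_ge0//.
    rewrite (le_trans (ler_norm _))// normrX exprn_ile1// ler_norml; lra.
  apply: ler_wpM2r; first by rewrite exprn_even_ge0.
  have h1 := @trig_cov_cvg p 1; rewrite -(cvg_lim (@Rhausdorff R) h1).
  apply: limr_ge; first by apply/cvg_ex; exists (trig_cov p 1).
  exists n => // N /= nN.
  have N4 : (4 <= N)%N := leq_trans n4 nN.
  rewrite (_ : \sum_(k < N) _ = \sum_(k < N) trig_mass k p); last first.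
    by apply: eq_bigr => i _; rewrite expr1n mulr1.
  rewrite -(subnKC N4) big_split_ord/=; apply: (@le_trans _ _ (\sum_(i < N - 4) trig_mass (4 + i) p)); last first.
    by rewrite lerDr; apply: sumr_ge0 => i _; exact: trig_mass_ge0.
  have -> : (N - 4 = (n - 4) + (N - n))%N by rewrite addnBAC// subnKC.
  by rewrite big_split_ord/= lerDl; apply: sumr_ge0 => i _; exact: trig_mass_ge0.
have b2 := trig_mass_ge0 2 p.
rewrite expr0 expr1 mulr1; apply: le_trans (lerD (lexx _) S) _.
have := ler_wpM2l b2 r2; lra.
Unshelve. all: by end_near. Qed.

Let s0 : (1 : R) != 0. Proof. exact: oner_neq0. Qed.

Lemma Int_trig p : \int[gamma]_x trig p x = trig_coef 0 p.
Proof.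
rewrite /trig bmf_Rintegral_sum; last first.
  by move=> a; apply: bmfM; [exact: bmf_cst|exact: bmf_cos_affine].
apply: eq_bigr => a _; rewrite bmf_RintegralZl; last exact: bmf_cos_affine.
by rewrite (normal_charfun s0) expr1n mul1r/= expr0 mulr1 mulrA.
Qed.

Lemma Int_trig_hermite2 p : \int[gamma]_x (trig p x * hermite2 x) = - trig_coef 2 p.
Proof.
have ih (u t : R) : intble gamma (fun x : MR => cos (u * x + t) * hermite2 x).
  exact: (intble_mul_bmf (bmf_cos_affine u t) (intble_hermite2 R)).
elim: p => [|a p IH].
  rewrite /trig_coef big_nil oppr0 -[RHS](Int_prob_cst gamma 0).
  by apply: eq_Rintegral => x _; rewrite /trig big_nil mul0r.
have ip : intble gamma (fun x : MR => trig p x * hermite2 x).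
  exact: (intble_mul_bmf (bmf_trig p) (intble_hermite2 R)).
rewrite /trig_coef big_cons opprD -/(trig_coef 2 p) -IH.
transitivity (\int[gamma]_x (a.1.1 * (cos (a.1.2 * x + a.2) * hermite2 x) + trig p x * hermite2 x)).
  by apply: eq_Rintegral => x _; rewrite /trig big_cons mulrDl mulrA.
rewrite IntD//; last exact: intbleZ.
by rewrite IntZ// Int_cos_hermite2/=; congr (_ + _); ring.
Qed.

(** The product formula for two cosines reduces everything to cosines of linear combinations, so the
    hypothesis also makes sense for degenerate pairs. *)
Lemma Int_trig_cov d (T : measurableType d) (P : probability T R) (X Y : T -> R) (r : R) p :
  measurable_fun setT X -> measurable_fun setT Y ->
  (forall u v t : R, \int[P]_w cos (u * X w + v * Y w + t) =
     expR (- ((u ^+ 2 + v ^+ 2 + 2 * u * v * r) / 2)) * cos t) ->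
  \int[P]_w (trig p (X w) * trig p (Y w)) = trig_cov p r.
Proof.
move=> mX mY H.
have bc u v t : bmf (fun w => cos (u * X w + v * Y w + t)).
  apply: bmf_cos; apply: measurable_funD => //.
  by apply: measurable_funD; apply: measurable_funM.
transitivity (\int[P]_w (\sum_(a <- p) \sum_(b <- p) a.1.1 * b.1.1 / 2 *
   (cos (a.1.2 * X w + b.1.2 * Y w + (a.2 + b.2)) + cos (a.1.2 * X w + (- b.1.2) * Y w + (a.2 - b.2))))).
  apply: eq_Rintegral => w _; rewrite /trig big_distrl; apply: eq_bigr => a _ /=.
  rewrite big_distrr; apply: eq_bigr => b _ /=.
  have -> : a.1.2 * X w + b.1.2 * Y w + (a.2 + b.2) = a.1.2 * X w + a.2 + (b.1.2 * Y w + b.2) by ring.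
  have -> : a.1.2 * X w + (- b.1.2) * Y w + (a.2 - b.2) = a.1.2 * X w + a.2 - (b.1.2 * Y w + b.2) by ring.
  by rewrite mulrACA cosM_cos mulrCA mulrC -!mulrA.
have bt a b : bmf (fun w => a.1.1 * b.1.1 / 2 *
   (cos (a.1.2 * X w + b.1.2 * Y w + (a.2 + b.2)) + cos (a.1.2 * X w + (- b.1.2) * Y w + (a.2 - b.2)))).
  by apply: bmfM; [exact: bmf_cst|exact: bmfD].
rewrite bmf_Rintegral_sum; last by move=> a; exact: bmf_sum.
apply: eq_bigr => a _; rewrite bmf_Rintegral_sum//; apply: eq_bigr => b _.
rewrite bmf_RintegralZl; last exact: bmfD.
rewrite bmf_RintegralD// !H sqrrN; congr (_ * (_ + expR (- (_ / 2)) * _)); ring.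
Qed.

Lemma trig_cov1 p : trig_cov p 1 = \int[gamma]_x trig p x ^+ 2.
Proof.
rewrite -(@Int_trig_cov _ MR gamma id id 1 p)//.
move=> u v t; transitivity (\int[gamma]_x cos ((u + v) * x + t)).
  by apply: eq_Rintegral => x _; rewrite mulrDl.
rewrite (normal_charfun s0); congr (expR (- (_ / 2)) * _); ring.
Qed.

Lemma trig_mass0 p : trig_mass 0 p = (\int[gamma]_x trig p x) ^+ 2.
Proof. by rewrite Int_trig /trig_mass fact0 divr1. Qed.

Lemma trig_mass2 p : trig_mass 2 p = (\int[gamma]_x (trig p x * hermite2 x)) ^+ 2 / 2.
Proof. by rewrite Int_trig_hermite2 /trig_mass sqrrN. Qed.

End trig_polynomials.

Section cauchy_schwarz.
Context d (T : measurableType d) (R : realType) (m : {measure set T -> \bar R}).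
Implicit Types f g : T -> R.

Lemma intble_mul f g : measurable_fun setT f -> measurable_fun setT g ->
  intble m (fun x => f x ^+ 2) -> intble m (fun x => g x ^+ 2) ->
  intble m (fun x => f x * g x).
Proof.
move=> mf mg f2 g2; apply: intble_le (intbleD f2 g2) _; first exact: measurable_funM.
move=> x; rewrite normrM.
have -> : f x ^+ 2 = `|f x| ^+ 2 by rewrite real_normK ?num_real.
have -> : g x ^+ 2 = `|g x| ^+ 2 by rewrite real_normK ?num_real.
have := normr_ge0 (f x); have := normr_ge0 (g x); nra.
Qed.

Lemma intble_sqrD f g : measurable_fun setT f -> measurable_fun setT g ->
  intble m (fun x => f x ^+ 2) -> intble m (fun x => g x ^+ 2) ->
  intble m (fun x => (f x + g x) ^+ 2).
Proof.
move=> mf mg f2 g2; have fg := intble_mul mf mg f2 g2.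
apply: (intble_eq _ (intbleD (intbleD f2 (intbleZ 2 fg)) g2)) => x; ring.
Qed.

Lemma Int_cauchy_schwarz f g : measurable_fun setT f -> measurable_fun setT g ->
  intble m (fun x => f x ^+ 2) -> intble m (fun x => g x ^+ 2) ->
  0 < \int[m]_x g x ^+ 2 ->
  (\int[m]_x (f x * g x)) ^+ 2 <= \int[m]_x f x ^+ 2 * \int[m]_x g x ^+ 2.
Proof.
move=> mf mg f2 g2; have fg := intble_mul mf mg f2 g2.
set A := \int[m]_x f x ^+ 2; set B := \int[m]_x g x ^+ 2; set C := \int[m]_x (f x * g x) => B0.
have : 0 <= \int[m]_x (B * f x - C * g x) ^+ 2 by apply: Int_ge0 => x; exact: sqr_ge0.
have -> : \int[m]_x (B * f x - C * g x) ^+ 2 = \int[m]_x (B ^+ 2 * f x ^+ 2 + (C ^+ 2 * g x ^+ 2 - 2 * B * C * (f x * g x))).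
  by apply: eq_Rintegral => x _; ring.
rewrite IntD; [|exact: intbleZ|apply: intbleB; exact: intbleZ].
rewrite IntB; [|exact: intbleZ|exact: intbleZ].
rewrite !IntZ// -/A -/B -/C.
have -> : B ^+ 2 * A + (C ^+ 2 * B - 2 * B * C * C) = B * (A * B - C ^+ 2) by ring.
by rewrite pmulr_rge0// subr_ge0.
Qed.

End cauchy_schwarz.

(** * Approximation by trigonometric polynomials in L^2 of the standard normal law *)

Section trig_approx.
Variable R : realType.
Local Notation MR := (measurableTypeR R).
Local Notation gamma := (@normal_prob R 0 1).
Let s0 : (1 : R) != 0. Proof. exact: oner_neq0. Qed.

Definition trig_approx (g : MR -> R) := [/\ measurable_fun setT g,
  intble gamma (fun x => g x ^+ 2) &
  forall e : R, 0 < e -> exists p, \int[gamma]_x (g x - trig p x) ^+ 2 <= e].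

Lemma trig_approx_eq f g : f =1 g -> trig_approx f -> trig_approx g.
Proof. by move=> /funext ->. Qed.

Lemma trig_approx_is_trig f : is_trig f -> trig_approx f.
Proof.
move=> [p fp]; apply: (@trig_approx_eq (trig p)); first by move=> x; rewrite fp.
split; first exact: (bmf_trig p).1.
  exact: intble_bmf (bmfX 2 (bmf_trig p)).
move=> e e0; exists p.
have -> : \int[gamma]_x (trig p x - trig p x) ^+ 2 = 0; last exact: ltW.
rewrite -[RHS](Int_prob_cst gamma 0).
by apply: eq_Rintegral => x _; rewrite subrr expr0n.
Qed.

Lemma intble_sub_trig g p : trig_approx g -> intble gamma (fun x => (g x - trig p x) ^+ 2).
Proof.
move=> [mg ig _]; have [mp _] := bmf_trig p.
have := @intble_sqrD _ _ _ gamma g (fun x => - trig p x) mg _ ig; apply.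
  exact: measurableT_comp.
by under eq_fun do rewrite sqrrN; exact: intble_bmf (bmfX 2 (bmf_trig p)).
Qed.

Lemma trig_approxZ c g : trig_approx g -> trig_approx (fun x => c * g x).
Proof.
move=> tg; have [mg ig hg] := tg; split.
- exact: measurable_funM.
- by under eq_fun do rewrite exprMn; exact: intbleZ.
move=> e e0; have [|p hp] := hg (e / (c ^+ 2 + 1)).
  by rewrite divr_gt0// ltr_wpDl// sqr_ge0.
have [q hq] := is_trigZ c (ex_intro _ p (fun=> erefl)); exists q.
rewrite (_ : \int[_]_x _ = \int[gamma]_x (c ^+ 2 * (g x - trig p x) ^+ 2)); last first.
  by apply: eq_Rintegral => x _; rewrite -hq; ring.
rewrite IntZ; last exact: intble_sub_trig.
apply: (le_trans (ler_wpM2l (sqr_ge0 c) hp)).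
have c1 : 0 < c ^+ 2 + 1 by rewrite ltr_wpDl// sqr_ge0.
rewrite mulrA ler_pdivrMr// mulrC ler_wpM2l ?lerDl//; exact: ltW.
Qed.

Lemma trig_approxD f g : trig_approx f -> trig_approx g -> trig_approx (fun x => f x + g x).
Proof.
move=> tf tg; have [mf if_ hf] := tf; have [mg ig hg] := tg; split.
- exact: measurable_funD.
- exact: intble_sqrD.
move=> e e0; have e4 : 0 < e / 4 by rewrite divr_gt0.
have [p hp] := hf _ e4; have [q hq] := hg _ e4.
have [r hr] := is_trigD (ex_intro _ p (fun=> erefl)) (ex_intro _ q (fun=> erefl)).
exists r; have i1 := intble_sub_trig p tf; have i2 := intble_sub_trig q tg.
have [mp _] := bmf_trig p; have [mq _] := bmf_trig q.
apply: (@le_trans _ _ (\int[gamma]_x (2 * (f x - trig p x) ^+ 2 + 2 * (g x - trig q x) ^+ 2))).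
  apply: Int_le.
  - apply: (intble_eq (f := fun x => ((f x - trig p x) + (g x - trig q x)) ^+ 2)).
      by move=> x; rewrite -hr; congr (_ ^+ 2); ring.
    by apply: intble_sqrD => //; apply: measurable_funB.
  - by apply: intbleD; exact: intbleZ.
  - by move=> x; rewrite -hr; have := sqr_ge0 (f x - trig p x - (g x - trig q x)); nra.
rewrite IntD; [|exact: intbleZ|exact: intbleZ].
rewrite !IntZ//; lra.
Qed.

(** Dominated convergence: 4 G^2 dominates the squared differences, so some [g_ N] is close to the
    limit, and an approximant of [g_ N] serves for it. *)
Lemma trig_approx_lim (g_ : nat -> MR -> R) (g G : MR -> R) :
  (forall n, trig_approx (g_ n)) -> (forall x, g_ n x @[n --> \oo] --> g x) ->
  measurable_fun setT G -> intble gamma (fun x => G x ^+ 2) ->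
  (forall n x, `|g_ n x| <= G x) -> trig_approx g.
Proof.
move=> tg gg mG iG gG.
have mg_ n : measurable_fun setT (g_ n) by have [] := tg n.
have mg : measurable_fun setT g by apply: (measurable_fun_cvg mg_) => x _; exact: gg.
have G0 x : 0 <= G x by apply: le_trans (gG 0%N x).
have gGx x : `|g x| <= G x.
  have := @ler_cvg_to _ \oo _ R (fun n => `|g_ n x|) (fun=> G x) `|g x| (G x).
  apply; [exact: cvg_norm|exact: cvg_cst|exact: nearW].
have ig : intble gamma (fun x => g x ^+ 2).
  apply: (intble_le _ iG); first exact: measurable_funX.
  by move=> x; rewrite normrX lerXn2r// nnegrE.
split => // e e0; have e4 : 0 < e / 4 by rewrite divr_gt0.
have [||||_ h] := @Rintegral_dct _ _ _ gamma (fun n x => (g_ n x - g x) ^+ 2) (fun=> 0) (fun x => 4 * G x ^+ 2).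
- by move=> n; apply: measurable_funX; exact: measurable_funB.
- move=> x; rewrite [X in _ --> X](_ : 0 = (g x - g x) ^+ 2); last by rewrite subrr expr0n.
  apply: (@cvg_comp _ _ _ (fun n => g_ n x - g x) (fun y => y ^+ 2) _ (nbhs (g x - g x))).
    by apply: cvgB; [exact: gg|exact: cvg_cst].
  exact: exprn_continuous.
- exact: intbleZ.
- move=> n x; rewrite normrX -[4](_ : 2 ^+ 2 = _); last by rewrite -natrX.
  rewrite -exprMn lerXn2r ?nnegrE ?mulr_ge0//.
  apply: (le_trans (ler_normB _ _)); have := gG n x; have := gGx x; lra.
rewrite Int_prob_cst in h; have /cvgr0Pnorm_le/(_ _ e4)[N _ hN] := h.
have := hN N (leqnn N) => /= /ler_normlW hN'.
have [_ iN hp] := tg N; have [p hp'] := hp _ e4; exists p.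
have i1 := intble_sub_trig p (tg N); have [mp _] := bmf_trig p.
have iNg : intble gamma (fun x => (g_ N x - g x) ^+ 2).
  have := @intble_sqrD _ _ _ gamma (g_ N) (fun x => - g x) (mg_ N) _ iN; apply.
    exact: measurableT_comp.
  by under eq_fun do rewrite sqrrN.
have igp : intble gamma (fun x => (g x - trig p x) ^+ 2).
  have := @intble_sqrD _ _ _ gamma g (fun x => - trig p x) mg _ ig; apply.
    exact: measurableT_comp.
  by under eq_fun do rewrite sqrrN; exact: intble_bmf (bmfX 2 (bmf_trig p)).
apply: (@le_trans _ _ (\int[gamma]_x (2 * (g_ N x - g x) ^+ 2 + 2 * (g_ N x - trig p x) ^+ 2))).
  apply: Int_le => //.
    by apply: intbleD; exact: intbleZ.
  by move=> x; have := sqr_ge0 (g_ N x - g x + (g_ N x - trig p x)); nra.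
rewrite IntD; [|exact: intbleZ|exact: intbleZ].
rewrite !IntZ//; lra.
Qed.

(* The iterates of q(t) = (3 t - t^3) / 2 converge to the sign function on
   [-1, 1]. *)
Let q (t : R) := (3 * t - t ^+ 3) / 2.

Let q_itv t : 0 <= t <= 1 -> t <= q t <= 1.
Proof.
move=> /andP[t0 t1].
have h1 : 0 <= t * (1 - t) * (1 + t) by rewrite !mulr_ge0//; lra.
have h2 : 0 <= (1 - t) ^+ 2 * (2 + t) by rewrite mulr_ge0 ?sqr_ge0//; lra.
rewrite /q; apply/andP; split; nra.
Qed.

Let iter_q_itv n t : 0 <= t <= 1 -> t <= iter n q t <= 1.
Proof.
move=> t01; elim: n => [|n /andP[h1 h2]]; first by rewrite lexx; case/andP: t01.
have /q_itv/andP[h3 h4] : 0 <= iter n q t <= 1 by rewrite h2 (le_trans _ h1)//; case/andP: t01.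
by rewrite /= h4 (le_trans h1 h3).
Qed.

Let iter_qN n t : iter n q (- t) = - iter n q t.
Proof. by elim: n => //= n ->; rewrite /q; ring. Qed.

Let iter_q_norm n t : `|t| <= 1 -> `|iter n q t| <= 1.
Proof.
move=> t1; have [t0|t0] := leP 0 t.
  have /andP[h1 h2] : t <= iter n q t <= 1.
    by apply: iter_q_itv; rewrite t0/=; apply: le_trans t1; exact: ler_norm.
  by rewrite ger0_norm// (le_trans t0 h1).
have nt0 : 0 <= - t by rewrite oppr_ge0 ltW.
have /andP[h1 h2] : - t <= iter n q (- t) <= 1.
  by apply: iter_q_itv; rewrite nt0/= -(ler0_norm (ltW t0)).
by rewrite -normrN -iter_qN ger0_norm// (le_trans nt0 h1).
Qed.

Let iter_q_cvg1 t : 0 < t <= 1 -> iter n q t @[n --> \oo] --> (1 : R).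
Proof.
move=> /andP[t0 t1].
(* One step multiplies 1 - y by (1 - y)(2 + y) / 2, which is at most 1 - t / 2 as long as y >= t. *)
have geo n : 1 - iter n q t <= (1 - t / 2) ^+ n.
  elim: n => [|n IH] /=; first by rewrite expr0 lerBlDr lerDl ltW.
  have /andP[h1 h2] : t <= iter n q t <= 1 by apply: iter_q_itv; rewrite t1 ltW.
  rewrite exprS; move: (iter n q t) h1 h2 IH => y h1 h2 IH.
  apply: (@le_trans _ _ ((1 - t / 2) * (1 - y))); last by apply: ler_wpM2l => //; lra.
  rewrite /q; have : 0 <= (1 - y) * ((y - t) + y ^+ 2) by apply: mulr_ge0; nra.
  nra.
have c : (1 - t / 2) ^+ n @[n --> \oo] --> (0 : R).
  by apply: cvg_expr; rewrite ger0_norm; lra.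
have c1 : (1 - (1 - t / 2) ^+ n) @[n --> \oo] --> (1 - 0 : R).
  by apply: cvgB; [exact: cvg_cst|exact: c].
rewrite subr0 in c1; apply: (squeeze_cvgr _ c1 (@cvg_cst _ _ _ _ _)).
apply: nearW => n; have /andP[h1 h2] : t <= iter n q t <= 1 by apply: iter_q_itv; rewrite t1 ltW.
by rewrite h2 andbT lerBlDr addrC -lerBlDr geo.
Qed.

Let sg (t : R) : R := if 0 < t then 1 else if t < 0 then -1 else 0.

Let iter_q_cvg t : `|t| <= 1 -> iter n q t @[n --> \oo] --> sg t.
Proof.
move=> t1; rewrite /sg; have [t0|] := ltP 0 t.
  by apply: iter_q_cvg1; rewrite t0/=; apply: le_trans t1; exact: ler_norm.
rewrite le_eqVlt => /orP[/eqP ->|t0].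
  rewrite ltxx; have -> : (fun n => iter n q 0) = fun=> 0.
    by apply/funext; elim=> //= n ->; rewrite /q; ring.
  exact: cvg_cst.
rewrite t0; have -> : (fun n => iter n q t) = (fun n => - iter n q (- t)).
  by apply/funext => n; rewrite iter_qN opprK.
apply: cvgN; apply: iter_q_cvg1; rewrite oppr_gt0 t0/=.
by rewrite -(ler0_norm (ltW t0)).
Qed.

Let is_trig_iter_q n f : is_trig f -> is_trig (fun x => iter n q (f x)).
Proof.
move=> tf; elim: n => // n IH /=; rewrite /q.
have := is_trigD (is_trigZ (3 / 2) IH) (is_trigZ (- (1 / 2)) (is_trigM IH (is_trigM IH IH))).
by case=> p hp; exists p => x; rewrite -hp; field.
Qed.

(** Two successive limits. For fixed N = n + 1 the iterates of [q] on a sine, which are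
    trigonometric polynomials, tend to the sign of that sine; then the period grows with N and the
    sign becomes that of x - a. The shift 1/N^2 makes the sign negative at x = a itself, which gives
    the closed half-line. *)
Lemma trig_approx_le a : trig_approx (\1_(`]-oo, a]%classic : set MR)).
Proof.
have t1 n : trig_approx (fun x : MR => sg (sin ((x - a) / n.+1%:R - (n.+1%:R ^+ 2)^-1))).
  apply: (@trig_approx_lim (fun k x => iter k q (sin ((x - a) / n.+1%:R - (n.+1%:R ^+ 2)^-1))) _ (cst 1)).
  - move=> k; apply: trig_approx_is_trig; apply: is_trig_iter_q.
    have [p hp] := is_trig_cos (n.+1%:R)^-1 (- a / n.+1%:R - (n.+1%:R ^+ 2)^-1 - pi / 2).
    exists p => x; rewrite -hp addrA cosBpihalf; congr sin; ring.
  - by move=> x; apply: iter_q_cvg; exact: sin_max.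
  - exact: measurable_cst.
  - by apply: intble_bmf; exact: bmfX (bmf_cst _ _).
  - by move=> k x; apply: iter_q_norm; exact: sin_max.
have ts : trig_approx (fun x : MR => 1 - 2 * \1_(`]-oo, a]%classic : set MR) x).
  apply: (@trig_approx_lim _ _ (cst 1) t1).
  - move=> x; apply: cvg_near_cst.
    have sinN_lt0 (y : R) : - pi < y < 0 -> sin y < 0.
      by move=> /andP[h1 h2]; rewrite -[y]opprK sinN oppr_lt0 sin_gt0_pi// oppr_gt0 h2 ltrNl.
    (* This threshold puts the argument inside (-pi, pi) and, for x > a, makes 1/N smaller than x -
       a. At x = a the inverse is 0 by convention. *)
    have := nbhs_infty_ger (`|x - a| + 1 + `|(x - a)^-1|).
    apply: filterS => n hn; set N : R := n.+1%:R.
    have nN : n%:R < N by rewrite ltr_nat.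
    have N0 : 0 < N by rewrite ltr0n.
    clearbody N.
    have yE : (x - a) / N - (N ^+ 2)^-1 = ((x - a) - N^-1) / N by field; rewrite gt_eqF.
    have pi1 : (2 : R) <= pi := pi_ge2 R.
    rewrite yE indicE; case: (boolP (x \in _)) => /= [|]; rewrite mem_setE in_itv/=.
      move=> xa; have x0 : x - a <= 0 by rewrite subr_le0.
      rewrite ler0_norm// in hn; have i0 := normr_ge0 (x - a)^-1.
      have NV0 : 0 < N^-1 by rewrite invr_gt0.
      have N1 : 1 <= N by lra.
      have NV1 : N^-1 <= 1 by rewrite invf_le1.
      have s1 : sin ((x - a - N^-1) / N) < 0.
        apply: sinN_lt0; apply/andP; split.
          rewrite ltr_pdivlMr//.
          have : 1 * N < pi * N by rewrite ltr_pM2r//; lra.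
          lra.
        by rewrite pmulr_llt0 ?invr_gt0//; lra.
      by rewrite /sg s1 ltNge (ltW s1)/=; lra.
    rewrite -ltNge => xa; rewrite mulr0 subr0 /sg ifT//.
    have xa0 : 0 < x - a by rewrite subr_gt0.
    have i0 : 0 < (x - a)^-1 by rewrite invr_gt0.
    rewrite !gtr0_norm// in hn.
    have NV : N^-1 < x - a.
      by rewrite invf_plt ?posrE//; apply: le_lt_trans nN; apply: le_trans hn; lra.
    apply: sin_gt0_pi; apply/andP; split; first by rewrite divr_gt0// subr_gt0.
    rewrite ltr_pdivrMr//; have NV0 : 0 < N^-1 by rewrite invr_gt0.
    have : 1 * N < pi * N by rewrite ltr_pM2r//; lra.
    lra.
  - exact: measurable_cst.
  - by apply: intble_bmf; exact: bmfX (bmf_cst _ _).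
  - by move=> k x; rewrite /sg; case: ifP => _; [|case: ifP => _]; rewrite ?normrN ?normr1 ?normr0.
have := trig_approxD (trig_approxZ (- (1 / 2)) ts) (trig_approx_is_trig (is_trig_cst (1 / 2))).
by apply: trig_approx_eq => x; field.
Qed.

Let cos_bounds (y : R) : 0 <= y -> 1 - y ^+ 2 / 2 <= cos y <= 1 - y ^+ 2 / 2 + y ^+ 4 / 24.
Proof.
move=> y0.
have dX k (x : R) : is_derive x 1 (fun z : R => z ^+ k) (k%:R * x ^+ k.-1).
  by have := is_derive_exprn k (is_derive_id x (1 : R)); rewrite mulr1.
have sin1 (x : R) : 0 <= x -> sin x <= x.
  move=> x0; have := @le_of_is_derive R (fun z => z - sin z) (fun z => 1 - cos z) 0 x x0.
  rewrite sin0 subrr subr_ge0; apply => z _.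
  by rewrite subr_ge0 cos_le1.
have cos1 (x : R) : 0 <= x -> 1 - x ^+ 2 / 2 <= cos x.
  move=> x0; have := @le_of_is_derive R (fun z => cos z + z ^+ 2 * (1 / 2)) (fun z => - sin z + 2 * z * (1 / 2)) 0 x x0.
  rewrite cos0 expr0n/= mul0r addr0 => H.
  suff : 1 <= cos x + x ^+ 2 * (1 / 2) by lra.
  apply: H => z /andP[z0 _].
    apply: (is_derive_eq (is_deriveD (is_derive_cos z) (is_deriveM (dX 2 z) (is_derive_cst (1 / 2 : R) z (1 : R))))).
    by rewrite /GRing.scale/= /cst; ring.
  by have := sin1 z z0; lra.
have sin3 (x : R) : 0 <= x -> x - x ^+ 3 / 6 <= sin x.
  move=> x0; have := @le_of_is_derive R (fun z => sin z - z + z ^+ 3 * (1 / 6)) (fun z => cos z - 1 + 3 * z ^+ 2 * (1 / 6)) 0 x x0.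
  rewrite sin0 expr0n/= mul0r addr0 subrr => H.
  suff : 0 <= sin x - x + x ^+ 3 * (1 / 6) by lra.
  apply: H => z /andP[z0 _].
    apply: (is_derive_eq (is_deriveD (is_deriveB (is_derive_sin z) (is_derive_id z 1)) (is_deriveM (dX 3 z) (is_derive_cst (1 / 6 : R) z (1 : R))))).
    by rewrite /GRing.scale/= /cst; ring.
  by have := cos1 z z0; lra.
rewrite cos1//=.
have := @le_of_is_derive R (fun z => z ^+ 4 * (1 / 24) - z ^+ 2 * (1 / 2) - cos z) (fun z => 4 * z ^+ 3 * (1 / 24) - 2 * z * (1 / 2) + sin z) 0 y y0.
rewrite cos0 !expr0n/= !mul0r => H.
suff : 0 - 0 - 1 <= y ^+ 4 * (1 / 24) - y ^+ 2 * (1 / 2) - cos y by lra.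
apply: H => z /andP[z0 _].
  apply: (is_derive_eq (is_deriveB (is_deriveB (is_deriveM (dX 4 z) (is_derive_cst (1 / 24 : R) z (1 : R))) (is_deriveM (dX 2 z) (is_derive_cst (1 / 2 : R) z (1 : R)))) (is_derive_cos z))).
  by rewrite /GRing.scale/= /cst; ring.
by have := sin3 z z0; lra.
Qed.

(** x^2 is the limit of 2 N^2 (1 - cos(x / N)), which lies between 0 and x^2. The bounds on the
    cosine give the error x^4 / (12 N), and x^2 + 1 dominates. *)
Lemma trig_approx_hermite2 : trig_approx (@hermite2 R).
Proof.
pose g n (x : MR) : R := 2 * n.+1%:R ^+ 2 * (1 - cos (x / n.+1%:R)) - 1.
have gb n x : 0 <= x ^+ 2 - (g n x + 1) <= x ^+ 4 / 12 / n.+1%:R.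
  rewrite /g; have : 1 <= n.+1%:R :> R by rewrite ler1n.
  move: (n.+1%:R : R) => N N1; have N0 : 0 < N by lra.
  have y0 : 0 <= `|x| / N by rewrite divr_ge0// ltW.
  have := cos_bounds y0.
  have -> : cos (`|x| / N) = cos (x / N).
    by have [x0|x0] := leP 0 x; [rewrite ger0_norm|rewrite ltr0_norm// mulNr cosN].
  rewrite !exprMn !exprVn; have -> : `|x| ^+ 4 = x ^+ 4 by rewrite -normrX ger0_norm// exprn_even_ge0.
  rewrite real_normK ?num_real// => /andP[h1 h2].
  have N2 : 0 < N ^+ 2 by rewrite exprn_gt0.
  apply/andP; split.
    have := ler_wpM2l (ltW N2) h1; rewrite mulrBr mulr1.
    have -> : N ^+ 2 * (x ^+ 2 / N ^+ 2 / 2) = x ^+ 2 / 2 by field; rewrite gt_eqF.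
    lra.
  have := ler_wpM2l (ltW N2) h2; rewrite mulrDr mulrBr mulr1.
  have -> : N ^+ 2 * (x ^+ 2 / N ^+ 2 / 2) = x ^+ 2 / 2 by field; rewrite gt_eqF.
  have -> : N ^+ 2 * (x ^+ 4 / N ^+ 4 / 24) = x ^+ 4 / 24 / N ^+ 2 by field; rewrite gt_eqF.
  have : x ^+ 4 / 24 / N ^+ 2 <= x ^+ 4 / 24 / N.
    apply: ler_wpM2l; first by rewrite divr_ge0// exprn_even_ge0.
    by rewrite lef_pV2 ?posrE// expr2 ler_peMl// ltW.
  have -> : x ^+ 4 / 12 / N = 2 * (x ^+ 4 / 24 / N) by field; rewrite gt_eqF.
  lra.
have cg (x : R) : g n x @[n --> \oo] --> hermite2 x.
  have c0 : x ^+ 4 / 12 / n.+1%:R @[n --> \oo] --> (x ^+ 4 / 12 * 0 : R).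
    apply: cvgM; first exact: cvg_cst.
    exact: cvg_harmonic.
  rewrite mulr0 in c0.
  have c1 : x ^+ 2 - 1 - x ^+ 4 / 12 / n.+1%:R @[n --> \oo] --> (x ^+ 2 - 1 - 0 : R).
    by apply: cvgB => //; exact: cvg_cst.
  rewrite subr0 in c1; apply: (squeeze_cvgr _ c1 (@cvg_cst _ _ _ _ _)).
  apply: nearW => n; have := gb n x.
  rewrite /hermite2; move: (g n x : R) (x ^+ 4 / 12 / n.+1%:R : R) => y E /andP[h1 h2].
  by apply/andP; split; lra.
apply: (@trig_approx_lim g _ (fun x => x ^+ 2 + 1)).
- move=> n; apply: trig_approx_is_trig.
  have [p hp] := is_trigD (is_trigZ (- (2 * n.+1%:R ^+ 2)) (is_trig_cos (n.+1%:R^-1 : R) 0)) (is_trig_cst (2 * n.+1%:R ^+ 2 - 1 : R)).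
  by exists p => x; rewrite -hp addr0 /g (mulrC x); ring.
- exact: cg.
- by apply: measurable_funD => //; exact: (@measurable_funX _ _ R setT id).
- have := @intble_sqrD _ _ _ gamma (@hermite2 R) (fun=> 2) (intble_measurable (intble_hermite2 R)) (measurable_cst _) (intble_hermite2_sqr R) (intble_cst _ _).
  by apply: intble_eq => x; rewrite /hermite2; congr (_ ^+ 2); ring.
- move=> n x; have /andP[h1 h2] := gb n x; have h3 : -1 <= g n x.
    rewrite /g lerDr mulr_ge0 ?mulr_ge0 ?sqr_ge0// subr_ge0; exact: cos_le1.
  rewrite ler_norml; apply/andP; split; last lra.
  have := sqr_ge0 x; lra.
Qed.

End trig_approx.

Section gaussian_l2.
Context d (T : measurableType d) (R : realType) (P : probability T R).
Local Notation MR := (measurableTypeR R).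

Lemma gaussian_intble_sqr (X : T -> R) : gaussian_rv P X -> intble P (fun w => X w ^+ 2).
Proof.
move=> gX; have [mX' [m [s law]]] := gX; have mX : measurable_fun setT (X : T -> MR) by [].
have [s0|s0] := eqVneq s 0; last first.
  have law' A : measurable A -> P (X @^-1` A) = normal_prob m s A.
    by move=> mA; rewrite law// (negbTE s0).
  apply: (gaussian_integral gX s0 law' (h := fun x => x ^+ 2) _).1.
  have i2 := quartic_growth_integrable s0 (quartic_growthX m (isT : 2 <= 4)%N (bmf_cst _ (1 : R))).
  apply: (intble_le _ (intbleD (intbleZ 2 i2) (intble_cst _ (2 * m ^+ 2)))).
    exact: (@measurable_funX _ _ R setT id).
  move=> x; rewrite ger0_norm ?sqr_ge0// mulr1.
  by have := sqr_ge0 (x - 2 * m); nra.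
have mh : measurable_fun setT (fun x : MR => (`|(x ^+ 2)%:E|)%E).
  by apply: measurableT_comp => //; apply/measurable_EFinP; exact: (@measurable_funX _ _ R setT id).
apply/integrableP; split.
  by apply/measurable_EFinP; exact: measurable_funX.
rewrite -(@ge0_integral_pushforward _ _ _ _ _ _ mX P setT (fun x => `|(x ^+ 2)%:E|%E))//.
rewrite (_ : (\int[pushforward P (X : T -> MR)]_x `|(x ^+ 2)%:E| = \int[@dirac _ MR m R]_x `|(x ^+ 2)%:E|)%E).
  by rewrite integral_dirac ?diracT ?mul1e ?ltry//.
have law' A : measurable A -> P (X @^-1` A) = \d_m A.
  by move=> mA; rewrite law// s0 eqxx.
by apply: eq_measure_integral => A mA _; exact: law'.
Qed.

Lemma intble_sqr_intble (X : T -> R) : measurable_fun setT X ->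
  intble P (fun w => X w ^+ 2) -> intble P X.
Proof.
move=> mX iX; apply: (intble_le mX (intbleD iX (intble_cst P 1))) => w.
have : `|X w| ^+ 2 = X w ^+ 2 by rewrite real_normK ?num_real.
by move=> <-; have := sqr_ge0 (`|X w| - 1); nra.
Qed.

Lemma Int_sum (I : Type) (s : seq I) (F : I -> T -> R) :
  (forall i, intble P (F i)) ->
  intble P (fun w => \sum_(i <- s) F i w) /\
  \int[P]_w (\sum_(i <- s) F i w) = \sum_(i <- s) \int[P]_w F i w.
Proof.
move=> iF; elim: s => [|i s [IH1 IH2]].
  rewrite big_nil; split; first by under eq_fun do rewrite big_nil; exact: intble_cst.
  by under eq_Rintegral do rewrite big_nil; exact: Int_prob_cst.
rewrite big_cons -IH2 -IntD//; split; first by under eq_fun do rewrite big_cons; exact: intbleD.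
by apply: eq_Rintegral => w _; rewrite big_cons.
Qed.

End gaussian_l2.

(** The squared modulus of the sum of c_k z_k, with c = X + i Y and z = p + i q. The covariance
    hypothesis concerns a_m times a conjugate, so it gives X_k X_j + Y_k Y_j and Y_k X_j - X_k Y_j
    but not the four products separately; only these two combinations appear here. *)
Lemma sqr_norm_sum (R : comRingType) n (X Y p q : 'I_n -> R) :
  (\sum_k (X k * p k - Y k * q k)) ^+ 2 + (\sum_k (X k * q k + Y k * p k)) ^+ 2 =
  \sum_k \sum_j ((X k * X j + Y k * Y j) * (p k * p j + q k * q j) -
    (Y k * X j - X k * Y j) * (q k * p j - p k * q j)).
Proof.
rewrite !expr2 !big_distrl -big_split/=; apply: eq_bigr => k _.
by rewrite !big_distrr -big_split/=; apply: eq_bigr => j _ /=; ring.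
Qed.

Lemma Re_sign_conj (R : realType) k (z : R[i]) :
  complex.Re ((-1) ^+ k * (z^*)%C) = (-1) ^+ k * complex.Re z.
Proof. by case: z => x y; rewrite -signr_odd -[in RHS]signr_odd; case: (odd k); rewrite ?expr1 ?expr0 /=; ring. Qed.

Lemma Im_sign_conj (R : realType) k (z : R[i]) :
  complex.Im ((-1) ^+ k * (z^*)%C) = - (-1) ^+ k * complex.Im z.
Proof. by case: z => x y; rewrite -signr_odd -[in RHS]signr_odd; case: (odd k); rewrite ?expr1 ?expr0 /=; ring. Qed.

Section spherical_harmonics_measurable.
Variable R : realType.
Local Notation AT := (measurableTypeR R * measurableTypeR R)%type.

Lemma bmf_cpow (u v : AT -> R) m : bmf u -> bmf v ->
  bmf (fun t => (cpow (u t) (v t) m).1) /\ bmf (fun t => (cpow (u t) (v t) m).2).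
Proof.
move=> bu bv; elim: m => [|m [IH1 IH2]] /=; first by split; exact: bmf_cst.
have bN (f : AT -> R) : bmf f -> bmf (fun t => - f t).
  by move=> bf; have := bmfM (bmf_cst _ (-1)) bf; under eq_fun do rewrite mulN1r.
split; [apply: bmfD; [|apply: bN]|apply: bmfD]; exact: bmfM.
Qed.

Lemma bmf_sphY l m : bmf (fun t : AT => complex.Re (sphY l m (spherical_coord t))) /\
  bmf (fun t : AT => complex.Im (sphY l m (spherical_coord t))).
Proof.
have b1 : bmf (fun t : AT => sin t.1 * cos t.2).
  by apply: bmfM; [apply: bmf_sin|apply: bmf_cos].
have b2 : bmf (fun t : AT => sin t.1 * sin t.2).
  by apply: bmfM; [apply: bmf_sin|apply: bmf_sin].
have b3 : bmf (fun t : AT => cos t.1) by apply: bmf_cos.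
have nn n : bmf (fun t : AT => complex.Re (sphY_nneg l n (spherical_coord t))) /\
  bmf (fun t : AT => complex.Im (sphY_nneg l n (spherical_coord t))).
  have [c1 c2] := bmf_cpow n b1 b2.
  have bp : bmf (fun t : AT => (-1) ^+ n * Num.sqrt ((2 * l + 1)%:R / (4 * pi) * ((l - n)`!%:R / (l + n)`!%:R)) * ((legendre R l)^`(n)).[cos t.1]).
    by apply: bmfM; [exact: bmf_cst|exact: bmf_horner].
  split; rewrite /sphY_nneg /=.
    under eq_fun do rewrite cpowE /= mul0r subr0.
    exact: bmfM.
  under eq_fun do rewrite cpowE /= mul0r addr0.
  exact: bmfM.
case: m => n; first exact: nn.
have [n1 n2] := nn n.+1; rewrite NegzE; split.
  under eq_fun do rewrite sphY_opp Re_sign_conj.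
  by apply: bmfM; [exact: bmf_cst|exact: n1].
under eq_fun do rewrite sphY_opp Im_sign_conj.
by apply: bmfM; [exact: bmf_cst|exact: n2].
Qed.

End spherical_harmonics_measurable.

Lemma measurable_eigenfield d (T : measurableType d) (R : realType) l (a : int -> T -> R[i]) w :
  measurable_fun setT (fun x : R * R * R => eigenfield l a w x).
Proof.
have m1 : measurable_fun setT (fun x : R * R * R => x.1.1) by exact: measurableT_comp.
have m2 : measurable_fun setT (fun x : R * R * R => x.1.2) by exact: measurableT_comp.
have mh (p : {poly R}) : measurable_fun setT (fun x : R * R * R => p.[x.2]).
  apply: (@measurableT_comp _ _ _ _ _ _ (horner p)) => //.
  by apply: continuous_measurable_fun; exact: continuous_horner.
have mc m : measurable_fun setT (fun x : R * R * R => (cpow x.1.1 x.1.2 m).1) /\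
    measurable_fun setT (fun x : R * R * R => (cpow x.1.1 x.1.2 m).2).
  elim: m => [|m [IH1 IH2]] /=; first by split; exact: measurable_cst.
  by split; [apply: measurable_funB|apply: measurable_funD]; exact: measurable_funM.
have nn n : measurable_fun setT (fun x : R * R * R => complex.Re (sphY_nneg l n x)) /\
  measurable_fun setT (fun x : R * R * R => complex.Im (sphY_nneg l n x)).
  have [c1 c2] := mc n; split; rewrite /sphY_nneg /=.
    under eq_fun do rewrite cpowE /= mul0r subr0.
    by apply: measurable_funM => //; apply: measurable_funM => //; exact: mh.
  under eq_fun do rewrite cpowE /= mul0r addr0.
  by apply: measurable_funM => //; apply: measurable_funM => //; exact: mh.
have mY m : measurable_fun setT (fun x : R * R * R => complex.Re (sphY l m x)) /\
  measurable_fun setT (fun x : R * R * R => complex.Im (sphY l m x)).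
  case: m => n; first exact: nn.
  have [n1 n2] := nn n.+1; rewrite NegzE; split.
    under eq_fun do rewrite sphY_opp Re_sign_conj.
    exact: measurable_funM.
  under eq_fun do rewrite sphY_opp Im_sign_conj.
  exact: measurable_funM.
rewrite /eigenfield /sum_order.
under eq_fun do rewrite Re_sum.
apply: measurable_sum => k; have [y1 y2] := mY (k%:Z - l%:Z).
have := measurable_funB (measurable_funM (measurable_cst (complex.Re (a (k%:Z - l%:Z) w))) y1)
  (measurable_funM (measurable_cst (complex.Im (a (k%:Z - l%:Z) w))) y2).
apply: eq_measurable_fun => x _ /=.
by move: (a _ w) (sphY _ _ _) => [? ?] [? ?].
Qed.

(** * The random field in angles and its finite-dimensional laws *)

Section field.
Context d (T : measurableType d) (R : realType) (P : probability T R).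
Variables (l : nat) (a : int -> T -> R[i]).
Hypothesis H : harmonic_coefficients P l a.
Local Notation AT := (measurableTypeR R * measurableTypeR R)%type.
Local Notation I := 'I_(2 * l).+1.
Let idx (k : I) : int := k%:Z - l%:Z.
Let X k w := complex.Re (a (idx k) w).
Let Y k w := complex.Im (a (idx k) w).
Let p k (t : AT) := complex.Re (sphY l (idx k) (spherical_coord t)).
Let q k (t : AT) := complex.Im (sphY l (idx k) (spherical_coord t)).

Let idx_le k : (`|idx k| <= l)%N.
Proof.
rewrite /idx; have := ltn_ord k; rewrite ltnS => kl.
have [lk|lk] := leqP l k; first by rewrite subzn// absz_nat leq_subLR addnn -mul2n.
by rewrite -opprB abszN subzn ?(ltnW lk)// absz_nat leq_subr.
Qed.

Let idx_rev k : idx (rev_ord k) = - idx k.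
Proof.
rewrite /idx /= subSS -subzn; last by rewrite -ltnS.
rewrite (_ : Posz (2 * l) = l%:Z + l%:Z); first ring.
by rewrite mul2n -addnn PoszD.
Qed.

Let idx_inj : injective idx.
Proof. by move=> i j /addIr [] /val_inj. Qed.

(** [jointly_gaussian] takes weights on all integers; weights on positions are transported to them
    along the injection [idx]. *)
Let idx_linear (u v : I -> R) : exists u' v' : int -> R, forall k, u' (idx k) = u k /\ v' (idx k) = v k.
Proof.
pose F (u : I -> R) (m : int) : R := if [pick k | idx k == m] is Some k then u k else 0.
exists (F u), (F v) => k; rewrite /F.
by case: pickP => [j /eqP/idx_inj ->//|/(_ k)]; rewrite eqxx.
Qed.

Let gaussian_lin (u v : I -> R) : gaussian_rv P (fun w => \sum_k (u k * X k w + v k * Y k w)).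
Proof.
have [u' [v' h]] := idx_linear u v; have := coef_gaussian H u' v'.
congr gaussian_rv; apply/funext => w; rewrite /sum_order; apply: eq_bigr => k _.
by have [-> ->] := h k.
Qed.

Let gX k : gaussian_rv P (X k).
Proof.
have := gaussian_lin (fun j => (j == k)%:R) (fun=> 0); congr gaussian_rv.
apply/funext => w; rewrite (bigD1 k)//= eqxx mul1r mul0r addr0 big1 ?addr0// => j /negbTE ->.
by rewrite !mul0r addr0.
Qed.

Let gY k : gaussian_rv P (Y k).
Proof.
have := gaussian_lin (fun=> 0) (fun j => (j == k)%:R); congr gaussian_rv.
apply/funext => w; rewrite (bigD1 k)//= eqxx mul1r mul0r add0r big1 ?addr0// => j /negbTE ->.
by rewrite !mul0r addr0.
Qed.

Let mX k : measurable_fun setT (X k). Proof. by have [] := gX k. Qed.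
Let mY k : measurable_fun setT (Y k). Proof. by have [] := gY k. Qed.
Let iX2 k : intble P (fun w => X k w ^+ 2). Proof. exact: gaussian_intble_sqr. Qed.
Let iY2 k : intble P (fun w => Y k w ^+ 2). Proof. exact: gaussian_intble_sqr. Qed.
Let iX k : intble P (X k). Proof. exact: intble_sqr_intble. Qed.
Let iY k : intble P (Y k). Proof. exact: intble_sqr_intble. Qed.

Let EX0 k : \int[P]_w X k w = 0.
Proof.
have [h _] := coef_mean H (idx_le k).
by move: h; rewrite unlock /Rintegral => ->.
Qed.

Let EY0 k : \int[P]_w Y k w = 0.
Proof.
have [_ h] := coef_mean H (idx_le k).
by move: h; rewrite unlock /Rintegral => ->.
Qed.

Let ERe k j : \int[P]_w (X k w * X j w + Y k w * Y j w) = 4 * pi / (2 * l + 1)%:R * (k == j)%:R.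
Proof.
have [h _] := coef_cov H (idx_le k) (idx_le j).
rewrite -(inj_eq idx_inj) -[RHS]/(fine (4 * pi / (2 * l + 1)%:R * (idx k == idx j)%:R)%:E) -[X in fine X]h.
rewrite unlock /Rintegral; congr fine; apply: eq_integral => w _; congr EFin.
rewrite /X /Y; move: (a (idx k) w) (a (idx j) w) => [x1 y1] [x2 y2] /=; ring.
Qed.

Let EIm k j : \int[P]_w (Y k w * X j w - X k w * Y j w) = 0.
Proof.
have [_ h] := coef_cov H (idx_le k) (idx_le j).
rewrite -[RHS]/(fine (0%:E : \bar R)) -[X in fine X]h.
rewrite unlock /Rintegral; congr fine; apply: eq_integral => w _; congr EFin.
rewrite /X /Y; move: (a (idx k) w) (a (idx j) w) => [x1 y1] [x2 y2] /=; ring.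
Qed.

Let XY_rev k w : X k w = (-1) ^+ `|idx k|%N * X (rev_ord k) w /\
  Y k w = - (-1) ^+ `|idx k|%N * Y (rev_ord k) w.
Proof.
rewrite /X /Y idx_rev (coef_real H (idx_le k)).
by rewrite Re_sign_conj Im_sign_conj.
Qed.

Let pq_rev k t : p k t = (-1) ^+ `|idx k|%N * p (rev_ord k) t /\
  q k t = - (-1) ^+ `|idx k|%N * q (rev_ord k) t.
Proof.
rewrite /p /q idx_rev; case: (idx k) => n.
  rewrite sphY_opp absz_nat Re_sign_conj Im_sign_conj !mulrA mulrNN -expr2 sqrr_sign !mul1r.
  by [].
by rewrite NegzE opprK sphY_opp abszN absz_nat Re_sign_conj Im_sign_conj.
Qed.

Definition field (t : AT) w : R := eigenfield l a w (spherical_coord t).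

Let fieldE t w : field t w = \sum_k (X k w * p k t - Y k w * q k t).
Proof.
rewrite /field /eigenfield /sum_order Re_sum; apply: eq_bigr => k _.
rewrite /X /Y /p /q -/(idx k).
by move: (a _ w) (sphY _ _ _) => [? ?] [? ?].
Qed.

(** Replacing m by -m turns the sum into its own opposite, by the conjugation rules for coefficients
    and harmonics. *)
Let field_im t w : \sum_k (X k w * q k t + Y k w * p k t) = 0.
Proof.
set S := \sum_k _; suff : S = - S by lra.
rewrite {1}/S (reindex_inj rev_ord_inj)/= -sumrN; apply: eq_bigr => k _.
have [-> ->] := XY_rev k w; have [-> ->] := pq_rev k t.
have : ((-1) ^+ `|idx k|%N : R) ^+ 2 = 1 by exact: sqrr_sign.
move: ((-1) ^+ _ : R) => e e2.
move: (X _ _) (Y _ _) (p _ _) (q _ _) => x y p' q'.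
have -> : - (e * x * (- e * q') + - e * y * (e * p')) = e ^+ 2 * (x * q' + y * p') by ring.
by rewrite e2 mul1r.
Qed.

Lemma measurable_field : measurable_fun setT (fun tw : AT * T => field tw.1 tw.2).
Proof.
under eq_fun do rewrite fieldE.
apply: measurable_sum => k; apply: measurable_funB; apply: measurable_funM.
- exact: (measurableT_comp (mX k) measurable_snd).
- have mp : measurable_fun setT (p k) := (bmf_sphY R l (idx k)).1.1.
  exact: (measurableT_comp mp measurable_fst).
- exact: (measurableT_comp (mY k) measurable_snd).
- have mq : measurable_fun setT (q k) := (bmf_sphY R l (idx k)).2.1.
  exact: (measurableT_comp mq measurable_fst).
Qed.

Lemma bmf_field w : bmf (fun t : AT => field t w).
Proof.
under eq_fun do rewrite fieldE.
apply: bmf_sum => k; have [b1 b2] := bmf_sphY R l (idx k).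
have := bmfD (bmfM (bmf_cst _ (X k w)) b1) (bmfM (bmf_cst _ (- Y k w)) b2).
by congr bmf; apply/funext => t; rewrite mulNr.
Qed.

Section pair.
Variables (u v : R) (t s : AT).
Let P' k := u * p k t + v * p k s.
Let Q' k := u * q k t + v * q k s.
Let F w := u * field t w + v * field s w.

Let FE w : F w = \sum_k (X k w * P' k - Y k w * Q' k).
Proof.
rewrite /F !fieldE !mulr_sumr -big_split/=; apply: eq_bigr => k _.
by rewrite /P' /Q'; ring.
Qed.

Let F_im w : \sum_k (X k w * Q' k + Y k w * P' k) = 0.
Proof.
transitivity (u * \sum_k (X k w * q k t + Y k w * p k t) + v * \sum_k (X k w * q k s + Y k w * p k s)).
  by rewrite !mulr_sumr -big_split/=; apply: eq_bigr => k _; rewrite /P' /Q'; ring.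
by rewrite !field_im !mulr0 addr0.
Qed.

Let gF : gaussian_rv P F.
Proof.
have := gaussian_lin P' (fun k => - Q' k); congr gaussian_rv; apply/funext => w.
by rewrite FE; apply: eq_bigr => k _; ring.
Qed.

Let EF : \int[P]_w F w = 0.
Proof.
transitivity (\int[P]_w (\sum_k (P' k * X k w + (- Q' k) * Y k w))).
  by apply: eq_Rintegral => w _; rewrite FE; apply: eq_bigr => k _; ring.
rewrite (Int_sum _ _).2; last by move=> k; apply: intbleD; exact: intbleZ.
rewrite big1// => k _; rewrite IntD; [|exact: intbleZ|exact: intbleZ].
by rewrite !IntZ// EX0 EY0 !mulr0 addr0.
Qed.

Let kernelE t1 t2 : 4 * pi / (2 * l + 1)%:R * \sum_k (p k t1 * p k t2 + q k t1 * q k t2) =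
  (legendre R l).[dot (spherical_coord t1) (spherical_coord t2)].
Proof.
rewrite -zonal_kernelE -addition_formula; congr (_ * _).
rewrite /sum_order Re_sum; apply: eq_bigr => k _; rewrite /p /q -/(idx k).
by move: (sphY _ _ _) (sphY _ _ _) => [? ?] [? ?] /=; ring.
Qed.

Let kernel1 t1 : 4 * pi / (2 * l + 1)%:R * \sum_k (p k t1 * p k t1 + q k t1 * q k t1) = 1.
Proof.
rewrite kernelE; have := sphere_spherical_coord t1.
rewrite /sphere/= /dot -!expr2 => ->; exact: legendre1.
Qed.

(** As the imaginary part vanishes, F^2 is a squared modulus; the covariance hypothesis makes its
    expectation a diagonal sum, which the addition theorem turns into values of P_l. *)
Let EF2 : \int[P]_w F w ^+ 2 = u ^+ 2 + v ^+ 2 +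
  2 * u * v * (legendre R l).[dot (spherical_coord t) (spherical_coord s)].
Proof.
have iXX k j : intble P (fun w => X k w * X j w) by exact: intble_mul.
have iYY k j : intble P (fun w => Y k w * Y j w) by exact: intble_mul.
have iYX k j : intble P (fun w => Y k w * X j w) by exact: intble_mul.
have iXY k j : intble P (fun w => X k w * Y j w) by exact: intble_mul.
have i1 k j : intble P (fun w => X k w * X j w + Y k w * Y j w) by exact: intbleD.
have i2 k j : intble P (fun w => Y k w * X j w - X k w * Y j w) by exact: intbleB.
transitivity (\int[P]_w (\sum_k \sum_j ((P' k * P' j + Q' k * Q' j) * (X k w * X j w + Y k w * Y j w) +
    - (Q' k * P' j - P' k * Q' j) * (Y k w * X j w - X k w * Y j w)))).
  apply: eq_Rintegral => w _; have := sqr_norm_sum (X ^~ w) (Y ^~ w) P' Q'.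
  rewrite F_im expr0n addr0 -FE => ->.
  by apply: eq_bigr => k _; apply: eq_bigr => j _; ring.
have i3 k j : intble P (fun w => (P' k * P' j + Q' k * Q' j) * (X k w * X j w + Y k w * Y j w) +
    - (Q' k * P' j - P' k * Q' j) * (Y k w * X j w - X k w * Y j w)).
  by apply: intbleD; exact: intbleZ.
rewrite (Int_sum _ _).2; last by move=> k; exact: (Int_sum _ _).1.
transitivity (\sum_k (P' k ^+ 2 + Q' k ^+ 2) * (4 * pi / (2 * l + 1)%:R)).
  apply: eq_bigr => k _; rewrite (Int_sum _ _).2// (bigD1 k)//= big1 ?addr0.
    rewrite IntD; [|exact: intbleZ|exact: intbleZ].
    by rewrite !IntZ// ERe EIm eqxx mulr0 addr0 mulr1 !expr2.
  move=> j jk; rewrite IntD; [|exact: intbleZ|exact: intbleZ].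
  by rewrite !IntZ// ERe EIm eq_sym (negbTE jk) !mulr0 addr0.
rewrite -mulr_suml mulrC.
have h1 := kernel1 t; have h2 := kernel1 s; rewrite -kernelE.
move: (4 * pi / (2 * l + 1)%:R : R) h1 h2 => c h1 h2.
transitivity (c * (\sum_k (u ^+ 2 * (p k t * p k t + q k t * q k t) + v ^+ 2 * (p k s * p k s + q k s * q k s)
   + 2 * u * v * (p k t * p k s + q k t * q k s)))).
  by congr (_ * _); apply: eq_bigr => k _; rewrite /P' /Q'; ring.
set S := (X in _ + 2 * u * v * (c * X)).
rewrite 2![in LHS]big_split/= -!mulr_sumr -/S !mulrDr.
by rewrite (mulrCA c (u ^+ 2)) (mulrCA c (v ^+ 2)) (mulrCA c (2 * u * v)) h1 h2 !mulr1.
Qed.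

(** All that the variance estimates use of the joint law of two field values. *)
Lemma field_cos (b : R) : \int[P]_w cos (u * field t w + v * field s w + b) =
  expR (- ((u ^+ 2 + v ^+ 2 + 2 * u * v *
     (legendre R l).[dot (spherical_coord t) (spherical_coord s)]) / 2)) * cos b.
Proof. by rewrite -(gaussian_cos gF EF b EF2). Qed.

(** The weights are section variables, whence the two equations; any point can serve as [s]. *)
Lemma field_law1 : u = 1 -> v = 0 -> gaussian_rv P (field t) /\
  forall A : set R, measurable A -> P (field t @^-1` A) = normal_prob 0 1 A.
Proof.
move=> u1 v0; have FE' : F = field t by apply/funext => w; rewrite /F u1 v0 mul0r addr0 mul1r.
rewrite -FE'; split => //; apply: gaussian_std => //.
by rewrite EF2 u1 v0 expr1n expr0n/= mulr0 mul0r !addr0.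
Qed.

End pair.
End field.

(** * Variance of integrals along the field *)

Section real_fubini.
Context d1 d2 (T1 : measurableType d1) (T2 : measurableType d2) (R : realType).
Variables (m1 : {finite_measure set T1 -> \bar R}) (m2 : {finite_measure set T2 -> \bar R}).
Implicit Types F : T1 * T2 -> R.

Lemma measurable_Rintegral2 F : measurable_fun setT F ->
  measurable_fun setT (fun x => \int[m2]_y F (x, y)).
Proof.
move=> mF; have mE : measurable_fun setT (EFin \o F) by exact/measurable_EFinP.
apply: (@measurableT_comp _ _ _ _ _ _ fine) => //.
rewrite (_ : (fun x => _) = (fun x => fubini_F m2 (EFin \o F)^\+ x - fubini_F m2 (EFin \o F)^\- x)%E).
  by apply: emeasurable_funB; apply: measurable_fun_fubini_tonelli_F => //;
    [exact: measurable_funepos|exact: measurable_funeneg].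
apply/funext => x; rewrite integralE /fubini_F /=.
by congr (_ - _)%E; apply: eq_integral => y _; rewrite ?funeposE ?funenegE.
Qed.

Lemma bmf_section F x : bmf F -> bmf (fun y => F (x, y)).
Proof.
move=> [mF [M FM]]; split; last by exists M.
exact: (measurableT_comp mF (measurable_pair1 x)).
Qed.

Lemma bmf_Rintegral2 F : bmf F -> bmf (fun x => \int[m2]_y F (x, y)).
Proof.
move=> bF; have [mF [M FM]] := bF; split; first exact: measurable_Rintegral2.
exists (\int[m2]_y M) => x; have iF := intble_bmf m2 (bmf_section x bF).
apply: (le_trans (le_normr_Rintegral measurableT iF)); apply: Int_le => //.
  by apply: intble_bmf; have [m _] := bmf_section x bF; split; [exact: measurableT_comp|exists M => y; rewrite normr_id].
exact: intble_cst.
Qed.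

Lemma tonelli_real F : measurable_fun setT F -> (forall z, 0 <= F z) ->
  (forall x, intble m2 (fun y => F (x, y))) -> (forall y, intble m1 (fun x => F (x, y))) ->
  intble m2 (fun y => \int[m1]_x F (x, y)) ->
  intble m1 (fun x => \int[m2]_y F (x, y)) /\
  \int[m1]_x \int[m2]_y F (x, y) = \int[m2]_y \int[m1]_x F (x, y).
Proof.
move=> mF F0 i2 i1 i21; have mE : measurable_fun setT (EFin \o F) by exact/measurable_EFinP.
have F0' z : (0 <= (EFin \o F) z)%E by rewrite lee_fin.
have := @fubini_tonelli _ _ _ _ _ m1 m2 (EFin \o F) mE F0'.
have -> : (\int[m1]_x \int[m2]_y (EFin \o F) (x, y) = \int[m1]_x (\int[m2]_y F (x, y))%:E)%E.
  apply: eq_integral => x _; rewrite /Rintegral fineK//.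
  exact: (integrable_fin_num _ (i2 x)).
have -> : (\int[m2]_y \int[m1]_x (EFin \o F) (x, y) = \int[m2]_y (\int[m1]_x F (x, y))%:E)%E.
  apply: eq_integral => x _; rewrite /Rintegral fineK//.
  exact: (integrable_fin_num _ (i1 x)).
move=> E; split; last by rewrite /Rintegral; congr fine.
apply/integrableP; split; first by apply/measurable_EFinP; exact: measurable_Rintegral2.
have -> : (\int[m1]_x `|(EFin \o (fun x => \int[m2]_y F (x, y))%R) x| = \int[m1]_x (\int[m2]_y F (x, y))%:E)%E.
  by apply: eq_integral => x _ /=; rewrite ger0_norm// Int_ge0.
by rewrite E ltey_eq integrable_fin_num.
Qed.

End real_fubini.

Section real_fubini_bounded.
Context d1 d2 (T1 : measurableType d1) (T2 : measurableType d2) (R : realType).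
Variables (m1 : {finite_measure set T1 -> \bar R}) (m2 : {finite_measure set T2 -> \bar R}).
Implicit Types F : T1 * T2 -> R.

Lemma bmf_swap F : bmf F -> bmf (fun z : T2 * T1 => F (z.2, z.1)).
Proof.
move=> bF; apply: (bmf_comp (g := fun z : T2 * T1 => (z.2, z.1)) bF).
exact: measurable_swap.
Qed.

Lemma bmf_section1 F y : bmf F -> bmf (fun x => F (x, y)).
Proof. by move=> bF; exact: (bmf_section y (bmf_swap bF)). Qed.

Lemma bmf_Rintegral1 F : bmf F -> bmf (fun y => \int[m1]_x F (x, y)).
Proof. by move=> bF; exact: (bmf_Rintegral2 m1 (bmf_swap bF)). Qed.

Lemma fubini_real F : bmf F ->
  \int[m1]_x \int[m2]_y F (x, y) = \int[m2]_y \int[m1]_x F (x, y).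
Proof.
move=> bF; have [mF [M FM]] := bF.
(* Adding the bound M makes the integrand nonnegative, so that Tonelli's theorem applies; the
   constant cancels afterwards. *)
pose G z := F z + M; have bG : bmf G by apply: bmfD => //; exact: bmf_cst.
have [_] := @tonelli_real _ _ _ _ _ m1 m2 G bG.1
  (fun z => ltac:(by rewrite /G; have := FM z; rewrite ler_norml => /andP[h _]; lra))
  (fun x => intble_bmf m2 (bmf_section x bG)) (fun y => intble_bmf m1 (bmf_section1 y bG))
  (intble_bmf m2 (bmf_Rintegral1 bG)).
have E1 x : \int[m2]_y G (x, y) = \int[m2]_y F (x, y) + \int[m2]_y M.
  by rewrite IntD//; [exact: intble_bmf (bmf_section x bF)|exact: intble_cst].
have E2 y : \int[m1]_x G (x, y) = \int[m1]_x F (x, y) + \int[m1]_x M.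
  by rewrite IntD//; [exact: intble_bmf (bmf_section1 y bF)|exact: intble_cst].
under eq_Rintegral do rewrite E1; under [in RHS]eq_Rintegral do rewrite E2.
rewrite IntD; [|exact: intble_bmf (bmf_Rintegral2 m2 bF)|exact: intble_cst].
rewrite IntD; [|exact: intble_bmf (bmf_Rintegral1 bF)|exact: intble_cst].
have -> : \int[m2]__ \int[m1]_x M = \int[m1]__ \int[m2]_y M.
  by rewrite !Rintegral_cst//; ring.
by move=> /addIr.
Qed.

End real_fubini_bounded.

Section variance.
Context d (T : measurableType d) (R : realType) (P : probability T R).
Variables (l : nat) (a : int -> T -> R[i]).
Hypothesis l_gt0 : (0 < l)%N.
Hypothesis H : harmonic_coefficients P l a.
Local Notation MR := (measurableTypeR R).
Local Notation AT := (MR * MR)%type.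
Local Notation nu := (@angle_measure R).
Local Notation gamma := (@normal_prob R 0 1).
Local Notation f := (field l a).
Let s0 : (1 : R) != 0. Proof. exact: oner_neq0. Qed.

Definition pint_excess : R := `|pint (legendre R l ^+ 3)| + `|pint (legendre R l ^+ 4)|.

Lemma measurable_field1 t : measurable_fun setT (f t : T -> R).
Proof. exact: (measurableT_comp (measurable_field H) (measurable_pair1 t)). Qed.

Let rho (t s : AT) : R := (legendre R l).[dot (spherical_coord t) (spherical_coord s)].

Lemma dot_sphere (t s : AT) : -1 <= dot (spherical_coord t) (spherical_coord s) <= 1.
Proof.
have := sphere_spherical_coord t; have := sphere_spherical_coord s.
move: (spherical_coord t) (spherical_coord s) => [[x1 x2] x3] [[y1 y2] y3].
rewrite /sphere /dot /= => h1 h2.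
have e1 := sqr_ge0 (x1 - y1); have e2 := sqr_ge0 (x2 - y2); have e3 := sqr_ge0 (x3 - y3).
have e4 := sqr_ge0 (x1 + y1); have e5 := sqr_ge0 (x2 + y2); have e6 := sqr_ge0 (x3 + y3).
apply/andP; split; nra.
Qed.

Let rho1 t s : -1 <= rho t s <= 1.
Proof. by rewrite -ler_norml; apply: legendre_le1 => //; exact: dot_sphere. Qed.

Lemma trig_field_cov p (t s : AT) :
  \int[P]_w (trig p (f t w) * trig p (f s w)) = trig_cov p (rho t s).
Proof.
apply: Int_trig_cov; try exact: measurable_field1.
by move=> u v b; exact: (field_cos H).
Qed.

Let bmf_trig_field p : bmf (fun tw : AT * T => trig p (f tw.1 tw.2)).
Proof.
exact: (@bmf_comp _ _ _ MR R (trig p) _ (bmf_trig p) (measurable_field H)).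
Qed.

Let bmf_dot (t : AT) : bmf (fun s : AT => dot (spherical_coord s) (spherical_coord t)).
Proof.
rewrite /dot; have b1 : bmf (fun t : AT => sin t.1 * cos t.2).
  by apply: bmfM; [apply: bmf_sin|apply: bmf_cos].
have b2 : bmf (fun t : AT => sin t.1 * sin t.2).
  by apply: bmfM; [apply: bmf_sin|apply: bmf_sin].
have b3 : bmf (fun t : AT => cos t.1) by apply: bmf_cos.
by apply: bmfD; [apply: bmfD|]; apply: bmfM => //; exact: bmf_cst.
Qed.

(** The square is a double integral of [trig_cov] over the sphere, which is bounded by a polynomial
    in P_l; [zonal_integral] evaluates one integral, and 8 pi^2 is 2 pi times 4 pi. The masses of
    order 0 and 2 stay because an approximant is only nearly orthogonal to 1 and x^2 - 1. *)
Lemma variance_trig p :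
  \int[P]_w (\int[nu]_t trig p (f t w)) ^+ 2 <=
  8 * pi ^+ 2 * (2 * (trig_mass 0 p + trig_mass 2 p) + trig_cov p 1 * pint_excess).
Proof.
pose h (z : T * AT) := trig p (f z.2 z.1).
have bh : bmf h := bmf_swap (bmf_trig_field p).
have bI : bmf (fun w => \int[nu]_t h (w, t)) := bmf_Rintegral2 nu bh.
have e1 : \int[P]_w (\int[nu]_t trig p (f t w)) ^+ 2 =
    \int[P]_w \int[nu]_t (fun z : T * AT => (\int[nu]_s h (z.1, s)) * h z) (w, t).
  apply: eq_Rintegral => w _; rewrite /= bmf_RintegralZl ?expr2//.
  exact: (bmf_section w bh).
have bIh : bmf (fun z : T * AT => (\int[nu]_s h (z.1, s)) * h z).
  apply: bmfM => //.
  exact: (@bmf_comp _ _ _ _ _ (fun w => \int[nu]_s h (w, s)) fst bI measurable_fst).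
rewrite e1 (fubini_real P nu bIh)/=.
have bhh t : bmf (fun z : T * AT => h z * h (z.1, t)).
  apply: bmfM => //.
  exact: (@bmf_comp _ _ _ _ _ (fun w => h (w, t)) fst (bmf_section1 t bh) measurable_fst).
have e2 t : \int[P]_w ((\int[nu]_s h (w, s)) * h (w, t)) = \int[nu]_s trig_cov p (rho s t).
  transitivity (\int[P]_w \int[nu]_s (fun z : T * AT => h z * h (z.1, t)) (w, s)).
    apply: eq_Rintegral => w _ /=; rewrite mulrC -bmf_RintegralZl; last exact: (bmf_section w bh).
    by apply: eq_Rintegral => s _; rewrite mulrC.
  rewrite (fubini_real _ _ (bhh t)); apply: eq_Rintegral => s _ /=.
  by rewrite /h /= trig_field_cov.
under eq_Rintegral do rewrite e2.
pose Q : {poly R} := (trig_mass 0 p + trig_mass 2 p)%:P + trig_mass 1 p *: legendre R l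
  + trig_mass 3 p *: legendre R l ^+ 3 + trig_cov p 1 *: legendre R l ^+ 4.
have QE t s : Q.[dot (spherical_coord t) (spherical_coord s)] =
  trig_mass 0 p + trig_mass 2 p + trig_mass 1 p * rho t s + trig_mass 3 p * rho t s ^+ 3
     + trig_cov p 1 * rho t s ^+ 4.
  rewrite /Q /rho; move: (legendre R l) (trig_mass 0 p + _) => L c.
  by rewrite !horner_rw; ring.
have pQ : \int[nu]_t (2 * pi * pint Q) <= 8 * pi ^+ 2 * (2 * (trig_mass 0 p + trig_mass 2 p) + trig_cov p 1 * pint_excess).
  rewrite Rintegral_cst//; have /= -> := angle_measureT R.
  have := pint_legendre R l_gt0; rewrite /Q /pint_excess.
  move: (legendre R l) => L pL; rewrite !pintD !pintZ pL mulr0 addr0.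
  have -> (c : R) : pint c%:P = 2 * c.
    rewrite -(mulr1 c%:P) mul_polyC pintZ -(derivX R) pint_deriv !hornerX; ring.
  move: (pint (L ^+ 3)) (pint (L ^+ 4)) (ler_norm (pint (L ^+ 3))) (ler_norm (pint (L ^+ 4))) => I3 I4 n3 n4.
  have m1 := trig_mass_le 3 p; have m0 := trig_mass_ge0 3 p.
  have p0 : 0 < pi ^+ 2 :> R by rewrite exprn_gt0// pi_gt0.
  rewrite /fine (_ : 2 * pi * _ * (4 * pi) = 8 * pi ^+ 2 * (2 * (trig_mass 0 p + trig_mass 2 p) + trig_mass 3 p * I3 + trig_cov p 1 * I4)); last by ring.
  have q0 : 0 <= 8 * pi ^+ 2 :> R by apply: mulr_ge0 => //; exact: ltW.
  apply: (ler_wpM2l q0); rewrite -addrA lerD2l mulrDr; apply: lerD; last by apply: ler_wpM2l => //; lra.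
  apply: (@le_trans _ _ (trig_mass 3 p * `|I3|)); first exact: ler_wpM2l.
  by apply: ler_wpM2r.
apply: le_trans pQ; apply: Int_le.
- apply: intble_bmf; have := bmf_Rintegral1 P bIh.
  by congr bmf; apply/funext => t; rewrite -e2.
- exact: intble_cst.
- move=> t; rewrite -(zonal_integral t); apply: Int_le.
  + apply: intble_bmf; have := bmf_Rintegral1 P (bhh t).
    by congr bmf; apply/funext => s; rewrite -trig_field_cov.
  + by apply: intble_bmf; apply: bmf_horner; exact: bmf_dot.
  + move=> s; rewrite QE; apply: trig_cov_le; exact: rho1.
Qed.

Lemma field_integral (g : MR -> R) t : intble gamma g ->
  intble P (fun w => g (f t w)) /\ \int[P]_w g (f t w) = \int[gamma]_x g x.
Proof.
have [gt law] := field_law1 H t t (erefl (1 : R)) (erefl (0 : R)).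
exact: (gaussian_integral gt s0 law).
Qed.

(** Cauchy-Schwarz on the sphere, ignoring cancellation; 16 pi^2 is the squared area. It serves for
    approximation errors and for h_{l;2}, where a bound independent of l suffices. *)
Lemma field_l2 (g : MR -> R) : measurable_fun setT g ->
  intble gamma (fun x => g x ^+ 2) -> (forall w, bmf (fun t => g (f t w))) ->
  [/\ measurable_fun setT (fun w => \int[nu]_t g (f t w)),
   intble P (fun w => (\int[nu]_t g (f t w)) ^+ 2) &
  \int[P]_w (\int[nu]_t g (f t w)) ^+ 2 <= 16 * pi ^+ 2 * \int[gamma]_x g x ^+ 2].
Proof.
move=> mg ig bg.
have mF : measurable_fun setT (fun z : T * AT => g (f z.2 z.1)).
  have mf2 : measurable_fun setT (fun z : T * AT => f z.2 z.1 : MR).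
    exact: (measurableT_comp (measurable_field H) (@measurable_swap _ _ T AT)).
  exact: (measurableT_comp mg mf2).
have mI : measurable_fun setT (fun w => \int[nu]_t g (f t w)).
  exact: (measurable_Rintegral2 nu mF).
have [i1 e1] := @tonelli_real _ _ _ _ _ P nu (fun z : T * AT => g (f z.2 z.1) ^+ 2)
  (measurable_funX 2 mF) (fun z => sqr_ge0 _) (fun w => intble_bmf nu (bmfX 2 (bg w)))
  (fun t => (field_integral t ig).1)
  ltac:(by under eq_fun do rewrite (field_integral _ ig).2; exact: intble_cst).
have nuT : \int[nu]_t (1 : R) = 4 * pi.
  by rewrite Rintegral_cst// mul1r; have /= -> := angle_measureT R.
have p0 : 0 < 4 * pi :> R by rewrite mulr_gt0 ?pi_gt0.
have cs w : (\int[nu]_t g (f t w)) ^+ 2 <= 4 * pi * \int[nu]_t g (f t w) ^+ 2.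
  have := @Int_cauchy_schwarz _ _ _ nu (fun t => g (f t w)) (fun=> 1) (bg w).1 (measurable_cst _)
    (intble_bmf nu (bmfX 2 (bg w))) (intble_cst nu (1 ^+ 2)).
  rewrite (_ : \int[nu]_x (g (f x w) * 1) = \int[nu]_t g (f t w)); last first.
    by apply: eq_Rintegral => t _; rewrite mulr1.
  by rewrite expr1n nuT => /(_ p0); rewrite mulrC.
have i2 : intble P (fun w => (\int[nu]_t g (f t w)) ^+ 2).
  apply: (intble_le (measurable_funX 2 mI) (intbleZ (4 * pi) i1)) => w.
  by rewrite ger0_norm ?sqr_ge0.
split => //; apply: (le_trans (Int_le i2 (intbleZ (4 * pi) i1) cs)).
rewrite IntZ// e1 /=; under eq_Rintegral do rewrite (field_integral _ ig).2.
rewrite Rintegral_cst//; have /= -> := angle_measureT R; rewrite /fine le_eqVlt; apply/orP; left; apply/eqP; ring.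
Qed.

(** Since g is orthogonal to 1 and x^2 - 1, Cauchy-Schwarz bounds the masses of order 0 and 2 of an
    approximant by its squared error. Letting the error tend to 0 leaves only the excess term. *)
Lemma variance_approx (g : MR -> R) : trig_approx g ->
  (forall w, bmf (fun t => g (f t w))) ->
  \int[gamma]_x g x = 0 -> \int[gamma]_x (g x * hermite2 x) = 0 ->
  \int[P]_w (\int[nu]_t g (f t w)) ^+ 2 <= 32 * pi ^+ 2 * pint_excess * \int[gamma]_x g x ^+ 2.
Proof.
move=> tg bg g0 g2; have [mg ig hg] := tg.
have [mI iI _] := field_l2 mg ig bg.
have ig1 : intble gamma g := intble_sqr_intble mg ig.
have igh : intble gamma (fun x => g x * hermite2 x).
  apply: intble_mul => //; [exact: intble_measurable (intble_hermite2 R)|exact: intble_hermite2_sqr].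
set v := \int[gamma]_x g x ^+ 2.
have ex0 : 0 <= pint_excess by rewrite addr_ge0.
have p0 : 0 < pi ^+ 2 :> R by rewrite exprn_gt0// pi_gt0.
apply/ler_addgt0Pr => e e0.
(* [c] exceeds the total coefficient with which the error e / c enters the estimates below. *)
pose c : R := pi ^+ 2 * (128 + 64 * pint_excess + 64).
have c0 : 0 < c by rewrite mulr_gt0// ltr_wpDl// addr_ge0// mulr_ge0.
have [p hp] := hg _ (divr_gt0 e0 c0); set e' := e / c in hp.
have bp : bmf (trig p : MR -> R) := bmf_trig p.
have ip := intble_bmf gamma bp.
have ip2 := intble_bmf gamma (bmfX 2 bp).
have iD2 := intble_sub_trig p tg.
have mD : measurable_fun setT (fun x : MR => g x - trig p x) by apply: measurable_funB => //; exact: bp.1.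
have bpf w : bmf (fun t => trig p (f t w)).
  exact: (bmf_section1 w (bmf_trig_field p)).
have bD w : bmf (fun t => g (f t w) - trig p (f t w)).
  have bN : bmf (fun t => -1 * trig p (f t w)) by apply: bmfM => //; exact: bmf_cst.
  by have := bmfD (bg w) bN; under eq_fun do rewrite mulN1r.
have [_ iID hD] := field_l2 mD iD2 bD.
have [_ iIp _] := field_l2 bp.1 ip2 bpf.
have hp0 : trig_mass 0 p <= e'.
  rewrite trig_mass0; have -> : \int[gamma]_x trig p x = - \int[gamma]_x ((g x - trig p x) * 1).
    by under [in RHS]eq_Rintegral do rewrite mulr1; rewrite IntB// g0 sub0r opprK.
  rewrite sqrrN; have := @Int_cauchy_schwarz _ _ _ gamma _ (fun=> 1) mD (measurable_cst _) iD2 (intble_cst gamma (1 ^+ 2)).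
  by rewrite expr1n Int_prob_cst mulr1 => /(_ ltr01) /le_trans; apply.
have hp2 : trig_mass 2 p <= e'.
  rewrite trig_mass2.
  have iph : intble gamma (fun x : MR => trig p x * hermite2 x).
    exact: intble_mul_bmf bp (intble_hermite2 R).
  have -> : \int[gamma]_x (trig p x * hermite2 x) = - \int[gamma]_x ((g x - trig p x) * hermite2 x).
    by under [in RHS]eq_Rintegral do rewrite mulrBl; rewrite IntB// g2 sub0r opprK.
  rewrite sqrrN; have := Int_cauchy_schwarz mD (intble_measurable (intble_hermite2 R)) iD2 (intble_hermite2_sqr R).
  by rewrite Int_hermite2_sqr => /(_ (ltr0Sn _ 1)); rewrite ler_pdivrMr// => h; apply: (le_trans h); rewrite ler_pM2r.
have hB : trig_cov p 1 <= 2 * v + 2 * e'.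
  rewrite trig_cov1.
  apply: (@le_trans _ _ (\int[gamma]_x (2 * g x ^+ 2 + 2 * (g x - trig p x) ^+ 2))).
    apply: Int_le => //; first by apply: intbleD; exact: intbleZ.
    by move=> x; have := sqr_ge0 (2 * g x - trig p x); nra.
  by rewrite IntD ?IntZ//; [rewrite lerD2l ler_pM2l|exact: intbleZ|exact: intbleZ].
apply: (@le_trans _ _ (\int[P]_w (2 * (\int[nu]_t trig p (f t w)) ^+ 2 +
    2 * (\int[nu]_t (g (f t w) - trig p (f t w))) ^+ 2))).
  apply: Int_le => //; first by apply: intbleD; exact: intbleZ.
  move=> w; rewrite IntB; [|exact: intble_bmf|exact: intble_bmf].
  move: (\int[nu]_t g (f t w)) (\int[nu]_t trig p (f t w)) => x y.
  by have := sqr_ge0 (2 * y - x); nra.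
rewrite IntD; [|exact: intbleZ|exact: intbleZ]; rewrite !IntZ//.
have hv := variance_trig p.
have ee : e = c * e' by rewrite /e' mulrC divfK// gt_eqF.
have e'0 : 0 < e' by rewrite divr_gt0.
rewrite ee /c; move: hp0 hp2 hB hv hD hp; clear ee; clearbody e' v.
move: (\int[P]__ _) (\int[P]__ _) (\int[gamma]__ _) => A B D hp0 hp2 hB hv hD hp.
have h1 : trig_cov p 1 * pint_excess <= (2 * v + 2 * e') * pint_excess by exact: ler_wpM2r.
have h2 : 8 * pi ^+ 2 * (2 * (trig_mass 0 p + trig_mass 2 p) + trig_cov p 1 * pint_excess) <=
  8 * pi ^+ 2 * (4 * e' + (2 * v + 2 * e') * pint_excess).
  have q0 : 0 <= 8 * pi ^+ 2 :> R by apply: mulr_ge0 => //; exact: ltW.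
  apply: (ler_wpM2l q0); lra.
have h3 : 16 * pi ^+ 2 * D <= 16 * pi ^+ 2 * e' by apply: ler_wpM2l => //; apply: mulr_ge0 => //; exact: ltW.
have p1 : 0 < pi ^+ 2 * e' by rewrite mulr_gt0.
have p2 : 0 <= pi ^+ 2 * e' * pint_excess by rewrite mulr_ge0// ltW.
have : 2 * A + 2 * B <= 16 * pi ^+ 2 * (4 * e' + (2 * v + 2 * e') * pint_excess) + 32 * pi ^+ 2 * e' by lra.
move=> h; lra.
Qed.

End variance.

(** * Chaining *)

Section chaining.
Context d (T : measurableType d) (R : realType) (P : probability T R).
Variables (Y : nat -> T -> R) (F : nat -> R) (kappa : R).
Hypothesis iY : forall i j, intble P (fun w => (Y j w - Y i w) ^+ 2).
Hypothesis EY : forall i j, (i <= j)%N ->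
  \int[P]_w (Y j w - Y i w) ^+ 2 <= kappa * (F j - F i).

(* Rademacher-Menshov chaining: [Y] at any point of [[a, a + 2 ^ K]] is reached
   from [Y a] by at most one dyadic increment per level. *)
Fixpoint chain K a (w : T) : R :=
  if K is K'.+1 then chain K' a w + chain K' (a + 2 ^ K')%N w + (Y (a + 2 ^ K')%N w - Y a w) ^+ 2
  else (Y a.+1 w - Y a w) ^+ 2.

Lemma chain_ge0 K a w : 0 <= chain K a w.
Proof. by elim: K a => [|K IH] a /=; rewrite ?addr_ge0 ?sqr_ge0. Qed.

Lemma intble_chain K a : intble P (chain K a).
Proof. by elim: K a => [|K IH] a //=; do 2 ?apply: intbleD. Qed.

(** The increments of one level cover disjoint ranges, so their bounds telescope to at most the full
    increment of F; there are K + 1 levels. *)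
Lemma Int_chain K a : \int[P]_w chain K a w <= K.+1%:R * kappa * (F (a + 2 ^ K)%N - F a).
Proof.
elim: K a => [|K IH] a /=; first by rewrite mul1r addn1; exact: EY.
rewrite IntD//; [|apply: intbleD; exact: intble_chain].
rewrite IntD; [|exact: intble_chain|exact: intble_chain].
have h1 := IH a; have h2 := IH (a + 2 ^ K)%N; have h3 := EY (leq_addr (2 ^ K) a).
have k0 : 0 <= kappa * (F (a + 2 ^ K + 2 ^ K)%N - F (a + 2 ^ K)%N).
  by apply: le_trans (EY (leq_addr (2 ^ K) (a + 2 ^ K)%N)); apply: Int_ge0 => w; exact: sqr_ge0.
rewrite expnS mul2n -addnn addnA -(natr1 K.+1).
lra.
Qed.

Lemma chain_bound K a j w : (j <= 2 ^ K)%N -> (Y (a + j)%N w - Y a w) ^+ 2 <= K.+1%:R * chain K a w.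
Proof.
elim: K a j => [|K IH] a j /=.
  case: j => [|[|//]] _; first by rewrite addn0 subrr expr0n mulr_ge0// sqr_ge0.
  by rewrite addn1 mul1r.
move=> jK; have c1 := chain_ge0 K a w; have c2 := chain_ge0 K (a + 2 ^ K)%N w.
have c3 := sqr_ge0 (Y (a + 2 ^ K)%N w - Y a w).
have n0 : 0 < K.+1%:R :> R by rewrite ltr0n.
rewrite -(natr1 K.+1).
have [jk|jk] := leqP j (2 ^ K).
  have := IH a j jk; move: (K.+1%:R : R) n0 => n n0; nra.
have jK' : (j - 2 ^ K <= 2 ^ K)%N by rewrite leq_subLR addnn -mul2n -expnS.
have := IH (a + 2 ^ K)%N _ jK'; rewrite -addnA subnKC ?(ltnW jk)//.
move: (K.+1%:R : R) n0 => n n0 h.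
set x := Y (a + j)%N w - Y (a + 2 ^ K)%N w in h.
(* The inequality used is (x + y)^2 <= (1 + 1/n) x^2 + (1 + n) y^2: one more level costs n + 1 in
   place of n. *)
set y := Y (a + 2 ^ K)%N w - Y a w in c3 *.
have -> : Y (a + j)%N w - Y a w = x + y by rewrite /x /y; ring.
have : 0 <= (x - n * y) ^+ 2 by exact: sqr_ge0.
move: (chain K a w) (chain K (a + 2 ^ K)%N w) c1 c2 h => A B c1 c2 h h4.
clearbody x y.
have h5 : n * (x + y) ^+ 2 <= n * ((n + 1) * (A + B + y ^+ 2)) by nra.
by rewrite -(ler_pM2l n0).
Qed.

End chaining.

Section markov.
Context d (T : measurableType d) (R : realType) (P : probability T R).

Lemma markov_intble (B : T -> R) (e c : R) : (forall w, 0 <= B w) -> intble P B -> 0 < e ->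
  \int[P]_w B w <= c -> (P [set w | (e <= B w)%R] <= (c / e)%:E)%E.
Proof.
move=> B0 iB e0 hc; have mB := intble_measurable iB.
have mA : measurable [set w | e <= B w].
  rewrite -[X in measurable X]setTI; exact: measurable_fun_le.
set A := [set w | e <= B w] in mA *.
have h : \int[P]_w (e * \1_A w) <= c.
  apply: le_trans hc; apply: Int_le => //.
    by apply: intble_bmf; apply: bmfM; [exact: bmf_cst|exact: bmf_indic].
  move=> w; rewrite indicE; case: (boolP (_ \in _)) => [|_]; last by rewrite mulr0.
  by rewrite inE mulr1.
rewrite IntZ in h; last by apply: intble_bmf; exact: bmf_indic.
have iA : \int[P]_w \1_A w = fine (P A) by rewrite /Rintegral integral_indic// setIT.
rewrite iA in h; rewrite -(fineK (fin_num_measure P A mA)) lee_fin.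
by rewrite ler_pdivlMr// mulrC.
Qed.

End markov.

(** * The residual process indexed by functions *)

Section process.
Context d (T : measurableType d) (R : realType) (P : probability T R).
Variables (l : nat) (a : int -> T -> R[i]).
Hypothesis l_gt0 : (0 < l)%N.
Hypothesis H : harmonic_coefficients P l a.
Local Notation MR := (measurableTypeR R).
Local Notation AT := (MR * MR)%type.
Local Notation nu := (@angle_measure R).
Local Notation gamma := (@normal_prob R 0 1).
Local Notation f := (field l a).
Local Notation H2 := (@hermite2 R).
Local Notation ex := (pint_excess R l).
Implicit Types u v : MR -> R.
Let s0 : (1 : R) != 0. Proof. exact: oner_neq0. Qed.

Definition admissible u := trig_approx u /\ bmf u.

Lemma admissible_cst c : admissible (fun=> c).
Proof. by split; [exact: trig_approx_is_trig (is_trig_cst c)|exact: bmf_cst]. Qed.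

Lemma admissible_le z : admissible (\1_(`]-oo, z]%classic : set MR)).
Proof. by split; [exact: trig_approx_le|apply: bmf_indic; exact: measurable_itv]. Qed.

Lemma admissibleB u v : admissible u -> admissible v -> admissible (fun x => u x - v x).
Proof.
move=> [t1 b1] [t2 b2]; split.
  apply: (trig_approx_eq _ (trig_approxD t1 (trig_approxZ (-1) t2))) => x.
  by rewrite mulN1r.
have := bmfD b1 (bmfM (bmf_cst _ (-1)) b2).
by congr bmf; apply/funext => x; rewrite mulN1r.
Qed.

(** The divisor 2 is the squared norm of [hermite2], so what is subtracted is the orthogonal
    projection on 1 and x^2 - 1. *)
Definition hermite_res u (x : MR) : R :=
  u x - \int[gamma]_y u y - (\int[gamma]_y (u y * H2 y)) / 2 * H2 x.

(** Indexing by functions makes S_l(z), its increments and the constants instances of one linear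
    functional; S_l(z) is its value at a half-line indicator. *)
Definition proc u (w : T) : R := Num.sqrt l%:R * \int[nu]_t hermite_res u (f t w).

Section admissible_fun.
Variable u : MR -> R.
Hypothesis au : admissible u.
Let iu : intble gamma u. Proof. exact: intble_bmf au.2. Qed.
Let iu2 : intble gamma (fun x => u x ^+ 2). Proof. exact: intble_bmf (bmfX 2 au.2). Qed.
Let iuH : intble gamma (fun x => u x * H2 x).
Proof. exact: intble_mul_bmf au.2 (intble_hermite2 R). Qed.
Let iH := intble_hermite2 R.
Let iH2 := intble_hermite2_sqr R.

Lemma trig_approx_hermite_res : trig_approx (hermite_res u).
Proof.
have := trig_approxD (trig_approxD au.1 (trig_approx_is_trig (is_trig_cst (- \int[gamma]_y u y))))
  (trig_approxZ (- ((\int[gamma]_y (u y * H2 y)) / 2)) (@trig_approx_hermite2 R)).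
by apply: trig_approx_eq => x; rewrite /hermite_res mulNr.
Qed.

Lemma bmf_hermite_res w : bmf (fun t => hermite_res u (f t w)).
Proof.
have bf := bmf_field l a w.
have bH : bmf (fun t => H2 (f t w)).
  by apply: bmfD; [exact: bmfX|exact: bmf_cst].
have bu : bmf (fun t => u (f t w)) by exact: (bmf_comp au.2 bf.1).
have := bmfD (bmfD bu (bmf_cst _ (- \int[gamma]_y u y)))
  (bmfM (bmf_cst _ (- ((\int[gamma]_y (u y * H2 y)) / 2))) bH).
by congr bmf; apply/funext => t; rewrite /hermite_res mulNr.
Qed.

Let iresA : intble gamma (fun x => u x - \int[gamma]_y u y).
Proof. by apply: intbleB => //; exact: intble_cst. Qed.

Let iresB : intble gamma (fun x => (\int[gamma]_y (u y * H2 y)) / 2 * H2 x).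
Proof. exact: intbleZ. Qed.

Lemma Int_hermite_res : \int[gamma]_x hermite_res u x = 0.
Proof.
rewrite /hermite_res IntB// IntB//; last exact: intble_cst.
by rewrite Int_prob_cst IntZ// Int_hermite2 mulr0 subrr subr0.
Qed.

Lemma Int_hermite_res_hermite2 : \int[gamma]_x (hermite_res u x * H2 x) = 0.
Proof.
set c := \int[gamma]_y u y; set e := \int[gamma]_y (u y * H2 y).
transitivity (\int[gamma]_x (u x * H2 x - (c * H2 x + e / 2 * H2 x ^+ 2))).
  by apply: eq_Rintegral => x _; rewrite /hermite_res -/c -/e; ring.
rewrite IntB//; last by apply: intbleD; exact: intbleZ.
rewrite IntD; [|exact: intbleZ|exact: intbleZ].
by rewrite !IntZ// Int_hermite2 Int_hermite2_sqr -/e mulr0 add0r divfK ?subrr// pnatr_eq0.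
Qed.

(** Pythagoras: the residual is orthogonal to what was subtracted. *)
Lemma Int_hermite_res_sqr : \int[gamma]_x hermite_res u x ^+ 2 <= \int[gamma]_x u x ^+ 2.
Proof.
set c := \int[gamma]_y u y; set e := \int[gamma]_y (u y * H2 y).
have h0 := Int_hermite_res; have h2 := Int_hermite_res_hermite2.
have [mr ir2 _] := trig_approx_hermite_res.
have ir1 : intble gamma (hermite_res u) := intble_sqr_intble mr ir2.
have irH : intble gamma (fun x => hermite_res u x * H2 x).
  by apply: intble_mul => //; exact: intble_measurable iH.
have : 0 <= \int[gamma]_x (c + e / 2 * H2 x) ^+ 2 by apply: Int_ge0 => x; exact: sqr_ge0.
have icH : intble gamma (fun x : MR => (c + e / 2 * H2 x) ^+ 2).
  have : intble gamma (fun x : MR => c ^+ 2 + (e * c * H2 x + e ^+ 2 / 4 * H2 x ^+ 2)).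
    by apply: intbleD; [exact: intble_cst|apply: intbleD; exact: intbleZ].
  by apply: intble_eq => x; field.
have -> : \int[gamma]_x u x ^+ 2 = \int[gamma]_x (hermite_res u x ^+ 2 + ((c + e / 2 * H2 x) ^+ 2
    + (2 * c * hermite_res u x + e * (hermite_res u x * H2 x)))).
  by apply: eq_Rintegral => x _; rewrite /hermite_res -/c -/e; field.
rewrite IntD//; last by apply: intbleD => //; apply: intbleD; exact: intbleZ.
rewrite IntD//; last by apply: intbleD; exact: intbleZ.
rewrite IntD; [|exact: intbleZ|exact: intbleZ].
by rewrite !IntZ// h0 h2 !mulr0 !addr0 lerDl.
Qed.

Lemma intble_proc_sqr : intble P (fun w => proc u w ^+ 2).
Proof.
have [mr ir2 _] := trig_approx_hermite_res.
have [_ i _] := field_l2 H mr ir2 bmf_hermite_res.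
apply: (intble_eq _ (intbleZ l%:R i)) => w.
by rewrite /proc exprMn sqr_sqrtr.
Qed.

Lemma measurable_proc : measurable_fun setT (proc u).
Proof.
have [mr ir2 _] := trig_approx_hermite_res.
have [m _ _] := field_l2 H mr ir2 bmf_hermite_res.
exact: measurable_funM.
Qed.

Lemma Int_proc_sqr : \int[P]_w proc u w ^+ 2 <=
  l%:R * (32 * pi ^+ 2 * ex) * \int[gamma]_x u x ^+ 2.
Proof.
have [mr ir2 _] := trig_approx_hermite_res.
have [_ i _] := field_l2 H mr ir2 bmf_hermite_res.
have v := variance_approx l_gt0 H trig_approx_hermite_res bmf_hermite_res
  Int_hermite_res Int_hermite_res_hermite2.
have -> : \int[P]_w proc u w ^+ 2 = l%:R * \int[P]_w (\int[nu]_t hermite_res u (f t w)) ^+ 2.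
  by rewrite -IntZ//; apply: eq_Rintegral => w _; rewrite /proc exprMn sqr_sqrtr.
rewrite -[leRHS]mulrA; apply: ler_wpM2l => //; apply: (le_trans v).
apply: ler_wpM2l; last exact: Int_hermite_res_sqr.
by rewrite mulr_ge0// ?addr_ge0// mulr_ge0// sqr_ge0.
Qed.

Lemma procE w : proc u w = Num.sqrt l%:R * (\int[nu]_t u (f t w) - 4 * pi * \int[gamma]_x u x
  - (\int[gamma]_x (u x * H2 x)) / 2 * \int[nu]_t H2 (f t w)).
Proof.
have bf := bmf_field l a w.
have bH : bmf (fun t => H2 (f t w)) by apply: bmfD; [exact: bmfX|exact: bmf_cst].
have bu : bmf (fun t => u (f t w)) by exact: (bmf_comp au.2 bf.1).
rewrite /proc /hermite_res; congr (_ * _).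
rewrite IntB; first last.
- by apply: intbleZ; exact: intble_bmf.
- by apply: intbleB; [exact: intble_bmf|exact: intble_cst].
rewrite IntB; [|exact: intble_bmf|exact: intble_cst].
rewrite IntZ; last exact: intble_bmf.
rewrite Rintegral_cst//; have /= -> := angle_measureT R.
by rewrite /fine (mulrC (\int[gamma]_y u y)).
Qed.

End admissible_fun.

Lemma procB u v w : admissible u -> admissible v ->
  proc (fun x => u x - v x) w = proc u w - proc v w.
Proof.
move=> au av; rewrite !procE//; last exact: admissibleB.
have bf := bmf_field l a w.
have bu : bmf (fun t => u (f t w)) by exact: (bmf_comp au.2 bf.1).
have bv : bmf (fun t => v (f t w)) by exact: (bmf_comp av.2 bf.1).
have -> : \int[nu]_t (u (f t w) - v (f t w)) = \int[nu]_t u (f t w) - \int[nu]_t v (f t w).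
  by apply: IntB; exact: intble_bmf.
have -> : \int[gamma]_x (u x - v x) = \int[gamma]_x u x - \int[gamma]_x v x.
  by apply: IntB; apply: intble_bmf; [exact: au.2|exact: av.2].
have -> : \int[gamma]_x ((u x - v x) * H2 x) = \int[gamma]_x (u x * H2 x) - \int[gamma]_x (v x * H2 x).
  rewrite -IntB; [|exact: intble_mul_bmf au.2 (intble_hermite2 R)|exact: intble_mul_bmf av.2 (intble_hermite2 R)].
  by apply: eq_Rintegral => x _; rewrite mulrBl.
by field.
Qed.

Lemma proc_cst c w : proc (fun=> c) w = 0.
Proof.
rewrite procE; last exact: admissible_cst.
rewrite IntZ; last exact: intble_hermite2.
rewrite Int_hermite2 mulr0 !mul0r subr0 Int_prob_cst Rintegral_cst//.
have /= -> := angle_measureT R; rewrite /fine.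
by rewrite (mulrC c) subrr mulr0.
Qed.

(** The integral of u along the field is nonnegative, so only the two compensators can pull the
    value down. The mean is at most e^2; half the Hermite coefficient is at most e, by
    Cauchy-Schwarz and u^2 <= u. *)
Lemma proc_lower u (e : R) w : admissible u -> (forall x, 0 <= u x <= 1) -> 0 <= e ->
  \int[gamma]_x u x <= e ^+ 2 ->
  - (Num.sqrt l%:R * (4 * pi * e ^+ 2 + e * `|\int[nu]_t H2 (f t w)|)) <= proc u w.
Proof.
move=> au u01 e0 ue; rewrite procE// -mulrN; apply: ler_wpM2l; first exact: sqrtr_ge0.
have nu0 : 0 <= \int[nu]_t u (f t w).
  by apply: Int_ge0 => t; have /andP[] := u01 (f t w).
have iu2 : intble gamma (fun x => u x ^+ 2) := intble_bmf gamma (bmfX 2 au.2).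
have iu : intble gamma u := intble_bmf gamma au.2.
have := Int_cauchy_schwarz au.2.1 (intble_measurable (intble_hermite2 R)) iu2 (intble_hermite2_sqr R).
rewrite Int_hermite2_sqr => /(_ (ltr0Sn _ 1)).
set I := \int[gamma]_x (u x * H2 x) => cs.
have u2 : \int[gamma]_x u x ^+ 2 <= \int[gamma]_x u x.
  by apply: Int_le => // x; have /andP[h1 h2] := u01 x; rewrite expr2 ler_piMr.
have I2 : `|I| / 2 <= e.
  rewrite -(@ler_pXn2r _ 2)// ?nnegrE ?divr_ge0//.
  rewrite exprMn real_normK ?num_real//.
  move: cs u2 ue; move: (\int[gamma]_x u x ^+ 2) (\int[gamma]_x u x) => A B cs u2 ue.
  have : (2^-1 : R) ^+ 2 = 4^-1 by rewrite exprVn -natrX.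
  by move=> ->; have := sqr_ge0 e; lra.
have p0 : 0 <= 4 * pi :> R by rewrite mulr_ge0// pi_ge0.
have hI : I / 2 * \int[nu]_t H2 (f t w) <= e * `|\int[nu]_t H2 (f t w)|.
  apply: (le_trans (ler_norm _)); rewrite normrM; apply: ler_wpM2r => //.
  by rewrite normrM [X in _ * X]ger0_norm.
move: nu0 hI (ler_wpM2l p0 ue).
clearbody I.
move: (\int[nu]_t u (f t w)) (\int[gamma]_x u x) (\int[nu]_t H2 (f t w)) => A B C.
lra.
Qed.

(** [proc_lower] for v - u bounds the value at v from below by that at u, and for u' - v from above
    by that at u'. This is how monotonicity controls the process between grid points. *)
Lemma proc_sandwich u v u' (e M : R) w : admissible u -> admissible v -> admissible u' ->
  (forall x, 0 <= u x <= v x /\ v x <= u' x <= 1) -> 0 <= e ->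
  \int[gamma]_x (u' x - u x) <= e ^+ 2 -> `|proc u w| <= M -> `|proc u' w| <= M ->
  `|proc v w| <= M + Num.sqrt l%:R * (4 * pi * e ^+ 2 + e * `|\int[nu]_t H2 (f t w)|).
Proof.
move=> au av au' uv e0 he.
have intle u1 v1 : admissible u1 -> admissible v1 -> (forall x, u1 x <= v1 x) ->
  \int[gamma]_x u1 x <= \int[gamma]_x v1 x.
  by move=> a1 a2 h; apply: Int_le => //; apply: intble_bmf; [exact: a1.2|exact: a2.2].
have l1 : forall x, 0 <= u' x - v x <= 1.
  by move=> x; have [/andP[h1 h2] /andP[h3 h4]] := uv x; apply/andP; split; lra.
have l2 : forall x, 0 <= v x - u x <= 1.
  by move=> x; have [/andP[h1 h2] /andP[h3 h4]] := uv x; apply/andP; split; lra.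
have := @proc_lower _ e w (admissibleB au' av) l1 e0.
have := @proc_lower _ e w (admissibleB av au) l2 e0.
rewrite !procB//; move: (Num.sqrt _ * _) => E.
have b1 : \int[gamma]_x (v x - u x) <= e ^+ 2.
  apply: le_trans he; apply: intle; try exact: admissibleB.
  by move=> x; have [_ /andP[h3 _]] := uv x; rewrite lerD2r.
have b2 : \int[gamma]_x (u' x - v x) <= e ^+ 2.
  apply: le_trans he; apply: intle; try exact: admissibleB.
  by move=> x; have [/andP[_ h3] _] := uv x; rewrite lerD2l lerN2.
move=> /(_ b1) + /(_ b2); move: (proc v w) (proc u w) (proc u' w) => x y z h1 h2.
rewrite !ler_norml => /andP[h3 h4] /andP[h5 h6].
by apply/andP; split; lra.
Qed.

Lemma S_processE z w : S_process l a z w = proc (\1_(`]-oo, z]%classic : set MR)) w.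
Proof.
have bf := bmf_field l a w.
have mI : measurable (`]-oo, z]%classic : set MR) by exact: measurable_itv.
rewrite procE; last exact: admissible_le.
rewrite (_ : \int[gamma]_x (_ * H2 x) = J2 z); last first.
  by rewrite /J2 -Int_hermite2_le; apply: eq_Rintegral => x _; rewrite mulrC.
have me := measurable_eigenfield l a w.
have -> : \int[gamma]_x \1_(`]-oo, z]%classic : set MR) x = std_normal_cdf z.
  by rewrite /std_normal_cdf /Rintegral integral_indic// setIT.
rewrite /S_process /empirical_process /h2.
rewrite (integral_surface_area (f := fun x => eigenfield l a w x ^+ 2 - 1)); first last.
- by apply: intble_bmf; apply: bmfD; [exact: (bmfX 2 bf)|exact: bmf_cst].
- by apply: measurable_funB => //; exact: measurable_funX.
have mA : measurable [set y | eigenfield l a w y <= z].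
  rewrite -[X in measurable X]setTI; exact: measurable_fun_le.
rewrite integral_surface_area; first last.
- by apply: intble_bmf; apply: (bmf_comp (bmf_indic _ mA)); exact: measurable_sph.
- exact: measurable_indic.
have -> : \int[nu]_t \1_[set y | eigenfield l a w y <= z] (spherical_coord t) =
   \int[nu]_t \1_(`]-oo, z]%classic : set MR) (f t w).
  by apply: eq_Rintegral => t _; rewrite !indicE; congr (nat_of_bool _)%:R; rewrite mem_setE in_itv/= [LHS]asboolE /field.
rewrite /hermite2 /field; ring.
Qed.

Lemma Int_indic_gap z z' : z <= z' ->
  \int[gamma]_x (\1_(`]-oo, z']%classic : set MR) x - \1_(`]-oo, z]%classic : set MR) x) <= z' - z.
Proof.
move=> zz; pose A : set MR := `]z, z']%classic.
have mA : measurable A by exact: measurable_itv.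
have -> : \int[gamma]_x (\1_(`]-oo, z']%classic : set MR) x - \1_(`]-oo, z]%classic : set MR) x) = fine (gamma A).
  rewrite -[RHS](_ : \int[gamma]_x \1_A x = _); last by rewrite /Rintegral integral_indic// setIT.
  apply: eq_Rintegral => x _; rewrite !indicE !mem_setE !in_itv/=.
  have [xz|zx] := leP x z; first by rewrite (le_trans xz zz) subrr.
  by rewrite subr0.
have h : (gamma A <= (z' - z)%:E)%E.
  rewrite /normal_prob; apply: (@le_trans _ _ (\int[lebesgue_measure]_(x in A) (cst 1%:E x))%E).
    apply: ge0_le_integral => //.
    - by move=> x _; rewrite lee_fin normal_pdf_ge0.
    - by apply/measurable_EFinP; apply: measurable_funTS; exact: measurable_normal_pdf.
    - move=> x _; rewrite lee_fin; apply: (le_trans (normal_pdf_ub 0 x s0)).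
      have p2 : 1 <= 1 ^+ 2 * pi *+ 2 :> R.
        by rewrite expr1n mul1r mulr2n; have := pi_ge2 R; lra.
      have p1 : 1 <= Num.sqrt (1 ^+ 2 * pi *+ 2) :> R by rewrite -[leLHS]sqrtr1 ler_wsqrtr.
      by rewrite /normal_peak invf_le1//; exact: lt_le_trans p1.
  rewrite integral_cst// mul1e; have /= -> := @lebesgue_measure_itv R `]z, z'].
  by rewrite lte_fin; case: ltP => // _; rewrite lee_fin subr_ge0.
by rewrite -lee_fin fineK// fin_num_measure.
Qed.

Let sqr_std : intble gamma (fun x : MR => x ^+ 2) /\ \int[gamma]_x x ^+ 2 = 1.
Proof.
have i : intble gamma (fun x : MR => x ^+ 2).
  have := intbleD (intble_hermite2 R) (intble_cst gamma 1).
  by apply: intble_eq => x; rewrite /hermite2 subrK.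
split => //; have h := Rintegral_normal_sqr 0 s0; rewrite expr1n in h.
transitivity (\int[gamma]_x (x - 0) ^+ 2); last exact: h.
by apply: eq_Rintegral => x _; rewrite subr0.
Qed.

(** Chebyshev's inequality in integral form: the standard normal law has second moment 1. *)
Lemma Int_tail u (r : R) : admissible u -> 0 < r ->
  (forall x, u x <= x ^+ 2 / r ^+ 2) -> \int[gamma]_x u x <= (r ^+ 2)^-1.
Proof.
move=> [_ bu] r0 h; have [i2 e2] := sqr_std.
have := IntZ (r ^+ 2)^-1 i2; rewrite e2 mulr1 => <-; apply: Int_le => //.
- exact: intble_bmf.
- exact: intbleZ.
- by move=> x; rewrite mulrC.
Qed.

(** Approaching z from the right makes the indicators of closed half-lines converge at every point;
    dominated convergence does the rest. *)
Lemma proc_right_cvg (q : nat -> R) z w : (forall n, z <= q n) -> q n @[n --> \oo] --> z ->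
  proc (\1_(`]-oo, q n]%classic : set MR)) w @[n --> \oo] --> proc (\1_(`]-oo, z]%classic : set MR)) w.
Proof.
move=> zq qz.
have mI y : measurable (`]-oo, y]%classic : set MR) by exact: measurable_itv.
have pt (x : R) : (\1_(`]-oo, q n]%classic : set MR) x : R) @[n --> \oo] --> (\1_(`]-oo, z]%classic : set MR) x : R).
  apply: cvg_near_cst; rewrite indicE mem_setE in_itv/=.
  have [xz|zx] := leP x z.
    by apply: nearW => n; rewrite indicE mem_setE in_itv/= (le_trans xz).
  have [N _ hN] := cvgr_lt z qz x zx; exists N => // n /= /hN /= qx.
  by rewrite indicE mem_setE in_itv/= leNgt qx.
have ind1 (y x : R) : `|\1_(`]-oo, y]%classic : set MR) x| <= 1 :> R.
  by rewrite indicE; case: (_ \in _); rewrite ?normr1 ?normr0.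
have bf := bmf_field l a w.
have E n := procE (admissible_le (q n)) w.
rewrite (procE (admissible_le z)); under eq_fun do rewrite E.
apply: cvgM; first exact: cvg_cst.
apply: cvgB; last first.
  apply: cvgM; last exact: cvg_cst.
  apply: cvgM; last exact: cvg_cst.
  have [||||_] := @Rintegral_dct _ _ _ gamma (fun n (x : MR) => \1_(`]-oo, q n]%classic : set MR) x * H2 x)
    (fun x => \1_(`]-oo, z]%classic : set MR) x * H2 x) (fun x => `|H2 x|).
  - by move=> n; apply: measurable_funM; [exact: measurable_indic|exact: intble_measurable (intble_hermite2 R)].
  - by move=> x; apply: cvgM; [exact: pt|exact: cvg_cst].
  - exact: integrable_abse (intble_hermite2 R).
  - by move=> n x; rewrite normrM ler_piMl.
  by [].
apply: cvgB.
  have [||||_] := @Rintegral_dct _ _ _ nu (fun n t => \1_(`]-oo, q n]%classic : set MR) (f t w))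
    (fun t => \1_(`]-oo, z]%classic : set MR) (f t w)) (fun=> 1).
  - by move=> n; apply: (bmf_comp (bmf_indic _ (mI (q n)))  bf.1).1.
  - by move=> t; exact: pt.
  - exact: intble_cst.
  - by move=> n t.
  by [].
apply: cvgM; first exact: cvg_cst.
have [||||_] := @Rintegral_dct _ _ _ gamma (fun n (x : MR) => \1_(`]-oo, q n]%classic : set MR) x)
  (fun x => \1_(`]-oo, z]%classic : set MR) x) (fun=> 1).
- by move=> n; exact: measurable_indic.
- by move=> x; exact: pt.
- exact: intble_cst.
- by move=> n x.
by [].
Qed.

(** The supremum runs over an uncountable set; by right continuity in z, every excess over eps is
    already witnessed at a rational level. *)
Lemma measurable_sup_S (eps : R) : measurable [set w | (eps%:E < sup_S l a w)%E].
Proof.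
have -> : [set w | (eps%:E < sup_S l a w)%E] =
    \bigcup_(q : rat) [set w | eps < `|proc (\1_(`]-oo, ratr q]%classic : set MR)) w|].
  apply/seteqP; split => w /=; last first.
    move=> [q _ /= h]; apply: (@lt_le_trans _ _ (`|S_process l a (ratr q) w|%:E)).
      by rewrite lte_fin S_processE.
    by apply: ereal_sup_ubound; exists (ratr q).
  move=> /ereal_sup_gt[_ [z _ <-]]; rewrite lte_fin S_processE => h.
  have qn n : {q : rat | z < ratr q < z + n.+1%:R^-1}.
    have : z < z + n.+1%:R^-1 by rewrite ltrDl invr_gt0.
    by move=> /rat_in_itvoo/cid[q]; rewrite in_itv/=; exists q.
  pose q n : R := ratr (sval (qn n)).
  have q1 n : z <= q n by rewrite /q; case: (qn n) => q' /= /andP[/ltW].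
  have qz : q n @[n --> \oo] --> z.
    have c : z + n.+1%:R^-1 @[n --> \oo] --> (z + 0 : R).
      by apply: cvgD; [exact: cvg_cst|exact: cvg_harmonic].
    rewrite addr0 in c; apply: (squeeze_cvgr _ (@cvg_cst _ _ _ _ _) c).
    apply: nearW => n; rewrite q1/=.
    by rewrite /q; case: (qn n) => q' /= /andP[_ /ltW].
  have := cvgr_gt _ (cvg_norm (@proc_right_cvg q z w q1 qz)) _ h.
  by case=> N _ /(_ N (leqnn N)) /= hN; exists (sval (qn N)).
apply: bigcupT_measurable_rat => q.
rewrite -[X in measurable X]setTI.
have m : measurable_fun setT (fun w => `|proc (\1_(`]-oo, ratr q]%classic : set MR)) w|).
  apply: measurableT_comp => //; exact: measurable_proc (admissible_le _).
have := m measurableT _ (measurable_itv `]eps, +oo[).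
by congr (measurable (_ `&` _)); apply/seteqP; split => w; rewrite /= in_itv/= andbT.
Qed.

End process.

(** * The grid of levels and Markov's inequality *)

Section tail_bound.
Context d (T : measurableType d) (R : realType) (P : probability T R).
Variables (l : nat) (a : int -> T -> R[i]).
Hypothesis l_gt1 : (1 < l)%N.
Hypothesis H : harmonic_coefficients P l a.
Local Notation MR := (measurableTypeR R).
Local Notation AT := (MR * MR)%type.
Local Notation nu := (@angle_measure R).
Local Notation gamma := (@normal_prob R 0 1).
Local Notation f := (field l a).
Local Notation H2 := (@hermite2 R).
Local Notation ex := (pint_excess R l).
Local Notation Lr := (l%:R : R).
Local Notation proc := (proc l a).
Let l_gt0 : (0 < l)%N. Proof. exact: ltnW. Qed.
Let Lr0 : 0 < Lr. Proof. by rewrite ltr0n. Qed.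
Let k := up_log 2 l.
(** Since 2^k >= l, this gives 2^K >= 4 l^3, enough indices to cover [-l, l] with mesh l^-2. *)
Let K := (3 * k + 2)%N.
Let N := (2 ^ K)%N.
Let kappa : R := Lr * (32 * pi ^+ 2 * ex).

Let z (i : nat) : R := - Lr + i.-1%:R / Lr ^+ 2.

(** The ends are padded by the constants 0 and 1, at which the process vanishes: chaining starts
    from 0, and the Gaussian mean grows from 0 to 1. The levels hence start at index 1, which
    explains [i.-1] in [z]. *)
Let u (i : nat) : MR -> R :=
  if i is 0 then fun=> 0 else if (i < N)%N then \1_(`]-oo, z i]%classic : set MR) else fun=> 1.

Let N_ge : 2 * Lr ^+ 3 + 2 <= N%:R.
Proof.
have h : (4 * l ^ 3 <= N)%N.
  rewrite /N /K expnD mulnC (mulnC 3) expnM leq_mul// leq_exp2r//.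
  exact: up_logP.
apply: (@le_trans _ _ (4 * l ^ 3)%N%:R); last by rewrite ler_nat.
rewrite natrM natrX; have : 1 <= Lr ^+ 3 by rewrite exprn_ege1// ler1n.
lra.
Qed.

Let N_gt1 : (1 < N)%N.
Proof.
rewrite -(ltr_nat R); apply: lt_le_trans N_ge.
have : 0 < Lr ^+ 3 by rewrite exprn_gt0.
lra.
Qed.

Let z_nd i j : (i <= j)%N -> z i <= z j.
Proof.
move=> ij; rewrite /z lerD2l ler_pM2r ?invr_gt0 ?exprn_gt0// ler_nat.
by case: i j ij => [|i] [|j].
Qed.

Let adm i : admissible (u i).
Proof.
rewrite /u; case: i => [|i]; first exact: admissible_cst.
by case: ifP => _; [exact: admissible_le|exact: admissible_cst].
Qed.

Let u01 i x : 0 <= u i x <= 1.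
Proof.
rewrite /u; case: i => [|i]; first by rewrite lexx ler01.
case: ifP => _; last by rewrite lexx ler01.
by rewrite indicE; case: (_ \in _); rewrite !lexx ?ler01.
Qed.

Let u_nd i j x : (i <= j)%N -> u i x <= u j x.
Proof.
case: i => [|i]; first by move=> _; have /andP[] := u01 j x.
case: j => [//|j] ij; rewrite {2}/u; case: ifP => jN; last by have /andP[] := u01 i.+1 x.
rewrite /u (leq_ltn_trans ij jN) !indicE !mem_setE !in_itv/= ler_nat.
by have [xz|//] := leP x (z i.+1); rewrite (le_trans xz)// z_nd.
Qed.

Let Y i w := proc (u i) w.
Let F i : R := \int[gamma]_x u i x.

Let YB i j w : Y j w - Y i w = proc (fun x => u j x - u i x) w.
Proof. by rewrite /Y -(procB l a w (adm j) (adm i)). Qed.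

Let iY i j : intble P (fun w => (Y j w - Y i w) ^+ 2).
Proof.
under eq_fun do rewrite YB.
by apply: (intble_proc_sqr H); apply: admissibleB.
Qed.

Let iu i : intble gamma (u i). Proof. exact: intble_bmf (adm i).2. Qed.

Let kappa0 : 0 <= kappa.
Proof. by rewrite mulr_ge0// mulr_ge0// ?addr_ge0// mulr_ge0// sqr_ge0. Qed.

(** Differences of the nested functions lie in [0, 1] and dominate their own squares, which gives
    the additive bound that chaining requires. *)
Let EY i j : (i <= j)%N -> \int[P]_w (Y j w - Y i w) ^+ 2 <= kappa * (F j - F i).
Proof.
move=> ij; under eq_Rintegral do rewrite YB.
have aB := admissibleB (adm j) (adm i).
apply: (le_trans (Int_proc_sqr l_gt0 H aB)); apply: ler_wpM2l; first exact: kappa0.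
rewrite /F -IntB//; apply: Int_le.
- exact: intble_bmf (bmfX 2 aB.2).
- exact: intble_bmf aB.2.
move=> x; have := u_nd x ij; have /andP[h1 h2] := u01 i x; have /andP[h3 h4] := u01 j x.
move=> h5; rewrite expr2 ler_piMr; lra.
Qed.

(** Inner cells have length l^-2 and the normal density is at most 1. The two end cells lie beyond
    -l and l, where Chebyshev's inequality gives the same bound. *)
Let gap i : (i < N)%N -> \int[gamma]_x (u i.+1 x - u i x) <= (Lr ^+ 2)^-1.
Proof.
have sq (x : R) : Lr <= `|x| -> 1 <= x ^+ 2 / Lr ^+ 2.
  move=> h; rewrite ler_pdivlMr ?exprn_gt0// mul1r -[x ^+ 2]real_normK ?num_real//.
  by rewrite lerXn2r// nnegrE ltW.
move=> iN; have [->|i0] := eqVneq i 0%N.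
  apply: Int_tail => //; first exact: admissibleB.
  move=> x; rewrite /u N_gt1 subr0 indicE mem_setE in_itv/= /z/= mul0r addr0.
  case: (leP x (- Lr)) => /= xL; last by rewrite mulr_ge0// ?sqr_ge0// invr_ge0 sqr_ge0.
  by apply: sq; rewrite ler_normr lerNr xL orbT.
have [iN1|iN1] := ltnP i.+1 N; last first.
  apply: Int_tail => //; first exact: admissibleB.
  move=> x; rewrite {1}/u ltnNge iN1/= /u.
  case: i iN i0 iN1 => // i iN _ iN1; rewrite iN indicE mem_setE in_itv/=.
  case: (leP x _) => /= xz; first by rewrite subrr mulr_ge0// ?sqr_ge0// invr_ge0 sqr_ge0.
  rewrite subr0; apply: sq; rewrite ler_normr; apply/orP; left; apply: le_trans (ltW xz).
  (* The last level is -l + (N - 2) / l^2, which [N_ge] makes at least l. *)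
  have iE : N = i.+2 by apply/eqP; rewrite eqn_leq iN1.
  have NN := N_ge; rewrite iE in NN.
  rewrite [z i.+1]/z/= -lerBlDl opprK ler_pdivlMr ?exprn_gt0//; move: NN.
  rewrite -(natr1 i.+1) -(natr1 i); lra.
case: i iN i0 iN1 => // i iN _ iN1; rewrite /u iN iN1.
apply: (le_trans (Int_indic_gap (z_nd (leqnSn _)))).
rewrite /z/= -(natr1 i); lra.
Qed.

Let find_cell (y : R) : exists i, (i < N)%N /\ forall x, u i x <= \1_(`]-oo, y]%classic : set MR) x <= u i.+1 x.
Proof.
have i01 (x : R) : 0 <= (\1_(`]-oo, y]%classic : set MR) x : R) <= 1.
  by rewrite indicE; case: (_ \in _); rewrite !lexx ?ler01.
have step m : (m < N)%N -> (forall x, u m x <= \1_(`]-oo, y]%classic : set MR) x) \/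
   exists i, (i < N)%N /\ forall x, u i x <= \1_(`]-oo, y]%classic : set MR) x <= u i.+1 x.
  elim: m => [|m IH] mN; first by left => x; rewrite /u; have /andP[] := i01 x.
  have [h|] := IH (ltnW mN); last by right.
  have [zy|yz] := leP (z m.+1) y.
    left=> x; rewrite /u mN !indicE !mem_setE !in_itv/= ler_nat.
    by case: (leP x (z m.+1)) => // xz; rewrite (le_trans xz).
  right; exists m; split; first exact: ltnW.
  move=> x; rewrite h/= /u mN !indicE !mem_setE !in_itv/= ler_nat.
  by case: (leP x y) => // xy; rewrite (le_trans xy)// ltW.
have N1 : (N.-1 < N)%N by rewrite prednK// ltnW.
have [h|//] := step _ N1; exists N.-1; split => // x.
rewrite h/= prednK ?(ltnW N_gt1)// /u; case: N N_gt1 => // n _; rewrite ltnn.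
by have /andP[] := i01 x.
Qed.

Let h w := \int[nu]_t H2 (f t w).
Let W := chain Y K 0.
(** The square of a sum of three terms is at most three times the sum of their squares; the terms
    are the chaining bound and the two errors 4 pi sqrt(l) / l^2 and |h| / sqrt(l) between grid
    points. *)
Let B w := 3 * (K.+1%:R * W w) + 3 * (16 * pi ^+ 2 / Lr ^+ 3) + 3 * (h w ^+ 2 / Lr).

Let Y_bound i w : (i <= N)%N -> Y i w ^+ 2 <= K.+1%:R * W w.
Proof.
move=> iN; have := @chain_bound _ T R Y K 0 i w iN.
by rewrite add0n /(Y 0%N) /u proc_cst subr0.
Qed.

Let sup_S_bound w (eps : R) : 0 < eps -> (eps%:E < sup_S l a w)%E -> eps ^+ 2 <= B w.
Proof.
move=> eps0 /ereal_sup_gt[_ [y _ <-]]; rewrite lte_fin (S_processE) => epsy.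
have W0 : 0 <= K.+1%:R * W w by rewrite mulr_ge0// chain_ge0.
have [i [iN ui]] := find_cell y.
pose M := Num.sqrt (K.+1%:R * W w).
have YM j : (j <= N)%N -> `|Y j w| <= M.
  by move=> jN; rewrite -sqrtr_sqr ler_wsqrtr// Y_bound.
have Li0 : 0 <= Lr^-1 by rewrite invr_ge0 ltW.
have g := gap iN; rewrite -exprVn in g.
have := @proc_sandwich _ _ R l a (u i) (\1_(`]-oo, y]%classic : set MR)) (u i.+1) Lr^-1 M w
  (adm i) (admissible_le _) (adm i.+1) _ Li0 g (YM i (ltnW iN)) (YM i.+1 iN).
move=> /(_ _) sw; have {}sw := sw _; move: sw => /(_ ltac:(move=> x; split;
  [have /andP[-> _] := u01 i x; have /andP[-> _] := ui x|have /andP[_ ->] := ui x; have /andP[_ ->] := u01 i.+1 x])) sw.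
have {sw} := lt_le_trans epsy (sw isT isT).
rewrite -/(h w) => epsM.
have M2 : M ^+ 2 = K.+1%:R * W w by rewrite sqr_sqrtr.
have S2 : Num.sqrt Lr ^+ 2 = Lr by rewrite sqr_sqrtr// ltW.
pose A := Num.sqrt Lr * (4 * pi * Lr^-1 ^+ 2); pose D := Num.sqrt Lr * (Lr^-1 * `|h w|).
have A2 : A ^+ 2 = 16 * pi ^+ 2 / Lr ^+ 3.
  rewrite /A exprMn S2; field; exact: lt0r_neq0.
have D2 : D ^+ 2 = h w ^+ 2 / Lr.
  rewrite /D exprMn S2 exprMn real_normK ?num_real//; field; exact: lt0r_neq0.
rewrite /B -M2 -A2 -D2; rewrite mulrDr -/A -/D in epsM.
have : eps ^+ 2 <= (M + (A + D)) ^+ 2 by rewrite lerXn2r ?nnegrE ?ltW// (lt_trans eps0).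
clearbody M A D.
have e1 := sqr_ge0 (M - A); have e2 := sqr_ge0 (M - D); have e3 := sqr_ge0 (A - D).
lra.
Qed.

(** Markov's inequality for [B]. The constant 96 is 3 times 16 times 2, the 2 being the squared norm
    of x^2 - 1. *)
Lemma sup_S_tail (eps : R) : 0 < eps ->
  (P [set w | (eps%:E < sup_S l a w)%E] <=
   ((3 * (K.+1%:R ^+ 2 * kappa) + 48 * pi ^+ 2 / Lr ^+ 3 + 96 * pi ^+ 2 / Lr) / eps ^+ 2)%:E)%E.
Proof.
move=> eps0; have e2 : 0 < eps ^+ 2 by rewrite exprn_gt0.
have mh := intble_measurable (intble_hermite2 R).
have [_ ih hh] := field_l2 H mh (intble_hermite2_sqr R)
  (fun w => bmfD (bmfX 2 (bmf_field l a w)) (bmf_cst _ (-1))).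
have iW : intble P W by exact: intble_chain.
have iB1 : intble P (fun w => K.+1%:R * W w) by exact: intbleZ.
have iB3 : intble P (fun w => h w ^+ 2 / Lr).
  by apply: (intble_eq _ (intbleZ Lr^-1 ih)) => w; rewrite mulrC.
have iB : intble P B.
  by apply: intbleD; [apply: intbleD; [exact: intbleZ|exact: intble_cst]|exact: intbleZ].
have B0 w : 0 <= B w.
  rewrite /B; apply: addr_ge0; [apply: addr_ge0|]; apply: mulr_ge0 => //.
  - by apply: mulr_ge0 => //; exact: chain_ge0.
  - by apply: divr_ge0; [apply: mulr_ge0 => //; exact: sqr_ge0|apply: exprn_ge0; exact: ltW].
  - by apply: divr_ge0; [exact: sqr_ge0|exact: ltW].
have mB := intble_measurable iB.
apply: (@le_trans _ _ (P [set w | (eps ^+ 2 <= B w)%R])).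
  apply: le_measure.
  - by rewrite inE; exact: (measurable_sup_S H).
  - by rewrite inE -[X in measurable X]setTI; exact: measurable_fun_le.
  - by move=> w; exact: sup_S_bound.
apply: markov_intble => //.
have F01 : F (0 + N)%N - F 0%N = 1.
  rewrite add0n /F /u; case: N N_gt1 => // n _; rewrite ltnn !Int_prob_cst subr0 //.
have hW : \int[P]_w W w <= K.+1%:R * kappa.
  by have := Int_chain iY EY K 0; rewrite -/N F01 mulr1.
rewrite /B IntD; [|by apply: intbleD; [exact: intbleZ|exact: intble_cst]|exact: intbleZ].
rewrite IntD; [|exact: intbleZ|exact: intble_cst].
rewrite Int_prob_cst (IntZ _ iB1) (IntZ _ iW) (IntZ _ iB3).
rewrite Int_hermite2_sqr in hh.
have -> : \int[P]_w (h w ^+ 2 / Lr) = Lr^-1 * \int[P]_w h w ^+ 2.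
  by rewrite -IntZ//; apply: eq_Rintegral => w _; rewrite mulrC.
have LV0 : 0 <= Lr^-1 by rewrite invr_ge0 ltW.
have h1 := ler_wpM2l LV0 hh.
have h2 := ler_wpM2l (ler0n R K.+1) hW.
rewrite expr2; move: h1 h2; rewrite /h.
move: (\int[P]_w W w) (\int[P]_w _ ^+ 2) => X1 X2 h1 h2.
lra.
Qed.

End tail_bound.

(** * Numerical constants and the final tail bounds *)

Section constants.
Variable R : realType.
Implicit Types l : nat.

(** From ln(1/2) <= -1/2. It lets absolute constants be absorbed into powers of ln l, in particular
    through 1 <= 8 ln^3 l. *)
Lemma ln_nat_ge l : (1 < l)%N -> 1 / 2 <= ln (l%:R : R).
Proof.
move=> l1; have l2 : ln (2 : R) <= ln (l%:R : R).
  by rewrite ler_ln ?posrE ?ltr0n ?(ltnW l1)// ler_nat.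
apply: le_trans l2.
have := @le_ln1Dx R (- (1 / 2)); rewrite (_ : 1 + - (1 / 2) = 2^-1 :> R); last by field.
rewrite lnV ?posrE// => h.
lra.
Qed.

(** As ln(2 l^2) <= 3 ln l, the two moment bounds add up to l^-2 times 2101 ln l + 14/3, and 14/3 <=
    (28/3) ln l. *)
Lemma pint_excess_le l : (1 < l)%N -> pint_excess R l <= 2111 * ln (l%:R : R) / l%:R ^+ 2.
Proof.
move=> l1; have l0 : (0 < l)%N := ltnW l1.
have lr0 : 0 < (l%:R : R) by rewrite ltr0n.
have L1 := ln_nat_ge l1; have L2 : ln (2 : R) <= ln (l%:R : R).
  by rewrite ler_ln ?posrE ?ltr0n// ler_nat.
have E : ln (2 * l%:R ^+ 2) <= 3 * ln (l%:R : R).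
  rewrite lnM ?posrE ?exprn_gt0// lnXn ?posrE// mulr2n; lra.
have := pint_legendre3 R l0; have := pint_legendre4 R l0; rewrite /pint_excess.
have i0 : 0 < (l%:R ^+ 2 : R)^-1 by rewrite invr_gt0 exprn_gt0.
move=> h4 h3; apply: (le_trans (lerD h3 h4)); move: E i0; clear h3 h4.
move: (ln (2 * _)) ((l%:R ^+ 2)^-1 : R) (ln (l%:R : R)) L1 => X I L L1 E i0.
have : 0 <= I * (3 * L - X) by apply: mulr_ge0; lra.
have : 0 <= I * (L - 1 / 2) by apply: mulr_ge0; lra.
lra.
Qed.

(** From 2^(k-1) < l and ln 2 >= 1/2 one gets k <= 2 ln l + 1, so 3 k + 3 <= 6 ln l + 6, and 6 <= 12
    ln l. *)
Lemma up_log_le l : (1 < l)%N -> (3 * up_log 2 l + 2).+1%:R <= 18 * ln (l%:R : R).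
Proof.
move=> l1; have L1 := ln_nat_ge l1; have L2 := ln_nat_ge (ltnSn 1).
have /andP[h _] := up_log_bounds (ltnSn 1) l1.
have : ln (2 ^+ (up_log 2 l).-1 : R) <= ln (l%:R : R).
  rewrite ler_ln ?posrE ?exprn_gt0 ?ltr0n ?(ltnW l1)//.
  by rewrite -natrX ler_nat ltnW.
rewrite lnXn// -[leLHS]mulr_natl => h1.
have h2 : (up_log 2 l)%:R <= (up_log 2 l).-1%:R + 1 :> R by rewrite natr1 ler_nat leqSpred.
rewrite -natr1 natrD natrM.
have : (up_log 2 l).-1%:R * (1 / 2) <= (up_log 2 l).-1%:R * ln (2 : R) by apply: ler_wpM2l.
lra.
Qed.

End constants.

(** Two logarithms come from the squared number of chaining levels and one from [pint_excess], whose
    l^-2 becomes 1/l through the factor l in [kappa]. *)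
Lemma sup_S_quadratic_tail (R : realType) : exists C : R, 0 < C /\
  forall l : nat, (2 <= l)%N ->
  forall (d : measure_display) (T : measurableType d) (P : probability T R)
    (a : int -> T -> R[i]), harmonic_coefficients P l a ->
  forall eps : R, 0 < eps ->
     (P [set w | (eps%:E < sup_S l a w)%E] <=
      (C / l%:R * (ln l%:R ^+ 3 / eps ^+ 2))%:E)%E.
Proof.
(* One summand for each term of [sup_S_tail]; the factors 8 come from 1 <= 8 ln^3 l. *)
pose c : R := 3 * 18 ^+ 2 * 32 * 2111 + 48 * 8 + 96 * 8.
exists (c * pi ^+ 2); have p0 : 0 < pi ^+ 2 :> R by rewrite exprn_gt0// pi_gt0.
split; first by rewrite mulr_gt0// /c; lra.
move=> l l1 d T P a H eps eps0; apply: (le_trans (sup_S_tail l1 H eps0)).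
have L1 := ln_nat_ge R l1; have k1 := up_log_le R l1; have e1 := pint_excess_le R l1.
have lr1 : 1 <= (l%:R : R) by rewrite ler1n ltnW.
have lr0 : 0 < (l%:R : R) by lra.
have ex0 : 0 <= pint_excess R l by rewrite addr_ge0.
rewrite lee_fin [leRHS]mulrA; apply: ler_wpM2r; first by rewrite invr_ge0 sqr_ge0.
set K := (3 * up_log 2 l + 2).+1%:R : R in k1 *.
have K0 : 0 <= K by rewrite ler0n.
clearbody K; move: (ln (l%:R : R)) L1 k1 e1 => L L1 k1 e1.
have K2 : K ^+ 2 <= 18 ^+ 2 * L ^+ 2 by rewrite -exprMn lerXn2r// nnegrE; lra.
have L3 : 1 <= 8 * L ^+ 3.
  have -> : 8 * L ^+ 3 = (2 * L) ^+ 3 by ring.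
  by rewrite exprn_ege1//; lra.
have t1 : K ^+ 2 * (l%:R * (32 * pi ^+ 2 * pint_excess R l)) <=
    18 ^+ 2 * 32 * 2111 * (pi ^+ 2 * L ^+ 3 / l%:R).
  apply: (@le_trans _ _ ((18 ^+ 2 * L ^+ 2) * (l%:R * (32 * pi ^+ 2 * (2111 * L / l%:R ^+ 2))))).
    have q0 : 0 <= 32 * pi ^+ 2 :> R by apply: mulr_ge0 => //; exact: ltW.
    apply: ler_pM => //; first exact: sqr_ge0.
      by apply: mulr_ge0; [exact: ltW|exact: mulr_ge0].
    by apply: ler_wpM2l; [exact: ltW|exact: ler_wpM2l].
  by rewrite le_eqVlt; apply/orP; left; apply/eqP; field; exact: lt0r_neq0.
have t2 : 48 * pi ^+ 2 / l%:R ^+ 3 <= 48 * 8 * (pi ^+ 2 * L ^+ 3 / l%:R).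
  apply: (@le_trans _ _ (48 * pi ^+ 2 / l%:R)).
    apply: ler_wpM2l; first by rewrite mulr_ge0// ltW.
    by rewrite lef_pV2 ?posrE ?exprn_gt0// -[leLHS]expr1 ler_weXn2l.
  have -> : 48 * 8 * (pi ^+ 2 * L ^+ 3 / l%:R) = 48 * pi ^+ 2 / l%:R * (8 * L ^+ 3) by field; exact: lt0r_neq0.
  by rewrite ler_peMr//; apply: divr_ge0; [apply: mulr_ge0 => //; exact: ltW|exact: ltW].
have t3 : 96 * pi ^+ 2 / l%:R <= 96 * 8 * (pi ^+ 2 * L ^+ 3 / l%:R).
  have -> : 96 * 8 * (pi ^+ 2 * L ^+ 3 / l%:R) = 96 * pi ^+ 2 / l%:R * (8 * L ^+ 3) by field; exact: lt0r_neq0.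
  by rewrite ler_peMr//; apply: divr_ge0; [apply: mulr_ge0 => //; exact: ltW|exact: ltW].
have -> : c * pi ^+ 2 / l%:R * L ^+ 3 = c * (pi ^+ 2 * L ^+ 3 / l%:R) by field; exact: lt0r_neq0.
rewrite /c; move: t1 t2 t3; move: (pi ^+ 2 * L ^+ 3 / l%:R) (K ^+ 2 * _) (48 * pi ^+ 2 / _) (96 * pi ^+ 2 / _) => X A B D.
lra.
Qed.

Theorem lemma4p2 (R : realType) :
  exists C : R, 0 < C /\
  forall l : nat, (2 <= l)%N ->
  forall (d : measure_display) (T : measurableType d) (P : probability T R)
    (a : int -> T -> R[i]), harmonic_coefficients P l a ->
  (forall eps : R, 0 < eps <= 1 ->
     (P [set w | eps%:E < sup_S l a w] <=
      (C / l%:R * (ln l%:R ^+ 6 / eps ^+ 3))%:E)%E) /\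
  (forall eps : R, 1 <= eps ->
     (P [set w | eps%:E < sup_S l a w] <=
      (C / l%:R * (eps `^ (- (4 / 3)) + ln l%:R ^+ 6 / eps `^ (7 / 3)))%:E)%E).
Proof.
(* The factor 8 raises ln^3 l to ln^6 l in the regime eps <= 1, again by 1 <= 8 ln^3 l. *)
have [C [C0 hC]] := sup_S_quadratic_tail R; exists (8 * C); split; first by rewrite mulr_gt0.
move=> l l1 d T P a H; have {hC} hC := hC l l1 d T P a H.
have L1 := ln_nat_ge R l1.
have lr0 : 0 < (l%:R : R) by rewrite ltr0n ltnW.
have Cl : 0 <= C / l%:R by rewrite divr_ge0// ltW.
have -> : 8 * C / l%:R = C / l%:R * 8 by ring.
split=> eps.
  move=> /andP[eps0 eps1]; apply: (le_trans (hC eps eps0)).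
  rewrite lee_fin -[leRHS]mulrA; apply: ler_wpM2l => //.
  move: (ln _) L1 => L L1.
  have L3 : 1 <= 8 * L ^+ 3.
    have -> : 8 * L ^+ 3 = (2 * L) ^+ 3 by ring.
    by rewrite exprn_ege1//; lra.
  have -> : 8 * (L ^+ 6 / eps ^+ 3) = L ^+ 3 / eps ^+ 2 * (8 * L ^+ 3 / eps) by field; exact: lt0r_neq0.
  rewrite ler_peMr//; first by rewrite divr_ge0// ?exprn_ge0 ?ltW//; lra.
  by rewrite ler_pdivlMr// mul1r (le_trans eps1).
move=> eps1; have eps0 : 0 < eps by lra.
apply: (le_trans (hC eps eps0)).
rewrite lee_fin -[leRHS]mulrA; apply: ler_wpM2l => //.
move: (ln _) L1 => L L1.
(* x^2 and y^2 are the two terms of the bound. Since eps >= 1, x y = L^3 eps^(-11/6) is at least L^3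
   / eps^2, and x y <= (x^2 + y^2) / 2. *)
pose x := eps `^ (- (2 / 3)); pose y := L ^+ 3 * eps `^ (- (7 / 6)).
have x2 : eps `^ (- (4 / 3)) = x ^+ 2.
  by rewrite /x -powR_mulrn ?powR_ge0// -powRrM; congr (_ `^ _); field.
have y2 : L ^+ 6 / eps `^ (7 / 3) = y ^+ 2.
  rewrite /y exprMn -exprM -powRN -(powR_mulrn 2 (powR_ge0 _ _)) -powRrM.
  by congr (_ * _ `^ _); field.
have xy : L ^+ 3 / eps ^+ 2 <= x * y.
  rewrite /x /y mulrCA -powRD; last by apply/implyP => _; rewrite gt_eqF.
  apply: ler_wpM2l; first by rewrite exprn_ge0//; lra.
  have -> : (eps ^+ 2)^-1 = eps `^ (- 2%:R) by rewrite powRN powR_mulrn// ltW.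
  by apply: ler_powR => //; lra.
rewrite x2 y2; have := sqr_ge0 (x - y); have := sqr_ge0 (x + y).
clearbody x y; move: (L ^+ 3 / eps ^+ 2) xy => q xy.
have := sqr_ge0 x; have := sqr_ge0 y; lra.
Qed.
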